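(* Let $(X, \|\cdot\|)$ be a Banach space, and let $X_1, \ldots, X_n \in X$. Let $\{Y_i\}_{i=1}^{\infty}$ be a stationary Markov chain with state space $[N]$, transition matrix $A$, stationary probability measure $\pi$, and averaging operator $E_{\pi}$, so that $Y_1$ is distributed according to $\pi$. Let $\lambda = \|A-E_{\pi}\|_{L_2(\pi) \rightarrow L_2(\pi)}$, and let $f_1, \ldots, f_n: [N] \rightarrow [-1, 1]$ be such that $\mathbb{E}[f_i(Y_i)] = 0$ for all $i$. Then there exist universal constants $C$ and $L$, such that for any $u \geq 0$, \[ \Pr\Big[\left\|f_1(Y_1)X_1+\cdots+f_n(Y_n)X_n\right\| \geq u\,C\,\mathbb{E}\big[\|g_1X_1 + \cdots + g_n X_n\|\big]\Big] \leq L\exp(-Cu^2(1-\lambda)), \] where $g_1, \ldots, g_n \sim \mathcal{N}(0, 1)$ are independent standard Gaussian random variables.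
   Context: $[N]=\{1,\ldots,N\}$. The transition matrix $A\in\mathbb{R}^{N\times N}$ is row-stochastic, with $A_{ij}$ the probability of moving from $i$ to $j$, and $\pi$ is a probability distribution on $[N]$ with positive entries satisfying $\sum_i \pi_i A_{ij}=\pi_j$ for all $j$. The chain is not assumed to be reversible. The averaging operator $E_\pi\in\mathbb{R}^{N\times N}$ is the matrix $(E_\pi)_{ij}=\pi_j$. For $v\in\mathbb{R}^N$, $\|v\|_{L_2(\pi)}=\left(\sum_{i=1}^N \pi_i |v_i|^2\right)^{1/2}$, and for $T\in\mathbb{R}^{N\times N}$, $\|T\|_{L_2(\pi)\to L_2(\pi)}=\max_{v:\|v\|_{L_2(\pi)}=1}\|Tv\|_{L_2(\pi)}$. ''Universal'' means that $C$ and $L$ do not depend on the Banach space, $n$, the $X_i$, the Markov chain, the $f_i$, or $u$.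
   Formalization: The formal theorem assumes that at least one X_i is non-zero; if all X_i = 0, the event is {0 ≥ 0}, which has probability 1 for every u, while the right-hand side tends to 0 as u grows whenever λ < 1. *)

(* Defs.v *)
From mathcomp Require Import all_boot all_order all_algebra.
From mathcomp Require Import all_classical all_reals all_analysis.

Set Implicit Arguments.
Unset Strict Implicit.
Unset Printing Implicit Defensive.

Import Order.TTheory GRing.Theory Num.Theory.
Import numFieldNormedType.Exports.

Local Open Scope classical_set_scope.
Local Open Scope ring_scope.

Definition row_stochastic (R : realType) (N : nat) (A : 'M[R]_N) : Prop :=
  (forall i j, 0 <= A i j) /\ (forall i, \sum_j A i j = 1).

Definition positive_distribution (R : realType) (N : nat) (p : 'I_N -> R) :
    Prop :=
  (forall i, 0 < p i) /\ \sum_i p i = 1.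

Definition stationary_distribution (R : realType) (N : nat) (A : 'M[R]_N)
    (p : 'I_N -> R) : Prop :=
  forall j, \sum_i p i * A i j = p j.

Definition averaging_mx (R : realType) (N : nat) (p : 'I_N -> R) : 'M[R]_N :=
  \matrix_(i, j) p j.

Definition L2norm (R : realType) (N : nat) (p : 'I_N -> R) (v : 'cV[R]_N) : R :=
  Num.sqrt (\sum_i p i * `|v i ord0| ^+ 2).

(* The set is compact, and nonempty as soon as p is a positive distribution,
   so that this supremum is a maximum. *)
Definition L2opnorm (R : realType) (N : nat) (p : 'I_N -> R) (T : 'M[R]_N) : R :=
  sup [set L2norm p (T *m v) | v in [set v : 'cV[R]_N | L2norm p v = 1]].

(* Y k stands for Y_{k+1}. The last clause is the Markov property
     P(Y_{k+1} = x_{k+1} | Y_0 = x_0, ..., Y_k = x_k) = A x_k x_{k+1}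
   multiplied by the probability of the conditioning event, so that it is
   automatically true when that event is null. *)
Definition markov_chain (R : realType) (N : nat) (A : 'M[R]_N) (p : 'I_N -> R)
    (d : measure_display) (W : measurableType d) (P : probability W R)
    (Y : nat -> W -> 'I_N) : Prop :=
  [/\ forall k s, measurable (Y k @^-1` [set s]),
      forall s, P (Y 0%N @^-1` [set s]) = (p s)%:E
    & forall (k : nat) (x : nat -> 'I_N),
        P [set w | forall i, (i <= k.+1)%N -> Y i w = x i] =
        (P [set w | forall i, (i <= k)%N -> Y i w = x i]
         * (A (x k) (x k.+1))%:E)%E].

Definition mutually_independent (R : realType) (d : measure_display)
    (W : measurableType d) (P : probability W R) (I : finType)
    (g : I -> {RV P >-> R}) : Prop :=
  forall (J : {set I}) (B : I -> set R), (forall i, measurable (B i)) ->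
    P [set w | forall i, i \in J -> B i (g i w)] =
    (\prod_(i in J) P (g i @^-1` B i))%E.
Arguments mutually_independent {R d W} P {I} g.

Definition standard_gaussian (R : realType) (d : measure_display)
    (W : measurableType d) (P : probability W R) (X : {RV P >-> R}) : Prop :=
  forall B : set R, measurable B -> distribution P X B = normal_prob 0 1 B.
Arguments standard_gaussian {R d W} P X.

(* Main.v *)
(** Since conditioning on one step contracts centred functions by lambda in L2(pi),
    multiplying by exp(a f_i) between two steps costs at most exp(36 a^2 / (1 - lambda))
    in the norm of L2(pi).  Hence xi = (f_i(Y_i))_i is subgaussian:
    E exp<v, xi> <= exp(36 |v|^2 / (1 - lambda)).

    It remains to compare a subgaussian vector with a Gaussian one in an arbitrary
    norm N, which is the majorizing measure theorem.  The norm N of each of the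
    finitely many values of xi is attained by a single linear functional
    (Hahn-Banach); van Handel's contraction argument, which rests on the Sudakov
    inequality and on concentration of measure, produces partitions of this finite
    set of functionals whose weighted diameters add up to at most a constant times
    the expected supremum, and chaining along them gives the tail bound.

    All Gaussian estimates are carried out for a symmetric random walk with small
    steps along the coordinate axes, for which they are finite computations.  The
    passage to the Gaussian vector is a comparison in the convex order: each
    coordinate of the Gaussian vector is rounded to a grid, and the walk, scaled by a
    small constant, is dominated coordinate by coordinate by the rounded Gaussian. *)

Require Import Defs.
From mathcomp Require Import all_boot all_order all_algebra.
From mathcomp Require Import all_classical all_reals all_analysis.
From mathcomp Require Import measurable_realfun ring lra zify.

Import Order.TTheory GRing.Theory Num.Theory.
Import numFieldNormedType.Exports.

Local Open Scope ring_scope.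

(** * Random walks with small steps *)

(** The functionals form a finite set, so finitely many levels of chaining suffice, and the step [h]
    of the walk is chosen once their number is known. A small step keeps the weights of a drifted
    walk nonnegative and allows exponentials to be expanded to second order over one round. No limit
    h -> 0 is taken: under h^2 M = 1 all constants are independent of [h], including the one in the
    comparison with the Gaussian vector, of which only a lower bound on its mean norm is wanted.

    Partitions of level m have at most 2^(4^m) cells, so that the chaining weights are 2^m rather
    than 2^(m/2).

    One constant has to serve in the threshold and in the exponent. Chaining gives the tail exp(-
    v^2) at a threshold K v / sqrt(1 - lambda), in units of the Gaussian mean. Taking v = K0 u
    sqrt(1 - lambda) cancels the square root there and produces 1 - lambda in the exponent; then C =
    K0^2 works as soon as K0 > K. *)

Section Euclidean.
Context {R : realType} {n : nat}.
Implicit Types (u v x y z : 'rV[R]_n) (a : R).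

Definition dot u v : R := \sum_k u 0 k * v 0 k.

Definition enorm u : R := Num.sqrt (dot u u).

Lemma dotC u v : dot u v = dot v u.
Proof. by apply: eq_bigr => k _; rewrite mulrC. Qed.

Lemma dotDl u v x : dot (u + v) x = dot u x + dot v x.
Proof. by rewrite -big_split; apply: eq_bigr => k _; rewrite mxE mulrDl. Qed.

Lemma dotZl a u v : dot (a *: u) v = a * dot u v.
Proof. by rewrite mulr_sumr; apply: eq_bigr => k _; rewrite mxE mulrA. Qed.

Lemma dotNl u v : dot (- u) v = - dot u v.
Proof. by rewrite -scaleN1r dotZl mulN1r. Qed.

Lemma dotBl u v x : dot (u - v) x = dot u x - dot v x.
Proof. by rewrite dotDl dotNl. Qed.

Lemma dot0l u : dot 0 u = 0.
Proof. by rewrite -(scale0r u) dotZl mul0r. Qed.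

Lemma dotDr u v x : dot x (u + v) = dot x u + dot x v.
Proof. by rewrite dotC dotDl !(dotC x). Qed.

Lemma dotZr a u v : dot u (a *: v) = a * dot u v.
Proof. by rewrite dotC dotZl dotC. Qed.

Lemma dotNr u v : dot u (- v) = - dot u v.
Proof. by rewrite dotC dotNl dotC. Qed.

Lemma dotBr u v x : dot x (u - v) = dot x u - dot x v.
Proof. by rewrite dotDr dotNr. Qed.

Lemma dot0r u : dot u 0 = 0.
Proof. by rewrite dotC dot0l. Qed.

Lemma dot_ge0 u : 0 <= dot u u.
Proof. by apply: sumr_ge0 => k _; rewrite -expr2 sqr_ge0. Qed.

Lemma dot_delta u k : dot u (delta_mx 0 k) = u 0 k.
Proof.
rewrite /dot (bigD1 k) //= mxE !eqxx mulr1 big1 ?addr0 // => j jk.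
by rewrite mxE (negbTE jk) mulr0.
Qed.

Lemma dot_eq0 u : dot u u = 0 -> u = 0.
Proof.
move=> /eqP; rewrite psumr_eq0 => [/allP u0|k _]; last by rewrite -expr2 sqr_ge0.
apply/rowP => k; rewrite mxE; apply/eqP.
by have := u0 k (mem_index_enum _); rewrite mulf_eq0 orbb.
Qed.

Lemma dot_CauchySchwarz u v : dot u v ^+ 2 <= dot u u * dot v v.
Proof.
have [v0|v0] := eqVneq (dot v v) 0; first by rewrite (dot_eq0 v v0) !dot0r expr0n mulr0.
have vp : 0 < dot v v by rewrite lt_def v0 dot_ge0.
have := dot_ge0 (dot v v *: u - dot u v *: v).
rewrite dotBl !dotBr !dotZl !dotZr (dotC v u) => h.
have : 0 <= dot v v * (dot u u * dot v v - dot u v ^+ 2) by lra.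
by rewrite pmulr_rge0 // subr_ge0.
Qed.

Lemma enorm_ge0 u : 0 <= enorm u.
Proof. exact: sqrtr_ge0. Qed.

Lemma enorm_sqr u : enorm u ^+ 2 = dot u u.
Proof. by rewrite sqr_sqrtr ?dot_ge0. Qed.

Lemma enorm_le u a : 0 <= a -> dot u u <= a ^+ 2 -> enorm u <= a.
Proof. by move=> a0 h; rewrite -(@ler_pXn2r _ 2) ?nnegrE ?enorm_ge0 // enorm_sqr. Qed.

Lemma dot_le u v : dot u v <= enorm u * enorm v.
Proof.
apply: le_trans (ler_norm _) _.
rewrite -(@ler_pXn2r _ 2) ?nnegrE ?mulr_ge0 ?enorm_ge0 //.
by rewrite real_normK ?num_real // exprMn !enorm_sqr dot_CauchySchwarz.
Qed.

Lemma enormN u : enorm (- u) = enorm u.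
Proof. by rewrite /enorm dotNl dotNr opprK. Qed.

Lemma enorm0 : enorm 0 = 0.
Proof. by rewrite /enorm dot0l sqrtr0. Qed.

Lemma enormD u v : enorm (u + v) <= enorm u + enorm v.
Proof.
apply: enorm_le; first by rewrite addr_ge0 ?enorm_ge0.
rewrite dotDl !dotDr (dotC v u) sqrrD !enorm_sqr.
have := dot_le u v; lra.
Qed.

Lemma enormBC u v : enorm (u - v) = enorm (v - u).
Proof. by rewrite -enormN opprB. Qed.

Lemma enorm_triangle u v x : enorm (u - x) <= enorm (u - v) + enorm (v - x).
Proof. by apply: le_trans (enormD _ _); rewrite addrA subrK. Qed.

Lemma enormZ a u : 0 <= a -> enorm (a *: u) = a * enorm u.
Proof.
move=> a0; rewrite /enorm dotZl dotZr mulrA -expr2 sqrtrM ?sqr_ge0 //.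
by rewrite sqrtr_sqr ger0_norm.
Qed.

Lemma enorm_delta k : enorm (delta_mx 0 k) = 1.
Proof. by rewrite /enorm dot_delta mxE !eqxx sqrtr1. Qed.

End Euclidean.

(** * Convex functions along the walk *)

Section Walk.
Context {R : realType} {n : nat}.
Implicit Types (s x y z : 'rV[R]_n) (h : R) (F : 'rV[R]_n -> R) (ks : seq 'I_n)
  (G : 'rV[R]_n -> 'rV[R]_n).

Definition bstep h s (k : 'I_n) F x : R :=
  ((1 + h * s 0 k) * F (x + h *: delta_mx 0 k)
   + (1 - h * s 0 k) * F (x - h *: delta_mx 0 k)) / 2.

(* The expectation of F at the end point of the walk started from x that moves
   by +h or -h along the successive coordinates in ks, the move in coordinate k
   having mean h^2 * s_k. *)
Definition walk h s ks F : 'rV[R]_n -> R := foldr (bstep h s) F ks.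

Definition small_drift h s := forall k, `|h * s 0 k| <= 1.

Lemma small_drift0 h : small_drift h 0.
Proof. by move=> k; rewrite mxE mulr0 normr0. Qed.

Lemma walk_cat h s ks ks' F :
  walk h s (ks ++ ks') F = walk h s ks (walk h s ks' F).
Proof. by rewrite /walk foldr_cat. Qed.

(** Every path stays within h * size ks of its start, so the functions need only be compared there.
    This locality later permits the second-order expansion of the exponential. *)
Lemma walk_le h s ks F1 F2 x : 0 <= h -> small_drift h s ->
  (forall z, enorm (z - x) <= h * (size ks)%:R -> F1 z <= F2 z) ->
  walk h s ks F1 x <= walk h s ks F2 x.
Proof.
move=> h0 sd; elim: ks x => [|k ks IH] x le12 /=.
  by apply: le12; rewrite subrr enorm0 mulr0.
have := sd k; rewrite ler_norml => /andP[sk1 sk2].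
have le_pm (b : R) : `|b| = h ->
    walk h s ks F1 (x + b *: delta_mx 0 k) <= walk h s ks F2 (x + b *: delta_mx 0 k).
  move=> bh; apply: IH => z zx; apply: le12.
  apply: le_trans (enorm_triangle _ (x + b *: delta_mx 0 k) _) _.
  have -> : x + b *: delta_mx 0 k - x = b *: delta_mx 0 k by rewrite addrAC subrr add0r.
  have -> : enorm (b *: delta_mx 0 k : 'rV[R]_n) = h.
    have [b0|b0] := leP 0 b; first by rewrite enormZ // enorm_delta mulr1 -bh ger0_norm.
    by rewrite -enormN -scaleNr enormZ ?enorm_delta ?mulr1 ?oppr_ge0 ?ltW // -bh ltr0_norm.
  by rewrite -natr1 mulrDr mulr1 lerD2r.
rewrite /bstep ler_pM2r ?invr_gt0 // -(scaleNr h (delta_mx 0 k)); apply: lerD.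
  by apply: ler_wpM2l; [lra|apply: le_pm; rewrite ger0_norm].
by apply: ler_wpM2l; [lra|apply: le_pm; rewrite normrN ger0_norm].
Qed.

Lemma ler_walk h s ks F1 F2 x : 0 <= h -> small_drift h s ->
  (forall z, F1 z <= F2 z) -> walk h s ks F1 x <= walk h s ks F2 x.
Proof. by move=> h0 sd le12; apply: walk_le. Qed.

Lemma eq_walk h s ks F1 F2 x : F1 =1 F2 -> walk h s ks F1 x = walk h s ks F2 x.
Proof. by move=> e; elim: ks x => [|k ks IH] x /=; rewrite ?e // /bstep !IH. Qed.

Lemma walk_lin h s ks a b F1 F2 x :
  walk h s ks (fun z => a * F1 z + b * F2 z) x
  = a * walk h s ks F1 x + b * walk h s ks F2 x.
Proof. by elim: ks x => [|k ks IH] x //=; rewrite /bstep !IH; ring. Qed.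

Lemma walk_cst h s ks (c : R) x : walk h s ks (fun=> c) x = c.
Proof. by elim: ks x => [|k ks IH] x //=; rewrite /bstep !IH; field. Qed.

Lemma walkD h s ks F1 F2 x :
  walk h s ks (fun z => F1 z + F2 z) x = walk h s ks F1 x + walk h s ks F2 x.
Proof.
rewrite -[walk _ _ _ F1 _]mul1r -[walk _ _ _ F2 _]mul1r -walk_lin.
by apply: eq_walk => z; rewrite !mul1r.
Qed.

Lemma walkZ h s ks (c : R) F x :
  walk h s ks (fun z => c * F z) x = c * walk h s ks F x.
Proof.
rewrite -[RHS]addr0 -(mul0r (walk h s ks F x)) -walk_lin.
by apply: eq_walk => z; rewrite mul0r addr0.
Qed.

Lemma walkB h s ks F1 F2 x :
  walk h s ks (fun z => F1 z - F2 z) x = walk h s ks F1 x - walk h s ks F2 x.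
Proof.
rewrite -[- walk h s ks F2 x]mulN1r -walkZ -walkD.
by apply: eq_walk => z; rewrite mulN1r.
Qed.

Lemma walk_sum (I : Type) (r : seq I) (Q : pred I) h s ks (F : I -> 'rV[R]_n -> R) x :
  walk h s ks (fun z => \sum_(i <- r | Q i) F i z) x
  = \sum_(i <- r | Q i) walk h s ks (F i) x.
Proof.
elim: r => [|i r IH].
  by rewrite big_nil -[RHS](walk_cst h s ks 0 x); apply: eq_walk => z; rewrite big_nil.
rewrite big_cons -IH; case: ifP => Qi.
  by rewrite -walkD; apply: eq_walk => z; rewrite big_cons Qi.
by apply: eq_walk => z; rewrite big_cons Qi.
Qed.

Lemma walk_shift h s ks F c x :
  walk h s ks (fun z => F (z + c)) x = walk h s ks F (x + c).
Proof.
elim: ks x => [|k ks IH] x //=; rewrite /bstep !IH.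
by rewrite (addrAC x c) (addrAC x c).
Qed.

Lemma walk_dot h s ks y x :
  walk h s ks (dot y) x = dot y x + h ^+ 2 * \sum_(k <- ks) s 0 k * y 0 k.
Proof.
elim: ks x => [|k ks IH] x /=; first by rewrite big_nil mulr0 addr0.
by rewrite /bstep !IH big_cons dotDr dotBr !dotZr !dot_delta; field.
Qed.

Lemma walk_sqr_ge h s ks F x : 0 <= h -> small_drift h s ->
  walk h s ks F x ^+ 2 <= walk h s ks (fun z => F z ^+ 2) x.
Proof.
move=> h0 sd; set m := walk h s ks F x.
have : 0 <= walk h s ks (fun z => (F z - m) ^+ 2) x.
  rewrite -(walk_cst h s ks 0 x); apply: ler_walk => // z; exact: sqr_ge0.
have -> : walk h s ks (fun z => (F z - m) ^+ 2) x
    = walk h s ks (fun z => F z ^+ 2 + ((- 2 * m) * F z + m ^+ 2 * 1)) x.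
  by apply: eq_walk => z; ring.
rewrite walkD walk_lin walk_cst -/m; lra.
Qed.

(** Convexity of [F], carried as a choice [G] of subgradients. In this form it survives averaging
    over the walk, and a bound on [enorm (G z)] is a Lipschitz constant. *)
Definition subgradient F G := forall x z, F x + dot (G x) (z - x) <= F z.

Definition vwalk h s ks G x := \row_k walk h s ks (fun z => G z 0 k) x.

Lemma dot_vwalk h s ks G x y :
  dot (vwalk h s ks G x) y = walk h s ks (fun z => dot (G z) y) x.
Proof.
rewrite /dot walk_sum; apply: eq_bigr => k _.
by rewrite mxE mulrC -walkZ; apply: eq_walk => z; rewrite mulrC.
Qed.

Lemma subgradient_walk h s ks F G : 0 <= h -> small_drift h s ->
  subgradient F G -> subgradient (walk h s ks F) (vwalk h s ks G).
Proof.
move=> h0 sd sg x z; rewrite dot_vwalk -walkD.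
have -> : walk h s ks F z = walk h s ks (fun y => F (y + (z - x))) x.
  by rewrite walk_shift subrKC.
apply: ler_walk => // y; have := sg y (y + (z - x)).
by rewrite (addrAC y) subrr add0r.
Qed.

Lemma enorm_vwalk h s ks G (d : R) x : 0 <= h -> small_drift h s -> 0 <= d ->
  (forall z, enorm (G z) <= d) -> enorm (vwalk h s ks G x) <= d.
Proof.
move=> h0 sd d0 Gd; apply: enorm_le => //.
rewrite -(walk_cst h s ks (d ^+ 2) x).
apply: le_trans (_ : walk h s ks (fun z => dot (G z) (G z)) x <= _); last first.
  apply: ler_walk => // z; rewrite -enorm_sqr ler_pXn2r ?nnegrE ?enorm_ge0 //.
rewrite walk_sum; apply: ler_sum => k _; rewrite mxE -expr2.
apply: le_trans (walk_sqr_ge _ _ _ _ _ h0 sd) _.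
by apply: ler_walk => // z; rewrite expr2.
Qed.

Lemma subgradient_lipschitz F G (d : R) x z : subgradient F G ->
  (forall z, enorm (G z) <= d) -> `|F z - F x| <= d * enorm (z - x).
Proof.
move=> sg Gd; rewrite ler_norml.
have h1 := sg x z; have h2 := sg z x.
have e1 := dot_le (- G x) (z - x); have e2 := dot_le (- G z) (x - z).
rewrite !dotNl !enormN (enormBC x) in e1 e2.
have k1 : enorm (G x) * enorm (z - x) <= d * enorm (z - x).
  by apply: ler_wpM2r (Gd x); exact: enorm_ge0.
have k2 : enorm (G z) * enorm (z - x) <= d * enorm (z - x).
  by apply: ler_wpM2r (Gd z); exact: enorm_ge0.
lra.
Qed.

(** Variance is decomposed over the steps: one step contributes ((a - b) / 2)^2, with a and b the
    averages at its two ends. A convex function rises at most with the slope at its higher end, so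
    |a - b| is at most 2 h times one of the end slopes; Jensen's inequality moves the squared slope
    inside the remaining walk. *)
Lemma walk_Poincare h ks F G x : 0 <= h -> subgradient F G ->
  walk h 0 ks (fun z => F z ^+ 2) x - walk h 0 ks F x ^+ 2
  <= 2 * h ^+ 2 * walk h 0 ks (fun z => \sum_(k <- ks) G z 0 k ^+ 2) x.
Proof.
move=> h0 sg; have sd := @small_drift0 h.
elim: ks x => [|k ks IH] x /=.
  by rewrite big_nil mulr0 subrr.
set xp := x + h *: delta_mx 0 k; set xm := x - h *: delta_mx 0 k.
have sum_cons z : walk h 0 ks (fun z => \sum_(j <- k :: ks) G z 0 j ^+ 2) z =
    walk h 0 ks (fun z => G z 0 k ^+ 2) z
    + walk h 0 ks (fun z => \sum_(j <- ks) G z 0 j ^+ 2) z.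
  by rewrite -walkD; apply: eq_walk => y; rewrite big_cons.
have sgW := subgradient_walk h 0 ks _ _ h0 sd sg.
rewrite /bstep mxE mulr0 addr0 subr0 !mul1r -/xp -/xm !sum_cons.
have := IH xp; have := IH xm.
have := walk_sqr_ge h 0 ks (fun z => G z 0 k) xp h0 sd.
have := walk_sqr_ge h 0 ks (fun z => G z 0 k) xm h0 sd.
have := sgW xp xm; have := sgW xm xp.
have -> : xm - xp = (- (2 * h)) *: delta_mx 0 k.
  by apply/rowP => j; rewrite !mxE; ring.
have -> : xp - xm = (2 * h) *: delta_mx 0 k.
  by apply/rowP => j; rewrite !mxE; ring.
rewrite !dotZr !dot_delta !mxE.
set gp := walk h 0 ks (fun z => G z 0 k) xp; set gm := walk h 0 ks (fun z => G z 0 k) xm.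
set a := walk h 0 ks F xp; set b := walk h 0 ks F xm.
set Ap := walk _ _ _ _ xp; set Am := walk _ _ _ _ xm.
set Bp := walk _ _ _ _ xp; set Bm := walk _ _ _ _ xm.
set Cp := walk _ _ _ _ xp; set Cm := walk _ _ _ _ xm.
move=> le1 le2 jm jp im ip.
have h2 : 0 <= h ^+ 2 by exact: sqr_ge0.
have ab : (a - b) ^+ 2 <= 4 * h ^+ 2 * (gp ^+ 2 + gm ^+ 2).
  have [ab|ab] := leP b a.
    have : (a - b) ^+ 2 <= (2 * h * gp) ^+ 2.
      by rewrite ler_pXn2r ?nnegrE //; lra.
    have : 0 <= h ^+ 2 * gm ^+ 2 by rewrite mulr_ge0 ?sqr_ge0.
    lra.
  have : (b - a) ^+ 2 <= (- (2 * h * gm)) ^+ 2.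
    by rewrite ler_pXn2r ?nnegrE //; lra.
  have : 0 <= h ^+ 2 * gp ^+ 2 by rewrite mulr_ge0 ?sqr_ge0.
  lra.
have jp' := ler_wpM2l h2 jp; have jm' := ler_wpM2l h2 jm.
lra.
Qed.

End Walk.

(** * Concentration and change of drift *)

Section WalkConcentration.
Context {R : realType} {n : nat}.
Implicit Types (s x y z : 'rV[R]_n) (h : R) (F : 'rV[R]_n -> R) (ks : seq 'I_n)
  (G : 'rV[R]_n -> 'rV[R]_n).

Lemma expR_le_quadratic (a : R) : `|a| <= 1 / 2 -> expR a <= 1 + a + 2 * a ^+ 2.
Proof.
rewrite ler_norml => /andP[a1 a2].
have := expR_ge1Dx (- a); have := expRxMexpNx_1 a; have := expR_gt0 a.
set e := expR a; set e' := expR (- a) => e0 ee' le'.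
have le1 : e * (1 - a) <= 1 by rewrite -[leRHS]ee' ler_pM2l.
have : 1 <= (1 + a + 2 * a ^+ 2) * (1 - a).
  have : 0 <= a ^+ 2 * (1 - 2 * a) by rewrite mulr_ge0 ?sqr_ge0 //; lra.
  lra.
have a3 : 0 < 1 - a by lra.
by move=> /(le_trans le1); rewrite ler_pM2r.
Qed.

(** Within one round [F] moves by at most d h n, so the exponential may be expanded around the mean
    [m]: the linear term averages to zero and the quadratic one is the variance. A round visits each
    coordinate once, so the sum in [walk_Poincare] is at most d^2, with no factor n. *)
Lemma walk_expR_block h (th d : R) F G x : 0 <= h -> 0 <= th -> 0 <= d ->
  subgradient F G -> (forall z, enorm (G z) <= d) -> 4 * (th * d) * h * n%:R <= 1 ->
  walk h 0 (enum 'I_n) (fun z => expR (- (th * F z))) x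
  <= expR (4 * (th * d * h) ^+ 2) * expR (- (th * walk h 0 (enum 'I_n) F x)).
Proof.
move=> h0 th0 d0 sg Gd small; have sd := @small_drift0 _ n h.
set ks := enum 'I_n; set m := walk h 0 ks F x.
have szks : size ks = n by rewrite size_enum_ord.
have osc z : enorm (z - x) <= h * (size ks)%:R -> `|F z - F x| <= d * (h * n%:R).
  move=> zx; apply: le_trans (subgradient_lipschitz _ _ _ _ _ sg Gd) _.
  by apply: ler_wpM2l => //; move: zx; rewrite szks.
have mosc : `|m - F x| <= d * (h * n%:R).
  rewrite ler_norml; apply/andP; split.
    rewrite lerBrDr addrC -(walk_cst h 0 ks (F x - d * (h * n%:R)) x).
    by apply: walk_le => // z /osc; rewrite ler_norml => /andP[]; lra.
  rewrite lerBlDr addrC -(walk_cst h 0 ks (F x + d * (h * n%:R)) x).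
  by apply: walk_le => // z /osc; rewrite ler_norml => /andP[]; lra.
have quad z : enorm (z - x) <= h * (size ks)%:R ->
    expR (- (th * F z)) <= expR (- (th * m)) * (1 + (- th * (F z - m) + 2 * th ^+ 2 * (F z - m) ^+ 2)).
  move=> /osc zosc.
  have -> : - (th * F z) = - (th * m) + (- th * (F z - m)) by ring.
  rewrite expRD ler_pM2l ?expR_gt0 //.
  have -> : 2 * th ^+ 2 * (F z - m) ^+ 2 = 2 * (- th * (F z - m)) ^+ 2 by ring.
  rewrite addrA; apply: expR_le_quadratic; rewrite normrM normrN (ger0_norm th0).
  have Fm : `|F z - m| <= 2 * (d * (h * n%:R)).
    have -> : F z - m = (F z - F x) - (m - F x) by ring.
    by apply: le_trans (ler_normB _ _) _; lra.
  apply: le_trans (ler_wpM2l th0 Fm) _; lra.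
apply: le_trans (walk_le h 0 ks _ _ x h0 sd quad) _.
rewrite walkZ mulrC ler_pM2r ?expR_gt0 // walkD walk_cst walk_lin.
have -> : walk h 0 ks (fun z => F z - m) x = 0 by rewrite walkB walk_cst subrr.
rewrite mulr0 add0r; apply: le_trans (expR_ge1Dx _); rewrite lerD2l.
have -> : walk h 0 ks (fun z => (F z - m) ^+ 2) x
    = walk h 0 ks (fun z => F z ^+ 2) x - m ^+ 2.
  rewrite -[m ^+ 2](walk_cst h 0 ks _ x).
  have -> : walk h 0 ks (fun z => (F z - m) ^+ 2) x
    = walk h 0 ks (fun z => F z ^+ 2 + ((- 2 * m) * F z + m ^+ 2 * 1)) x.
    by apply: eq_walk => z; ring.
  rewrite walkD walk_lin !walk_cst -/m; ring.
have var : walk h 0 ks (fun z => F z ^+ 2) x - m ^+ 2 <= 2 * h ^+ 2 * d ^+ 2.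
  apply: le_trans (walk_Poincare h ks F G x h0 sg) _.
  apply: ler_wpM2l; first by rewrite mulr_ge0 ?sqr_ge0.
  rewrite -[d ^+ 2](walk_cst h 0 ks _ x); apply: ler_walk => // z.
  have -> : \sum_(k <- ks) G z 0 k ^+ 2 = enorm (G z) ^+ 2.
    by rewrite enorm_sqr /dot big_enum; apply: eq_bigr => k _; rewrite expr2.
  by rewrite ler_pXn2r ?nnegrE ?enorm_ge0.
have th2 : 0 <= 2 * th ^+ 2 by rewrite mulr_ge0 ?sqr_ge0.
have := ler_wpM2l th2 var; lra.
Qed.

Definition rounds (M : nat) : seq 'I_n := flatten (nseq M (enum 'I_n)).

Lemma sum_rounds M (f : 'I_n -> R) :
  \sum_(k <- rounds M) f k = M%:R * \sum_k f k.
Proof.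
elim: M => [|M IH]; first by rewrite big_nil mul0r.
by rewrite /rounds /= big_cat /= -/(rounds M) IH -natr1 mulrDl mul1r addrC big_enum.
Qed.

(** Each round costs exp(4 (th d h)^2), since averaging over the later rounds keeps both convexity
    and the bound [d]. For h^2 M = 1 this is a dimension-free Gaussian bound on the downward
    deviations of [F]. *)
Lemma walk_expR h (th d : R) F G M x : 0 <= h -> 0 <= th -> 0 <= d ->
  subgradient F G -> (forall z, enorm (G z) <= d) -> 4 * (th * d) * h * n%:R <= 1 ->
  walk h 0 (rounds M) (fun z => expR (- (th * F z))) x
  <= expR (4 * (th * d) ^+ 2 * (h ^+ 2 * M%:R))
     * expR (- (th * walk h 0 (rounds M) F x)).
Proof.
move=> h0 th0 d0 sg Gd small; have sd := @small_drift0 _ n h.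
elim: M x => [|M IH] x; first by rewrite /= !mulr0 expR0 mul1r.
have -> : rounds M.+1 = enum 'I_n ++ rounds M by [].
rewrite !walk_cat.
apply: le_trans (ler_walk h 0 _ _ _ x h0 sd IH) _.
rewrite walkZ.
have := walk_expR_block h th d (walk h 0 (rounds M) F) (vwalk h 0 (rounds M) G) x h0 th0 d0
  (subgradient_walk _ _ _ _ _ h0 sd sg)
  (fun z => enorm_vwalk _ _ _ _ _ z h0 sd d0 Gd) small.
move=> /(ler_wpM2l (expR_ge0 (4 * (th * d) ^+ 2 * (h ^+ 2 * M%:R)))) /le_trans; apply.
rewrite (mulrA (expR _)) -expRD le_eqVlt; apply/orP; left; apply/eqP; congr (expR _ * _).
by rewrite -[M.+1%:R]natr1; ring.
Qed.

(* Cauchy-Schwarz against the density of the biased walk. *)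
Lemma walk_tilt h s ks F x : 0 <= h -> small_drift h s ->
  walk h s ks F x ^+ 2
  <= expR (h ^+ 2 * \sum_(k <- ks) s 0 k ^+ 2) * walk h 0 ks (fun z => F z ^+ 2) x.
Proof.
move=> h0 sd; elim: ks x => [|k ks IH] x /=.
  by rewrite big_nil mulr0 expR0 mul1r.
rewrite /bstep big_cons mxE mulr0 addr0 subr0 !mul1r.
set xp := x + _; set xm := x - _.
have := IH xp; have := IH xm.
set u := walk h s ks F xp; set v := walk h s ks F xm.
set Au := walk h 0 ks _ xp; set Av := walk h 0 ks _ xm.
set S := \sum_(j <- ks) _; set a := h * s 0 k => lev leu.
rewrite mulrDr expRD.
have e1 : 1 + a ^+ 2 <= expR (h ^+ 2 * s 0 k ^+ 2).
  by apply: le_trans (expR_ge1Dx _); rewrite /a exprMn.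
have e0 := expR_ge0 (h ^+ 2 * S).
have Auv0 : 0 <= expR (h ^+ 2 * S) * ((Au + Av) / 2).
  have := sqr_ge0 u; have := sqr_ge0 v; lra.
have := ler_wpM2r Auv0 e1.
have a1 : 0 <= 1 + a ^+ 2 by rewrite addr_ge0 ?sqr_ge0.
have := ler_wpM2l a1 leu; have := ler_wpM2l a1 lev.
have := sqr_ge0 ((1 - a) * u - (1 + a) * v).
rewrite -!mulrA; set E := expR _; set E' := expR _.
lra.
Qed.

Lemma subgradient_convex F G x z (b : R) : subgradient F G -> 0 <= b <= 1 ->
  F ((1 - b) *: x + b *: z) <= (1 - b) * F x + b * F z.
Proof.
move=> sg /andP[b0 b1]; set m := (1 - b) *: x + b *: z.
have := sg m x; have := sg m z.
have -> : z - m = (1 - b) *: (z - x) by apply/rowP => j; rewrite !mxE; ring.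
have -> : x - m = (- b) *: (z - x) by apply/rowP => j; rewrite !mxE; ring.
rewrite !dotZr => e1 e2.
have b1' : 0 <= 1 - b by lra.
have := ler_wpM2l b0 e1; have := ler_wpM2l b1' e2; lra.
Qed.

(* Each centred biased step lies in [-2h, 2h], so convex functions do not see
   more of it than of a symmetric step of size 2h. *)
Lemma walk_biased_le h s ks F G x : 0 <= h -> small_drift h s -> subgradient F G ->
  walk h s ks F x
  <= walk (2 * h) 0 ks F (x + h ^+ 2 *: \sum_(k <- ks) s 0 k *: delta_mx 0 k).
Proof.
move=> h0 sd sg; elim: ks x => [|k ks IH] x /=.
  by rewrite big_nil scaler0 addr0.
have := sd k; rewrite ler_norml => /andP[s1 s2].
have h20 : 0 <= 2 * h by lra.
rewrite /bstep big_cons mxE mulr0 addr0 subr0 !mul1r scalerDr scalerA addrA.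
set S := \sum_(j <- ks) _; set e : 'rV[R]_n := delta_mx 0 k.
set a := h * s 0 k.
have := IH (x + h *: e); have := IH (x - h *: e).
set W := walk (2 * h) 0 ks F.
have sgW := subgradient_walk (2 * h) 0 ks F G h20 (small_drift0 _) sg.
(* Up to the shift by [S], [P] and [Q] are the ends of the symmetric step of size 2h around the mean
   x + h a e of the biased step. The two points of the biased step put weights (1 + a) / 4 and (3 +
   a) / 4 on [Q]; averaged with the probabilities (1 + a) / 2 and (1 - a) / 2 these give exactly 1 /
   2. *)
set P := x + (h ^+ 2 * s 0 k) *: e + h ^+ 2 *: S + (2 * h) *: e.
set Q := x + (h ^+ 2 * s 0 k) *: e + h ^+ 2 *: S - (2 * h) *: e.
have := subgradient_convex W _ P Q ((1 + a) / 4) sgW; rewrite -/W.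
have := subgradient_convex W _ P Q ((3 + a) / 4) sgW; rewrite -/W.
have -> : (1 - (3 + a) / 4) *: P + ((3 + a) / 4) *: Q = x - h *: e + h ^+ 2 *: S.
  by apply/rowP => j; rewrite /P /Q /a !mxE; field.
have -> : (1 - (1 + a) / 4) *: P + ((1 + a) / 4) *: Q = x + h *: e + h ^+ 2 *: S.
  by apply/rowP => j; rewrite /P /Q /a !mxE; field.
move=> c1 c2 i1 i2.
have {}c1 : W (x - h *: e + h ^+ 2 *: S) <= (1 - (3 + a) / 4) * W P + (3 + a) / 4 * W Q.
  by apply: c1; rewrite /a; apply/andP; split; lra.
have {}c2 : W (x + h *: e + h ^+ 2 *: S) <= (1 - (1 + a) / 4) * W P + (1 + a) / 4 * W Q.
  by apply: c2; rewrite /a; apply/andP; split; lra.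
have a1 : 0 <= 1 + a by rewrite /a; lra.
have a2 : 0 <= 1 - a by rewrite /a; lra.
have := ler_wpM2l a1 (le_trans i2 c2); have := ler_wpM2l a2 (le_trans i1 c1).
lra.
Qed.

Lemma walk_scale h (c : R) ks F x :
  walk (c * h) 0 ks F (c *: x) = walk h 0 ks (fun z => F (c *: z)) x.
Proof.
elim: ks x => [|k ks IH] x //=.
by rewrite /bstep -!scalerA -scalerDr -scalerBr !IH !mxE !mulr0.
Qed.

Lemma walk_drift_rounds h M s : h ^+ 2 * M%:R = 1 ->
  h ^+ 2 *: \sum_(k <- rounds M) s 0 k *: (delta_mx 0 k : 'rV[R]_n) = s.
Proof.
move=> hM; apply/rowP => j; rewrite mxE summxE.
rewrite (eq_bigr (fun k => s 0 k * (delta_mx 0 k : 'rV[R]_n) 0 j)) => [|k _]; last by rewrite mxE.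
rewrite sum_rounds mulrA hM mul1r (bigD1 j) //= mxE !eqxx mulr1 big1 ?addr0 // => k kj.
by rewrite mxE eqxx eq_sym (negbTE kj) mulr0.
Qed.

End WalkConcentration.

(** * Suprema of finitely many linear functionals *)

Section SupportFunction.
Context {R : realType} {n : nat} {I : finType}.
Implicit Types (y : I -> 'rV[R]_n) (i : I) (A B : {set I}) (x z c : 'rV[R]_n).

(** The starting value of the maximum is the functional at [i0], so this is the supremum over [A]
    together with [i0], meaningful also for empty [A]. *)
Definition supf y i0 A z : R := \big[Num.max/dot (y i0) z]_(i in A) dot (y i) z.

Lemma supf_ge y i0 A z i : i \in A -> dot (y i) z <= supf y i0 A z.
Proof. by move=> iA; rewrite /supf (bigD1 i) //= le_max lexx. Qed.

Lemma supf_ge0 y i0 A z : dot (y i0) z <= supf y i0 A z.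
Proof. exact: bigmax_ge_id. Qed.

Lemma supf_attained y i0 A z :
  exists2 i, (i == i0) || (i \in A) & supf y i0 A z = dot (y i) z.
Proof.
rewrite /supf; elim/big_ind: _ => [|a b [i iA ->] [j jA ->]|i iA].
- by exists i0; rewrite ?eqxx.
- by rewrite maxElt; case: ifP => _; [exists j|exists i].
- by exists i; rewrite ?iA ?orbT.
Qed.

Lemma supf_translate y i0 A c z :
  supf (fun i => y i - c) i0 A z = supf y i0 A z - dot c z.
Proof.
apply/eqP; rewrite eq_le; apply/andP; split.
  have [i /predU1P[->|iA] ->] := supf_attained (fun i => y i - c) i0 A z;
    rewrite dotBl lerB ?supf_ge0 ?supf_ge //.
have [i /predU1P[->|iA] ->] := supf_attained y i0 A z; rewrite -dotBl.
  exact: (supf_ge0 (fun i => y i - c)).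
exact: (supf_ge (fun i => y i - c)).
Qed.

Lemma supf_scale y i0 A (a : R) z : 0 <= a -> supf y i0 A (a *: z) = a * supf y i0 A z.
Proof.
move=> a0; apply/eqP; rewrite eq_le; apply/andP; split.
  have [i /predU1P[->|iA] ->] := supf_attained y i0 A (a *: z);
    by rewrite dotZr ler_wpM2l ?supf_ge0 ?supf_ge.
have [i /predU1P[->|iA] ->] := supf_attained y i0 A z; rewrite -dotZr.
  exact: supf_ge0.
exact: supf_ge.
Qed.

Definition supf_grad y i0 A z : 'rV[R]_n :=
  y (odflt i0 [pick i | ((i == i0) || (i \in A)) && (supf y i0 A z == dot (y i) z)]).

Lemma supf_gradP y i0 A z :
  exists2 i, (i == i0) || (i \in A) &
    supf_grad y i0 A z = y i /\ supf y i0 A z = dot (y i) z.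
Proof.
rewrite /supf_grad; case: pickP => [i /andP[iA /eqP e]|no] /=; first by exists i.
have [i iA e] := supf_attained y i0 A z.
by have := no i; rewrite iA e eqxx.
Qed.

Lemma subgradient_supf y i0 A : subgradient (supf y i0 A) (supf_grad y i0 A).
Proof.
move=> x z; have [i /predU1P[->|iA] [-> ->]] := supf_gradP y i0 A x;
  rewrite -dotDr subrKC.
  exact: supf_ge0.
exact: supf_ge.
Qed.

End SupportFunction.

(** * Width of a finite set and Sudakov's inequality *)

Section Width.
Context {R : realType} {n : nat} {I : finType}.
Context (h : R) (M : nat) (hM : h ^+ 2 * M%:R = 1) (h0 : 0 <= h).
Implicit Types (y : I -> 'rV[R]_n) (i : I) (A B : {set I}) (x z c : 'rV[R]_n).

Definition width y i0 A : R := walk h 0 (rounds M) (supf y i0 A) 0.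

Let sd0 : @small_drift R n h 0 := small_drift0 h.

Lemma walk_dot0 c : walk h 0 (rounds M) (dot c) 0 = 0.
Proof. by rewrite walk_dot dot0r add0r big1 ?mulr0 // => k _; rewrite mxE mul0r. Qed.

Lemma width_ge0 y i0 A : 0 <= width y i0 A.
Proof. by rewrite -(walk_dot0 (y i0)); apply: ler_walk => // z; exact: supf_ge0. Qed.

Lemma width_translate y i0 A c : width (fun i => y i - c) i0 A = width y i0 A.
Proof.
rewrite /width -[RHS]subr0 -(walk_dot0 c) -walkB.
by apply: eq_walk => z; exact: supf_translate.
Qed.

(* The volumetric proof: the regions where the points l in J are decoded
   correctly are disjoint, and the walk with drift tau * y l most likely ends in
   the l-th region, so that the latter has probability at least exp(-q^2) / 4. *)
Lemma Sudakov y (J : {set I}) i0 (r e q : R) : i0 \in J -> 0 < r -> 0 < e -> 0 < q ->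
  h * q <= 1 -> (forall l, l \in J -> enorm (y l) <= r) ->
  (forall l l', l \in J -> l' \in J -> l != l' -> e <= enorm (y l - y l')) ->
  4 * expR (q ^+ 2) <= #|J|%:R -> e ^+ 2 * q <= 8 * r * width y i0 J.
Proof.
move=> i0J r0 e0 q0 hq Jr Je cJ; rewrite leNgt; apply/negP => wlt.
set w := width y i0 J in wlt.
(* The drifts [t *: y l] have length at most q, so the change of measure costs at most exp(q^2). *)
have [t t0 tr] : exists2 t, 0 < t & t * r = q.
  by exists (q / r); rewrite ?divr_gt0 // divfK ?gt_eqF.
have wt : 8 * w < t * e ^+ 2.
  rewrite -(ltr_pM2l r0); have -> : r * (t * e ^+ 2) = e ^+ 2 * q by rewrite -tr; ring.
  lra.
(* In the Gaussian limit this is the log-likelihood of the drift t y_l, divided by t and up to terms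
   independent of l. *)
pose score l z := dot (y l) z - t / 2 * dot (y l) (y l).
pose D l z := [forall l' in J, (l' != l) ==> (score l' z < score l z)].
have disj z : \sum_(l in J) (D l z)%:R <= 1 :> R.
  have [l /andP[lJ lD]|noD] := pickP [pred l | (l \in J) && D l z].
    rewrite (bigD1 l) //= lD big1 ?addr0 // => l' /andP[l'J l'l].
    case Dl' : (D l' z) => //.
    have := forall_inP lD _ l'J; rewrite l'l /=.
    by have := forall_inP Dl' _ lJ; rewrite eq_sym l'l /= => a /(lt_trans a); rewrite ltxx.
  rewrite big1 ?ler01 // => l lJ; by have := noD l; rewrite /= lJ /= => ->.
have sdl l : l \in J -> small_drift h (t *: y l).
  move=> lJ k; rewrite mxE mulrA normrM.
  have yk : `|y l 0 k| <= r.
    apply: le_trans (Jr l lJ); rewrite -(@ler_pXn2r _ 2) ?nnegrE ?enorm_ge0 //.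
    rewrite enorm_sqr real_normK ?num_real // /dot (bigD1 k) //= expr2 lerDl.
    by apply: sumr_ge0 => j _; rewrite -expr2 sqr_ge0.
  rewrite ger0_norm ?mulr_ge0 ?(ltW t0) //.
  apply: le_trans (ler_wpM2l _ yk) _; first by rewrite mulr_ge0 ?(ltW t0).
  by rewrite -mulrA tr.
have pD l : l \in J -> 1 / 2 < walk h (t *: y l) (rounds M) (fun z => (D l z)%:R) 0.
  move=> lJ; set s := t *: y l; pose y' i := y i - y l.
  have te0 : 0 < t * e ^+ 2 by rewrite mulr_gt0 ?exprn_gt0.
  (* If some l' is not beaten by l, the supremum of y_i - y_l at the recentred point z - s is at
     least t e^2 / 2; Markov's inequality then bounds the probability of wrong decoding. *)
  have miss z : 1 - 2 / (t * e ^+ 2) * supf y' i0 J (z + - s) <= (D l z)%:R.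
    have sup0 : 0 <= supf y' i0 J (z + - s).
      by apply: le_trans (supf_ge y' i0 J _ l lJ); rewrite /y' subrr dot0l.
    have c0 : 0 <= 2 / (t * e ^+ 2) by rewrite divr_ge0 // ltW.
    case: (boolP (D l z)) => [_|nD].
      by rewrite gerBl mulr_ge0.
    move: nD; rewrite negb_forall => /existsP[l' ]; rewrite !negb_imply -leNgt => /and3P[l'J l'l].
    rewrite /score => sc.
    have sup1 : t * e ^+ 2 / 2 <= supf y' i0 J (z + - s).
      apply: le_trans (supf_ge y' i0 J _ l' l'J).
      have el' : e ^+ 2 <= enorm (y l' - y l) ^+ 2.
        by rewrite ler_pXn2r ?nnegrE ?enorm_ge0 ?(ltW e0) // Je.
      have -> : dot (y' l') (z + - s)
          = dot (y l') z - dot (y l) z - t * (dot (y l') (y l) - dot (y l) (y l)).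
        by rewrite /y' /s dotBl !dotBr !dotZr; ring.
      have := ler_wpM2l (ltW t0) el'.
      have -> : enorm (y l' - y l) ^+ 2
          = dot (y l') (y l') - 2 * dot (y l') (y l) + dot (y l) (y l).
        by rewrite enorm_sqr dotBl !dotBr (dotC (y l) (y l')); ring.
      lra.
    rewrite subr_le0; apply: le_trans (ler_wpM2l c0 sup1).
    have -> : 2 / (t * e ^+ 2) * (t * e ^+ 2 / 2) = 1 by field; rewrite !gt_eqF.
    exact: lexx.
  apply: lt_le_trans (ler_walk h s (rounds M) _ _ 0 h0 (sdl l lJ) miss).
  rewrite walkB walk_cst walkZ walk_shift.
  have ub : walk h s (rounds M) (supf y' i0 J) (0 + - s) <= 2 * w.
    apply: le_trans (walk_biased_le h s _ _ _ _ h0 (sdl l lJ) (subgradient_supf y' i0 J)) _.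
    rewrite walk_drift_rounds // add0r addNr -[X in walk _ _ _ _ X](scaler0 _ 2) walk_scale.
    rewrite /w -(width_translate y i0 J (y l)) -/y' /width -walkZ.
    by apply: ler_walk => // z; rewrite supf_scale.
  have c0 : 0 < 2 / (t * e ^+ 2) by rewrite divr_gt0.
  have := ler_wpM2l (ltW c0) ub.
  have : 2 / (t * e ^+ 2) * (2 * w) < 1 / 2.
    have -> : 2 / (t * e ^+ 2) * (2 * w) = 8 * w / (t * e ^+ 2) / 2 by field; rewrite !gt_eqF.
    by rewrite ltr_pM2r ?invr_gt0 // ltr_pdivrMr // mul1r.
  lra.
have E0 := expR_gt0 (q ^+ 2).
have vol l : l \in J -> 1 < 4 * expR (q ^+ 2) * walk h 0 (rounds M) (fun z => (D l z)%:R) 0.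
  move=> lJ; have := walk_tilt h (t *: y l) (rounds M) (fun z => (D l z)%:R) 0 h0 (sdl l lJ).
  have p2 : (1 / 2) ^+ 2 < walk h (t *: y l) (rounds M) (fun z => (D l z)%:R) 0 ^+ 2.
    by rewrite ltr_pXn2r ?nnegrE ?pD //; apply: ltW; apply: le_lt_trans (pD l lJ); lra.
  move=> /(lt_le_trans p2).
  rewrite (eq_walk _ _ _ _ (fun z => (D l z)%:R)) => [|z]; last by case: (D l z); rewrite ?expr1n ?expr0n.
  set P := walk _ _ _ _ _.
  have P0 : 0 <= P by rewrite -[leLHS](walk_cst h (0 : 'rV[R]_n) (rounds M) 0 0); apply: ler_walk => // z; rewrite ler0n.
  have le1 : expR (h ^+ 2 * \sum_(k <- rounds M) (t *: y l) 0 k ^+ 2) <= expR (q ^+ 2).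
    rewrite ler_expR sum_rounds mulrA hM mul1r.
    have -> : \sum_k (t *: y l) 0 k ^+ 2 = enorm (t *: y l) ^+ 2.
      by rewrite enorm_sqr; apply: eq_bigr => k _; rewrite expr2.
    rewrite ler_pXn2r ?nnegrE ?enorm_ge0 ?(ltW q0) // enormZ ?(ltW t0) // -tr.
    by rewrite ler_pM2l // Jr.
  have := ler_wpM2r P0 le1; lra.
have tot : walk h 0 (rounds M) (fun z => \sum_(l in J) (D l z)%:R) 0 <= 1.
  by rewrite -[leRHS](walk_cst h (0 : 'rV[R]_n) (rounds M) 1 0); apply: ler_walk.
rewrite walk_sum in tot.
have : #|J|%:R < 4 * expR (q ^+ 2) * \sum_(l in J) walk h 0 (rounds M) (fun z => (D l z)%:R) 0.
  rewrite mulr_sumr -sum1_card natr_sum; apply: ltr_sum => [|l lJ]; last exact: vol.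
  by apply/hasP; exists i0; rewrite ?mem_index_enum.
have k0 : 0 <= 4 * expR (q ^+ 2) by rewrite mulr_ge0 // ltW.
have := ler_wpM2l k0 tot; lra.
Qed.

End Width.

(** * Sudakov's inequality for families of sets; diameter and width *)

Section SuperSudakov.
Context {R : realType} {n : nat} {I : finType}.
Context (h : R) (M : nat) (hM : h ^+ 2 * M%:R = 1) (h0 : 0 <= h).
Implicit Types (y : I -> 'rV[R]_n) (i : I) (A B : {set I}) (x z c : 'rV[R]_n).

Local Notation width := (width h M).
Local Notation sd0 := (small_drift0 h).

(** The supremum over [U] is at least that of [y l] over [J] plus the local supremum around the
    maximizing l. As this l depends on the end point, the local suprema must be controlled
    simultaneously: each falls below its mean with Gaussian tails at scale d, and over at most
    exp(p^2) sets the mean loss is at most 4 d p. *)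
Lemma super_Sudakov y (J : {set I}) (A : I -> {set I}) (U : {set I}) i0 u0
    (r e q d p mu : R) :
  i0 \in J -> 0 < r -> 0 < e -> 0 < q -> 0 < d -> 0 < p ->
  h * q <= 1 -> 2 * p * h * n%:R <= 1 ->
  (forall l l', l \in J -> l' \in J -> enorm (y l - y l') <= r) ->
  (forall l l', l \in J -> l' \in J -> l != l' -> e <= enorm (y l - y l')) ->
  4 * expR (q ^+ 2) <= #|J|%:R -> #|J|%:R <= expR (p ^+ 2) ->
  (forall l i, l \in J -> i \in A l -> enorm (y i - y l) <= d) ->
  (forall l, l \in J -> l \in A l) -> (forall l, l \in J -> A l \subset U) ->
  (forall l, l \in J -> mu <= width y l (A l)) ->
  mu + (e ^+ 2 * q / (8 * r) - 4 * d * p) <= width y u0 U.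
Proof.
move=> i0J r0 e0 q0 d0 p0 hq hp Jr Je cJ cJ' Ad lA AU muA.
pose th := p / (2 * d); have th0 : 0 < th by rewrite divr_gt0 // mulr_gt0.
have thd : th * d = p / 2 by rewrite /th; field; rewrite gt_eqF.
pose Ml l := supf (fun i => y i - y l) l (A l).
pose w l := width y l (A l).
have wMl l : walk h 0 (rounds M) (Ml l) 0 = w l by rewrite /w -(width_translate h M y l (A l) (y l)).
pose b := 2 * p ^+ 2.
(* A smooth bound for the largest shortfall, from x <= exp(x - b) + b - 1 summed over [J]. With th =
   p / (2 d) and b = 2 p^2 the exponential sum has mean at most 1, which leaves b / th = 4 d p. *)
pose v z := th^-1 * (expR (- b) * (\sum_(l in J) expR (th * w l) * expR (- (th * Ml l z))) + (b - 1)).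
have Mlv l z : l \in J -> w l - Ml l z <= v z.
  move=> lJ; rewrite /v ler_pdivlMl //.
  have := expR_ge1Dx (th * (w l - Ml l z) - b).
  have : expR (th * (w l - Ml l z) - b)
     <= expR (- b) * (\sum_(l in J) expR (th * w l) * expR (- (th * Ml l z))).
    rewrite addrC expRD ler_pM2l ?expR_gt0 // mulrBr expRD (bigD1 l) //= lerDl.
    by apply: sumr_ge0 => l' _; rewrite mulr_ge0 ?expR_ge0.
  lra.
have conc l : l \in J ->
    walk h 0 (rounds M) (fun z => expR (- (th * Ml l z))) 0 <= expR (p ^+ 2) * expR (- (th * w l)).
  move=> lJ.
  have Gd z : enorm (supf_grad (fun i => y i - y l) l (A l) z) <= d.
    have [i /predU1P[->|iA] [-> _]] := supf_gradP (fun i => y i - y l) l (A l) z.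
      by apply: (Ad _ _ lJ); exact: lA.
    exact: Ad.
  have hp' : 4 * (th * d) * h * n%:R <= 1 by rewrite thd; lra.
  have := walk_expR h th d _ _ M 0 h0 (ltW th0) (ltW d0)
    (subgradient_supf (fun i => y i - y l) l (A l)) Gd hp'.
  rewrite hM thd wMl.
  by have -> : 4 * (p / 2) ^+ 2 * 1 = p ^+ 2 by field.
have Ev : walk h 0 (rounds M) v 0 <= 4 * d * p.
  rewrite walkZ walkD walk_cst walkZ walk_sum.
  have le1 : expR (- b) * \sum_(l in J)
      walk h 0 (rounds M) (fun z => expR (th * w l) * expR (- (th * Ml l z))) 0 <= 1.
    have le2 : \sum_(l in J)
      walk h 0 (rounds M) (fun z => expR (th * w l) * expR (- (th * Ml l z))) 0
      <= #|J|%:R * expR (p ^+ 2).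
      rewrite -sum1_card natr_sum mulr_suml; apply: ler_sum => l lJ; rewrite walkZ mul1r.
      have := ler_wpM2l (expR_ge0 (th * w l)) (conc l lJ).
      by rewrite (mulrC (expR (p ^+ 2))) mulrA -expRD addrN expR0 mul1r.
    have le3 := le_trans le2 (ler_wpM2r (expR_ge0 _) cJ').
    have := ler_wpM2l (expR_ge0 (- b)) le3.
    have bp : - b + (p ^+ 2 + p ^+ 2) = 0 by rewrite /b; ring.
    by rewrite -!expRD bp expR0.
  have thb : th * (4 * d * p) = b.
    have -> : th * (4 * d * p) = 4 * p * (th * d) by ring.
    by rewrite thd /b; field.
  rewrite ler_pdivrMl // thb.
  lra.
have Sud : e ^+ 2 * q / (8 * r) <= width y i0 J.
  rewrite ler_pdivrMr ?mulr_gt0 // mulrC -(width_translate h M y i0 J (y i0)) [leRHS]mulrC.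
  rewrite mulrC; apply: (Sudakov h M hM h0) => // [l lJ|l l' lJ l'J ll']; first exact: Jr.
  by rewrite opprB addrA subrK; exact: Je.
have main : width y i0 J + (mu - walk h 0 (rounds M) v 0) <= width y u0 U.
  rewrite -[mu](walk_cst h (0 : 'rV[R]_n) (rounds M) _ 0) -walkB -walkD; apply: ler_walk => //; [exact: sd0|move=> z].
  have [l /predU1P lJ ->] := supf_attained y i0 J z.
  have {}lJ : l \in J by case: lJ => [->|].
  have [i /predU1P iA e1] := supf_attained (fun i => y i - y l) l (A l) z.
  have {}iA : i \in A l by case: iA => [->|//]; exact: lA.
  have : dot (y i) z <= supf y u0 U z.
    by apply: supf_ge; apply: (fintype.subsetP (AU l lJ)).
  have := Mlv l z lJ; rewrite /Ml e1 dotBl; have := muA l lJ; rewrite -/(w l).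
  lra.
lra.
Qed.

Lemma walk_dot_sqr ks (y : 'rV[R]_n) x : walk h 0 ks (fun z => dot y z ^+ 2) x
  = dot y x ^+ 2 + h ^+ 2 * \sum_(k <- ks) y 0 k ^+ 2.
Proof.
elim: ks x => [|k ks IH] x /=; first by rewrite big_nil mulr0 addr0.
by rewrite /bstep !IH big_cons dotDr dotBr !dotZr !dot_delta mxE; field.
Qed.

Lemma walk_dot_pow4 ks (y : 'rV[R]_n) x : walk h 0 ks (fun z => dot y z ^+ 4) x
  <= dot y x ^+ 4 + 6 * dot y x ^+ 2 * (h ^+ 2 * \sum_(k <- ks) y 0 k ^+ 2)
     + 3 * (h ^+ 2 * \sum_(k <- ks) y 0 k ^+ 2) ^+ 2.
Proof.
elim: ks x => [|k ks IH] x /=; first by rewrite big_nil; lra.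
rewrite /bstep big_cons mxE mulr0 addr0 subr0 !mul1r.
have := IH (x + h *: delta_mx 0 k); have := IH (x - h *: delta_mx 0 k).
rewrite !(dotDr, dotNr, dotZr) !dot_delta.
set a := walk _ _ _ _ _; set b := walk _ _ _ _ _.
set S := \sum_(j <- ks) _; set u := dot y x; set c := y 0 k.
have : 0 <= (h * c) ^+ 4 by rewrite (exprM _ 2 2) sqr_ge0.
lra.
Qed.

(* |u| >= u^2 / s - u^4 / (4 s^3), so two moments suffice. *)
Lemma Khinchine (y : 'rV[R]_n) : enorm y / 4 <= walk h 0 (rounds M) (fun z => `|dot y z|) 0.
Proof.
have [y0|y0] := eqVneq (enorm y) 0.
  rewrite y0 mul0r -[leLHS](walk_cst h (0 : 'rV[R]_n) (rounds M) 0 0); by apply: ler_walk => //; exact: sd0.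
have s0 : 0 < enorm y by rewrite lt_def y0 enorm_ge0.
set s := enorm y in s0 *.
have pt z : s^-1 * dot y z ^+ 2 + - (s^-1 ^+ 3 / 4) * dot y z ^+ 4 <= `|dot y z|.
  have [a ea] : exists a, dot y z = s * a.
    by exists (dot y z / s); rewrite mulrC divfK // gt_eqF.
  rewrite ea normrM (gtr0_norm s0).
  have -> : s^-1 * (s * a) ^+ 2 + - (s^-1 ^+ 3 / 4) * (s * a) ^+ 4
     = s * (a ^+ 2 - a ^+ 4 / 4) by field; rewrite gt_eqF.
  rewrite ler_pM2l // -(real_normK (num_real a)) (_ : a ^+ 4 = `|a| ^+ 4); last first.
    by rewrite (exprM _ 2 2) -(real_normK (num_real a)) -exprM.
  have := normr_ge0 a; move: `|a| => t t0.
  have [t1|t1] := leP t 1.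
    have : 0 <= t * (1 - t) by rewrite mulr_ge0 //; lra.
    have : 0 <= t ^+ 4 by rewrite exprn_ge0.
    lra.
  have := sqr_ge0 (t ^+ 2 - 2); lra.
apply: le_trans (ler_walk h 0 (rounds M) _ _ 0 h0 sd0 pt).
rewrite walk_lin walk_dot_sqr.
have := walk_dot_pow4 (rounds M) y 0.
have sum2 : h ^+ 2 * \sum_(k <- rounds M) y 0 k ^+ 2 = s ^+ 2.
  rewrite sum_rounds mulrA hM mul1r enorm_sqr.
  by apply: eq_bigr => k _; rewrite expr2.
rewrite dot0r sum2.
set W := walk _ _ _ _ _ => W3.
have c0 : 0 <= s^-1 ^+ 3 / 4 by rewrite divr_ge0 // exprn_ge0 // invr_ge0 ltW.
have := ler_wpM2l c0 W3.
have -> : s^-1 ^+ 3 / 4 * (0 ^+ 4 + 6 * 0 ^+ 2 * s ^+ 2 + 3 * (s ^+ 2) ^+ 2) = 3 / 4 * s.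
  by field; rewrite gt_eqF.
have -> : s^-1 * (0 ^+ 2 + s ^+ 2) = s by field; rewrite gt_eqF.
lra.
Qed.

(** max(a, b) = |a - b| / 2 + (a + b) / 2: the second term has mean zero, and [Khinchine] bounds the
    first. *)
Lemma enorm_le_width y u0 (U : {set I}) i j : i \in U -> j \in U ->
  enorm (y i - y j) <= 8 * width y u0 U.
Proof.
move=> iU jU; have := Khinchine (y i - y j).
have : walk h 0 (rounds M) (fun z => 2^-1 * `|dot (y i - y j) z| + 2^-1 * dot (y i + y j) z) 0
    <= width y u0 U.
  apply: ler_walk => //; [exact: sd0|move=> z]; rewrite dotBl dotDl.
  have := supf_ge y u0 U z i iU; have := supf_ge y u0 U z j jU.
  by case: (ger0P (dot (y i) z - dot (y j) z)); lra.
rewrite walk_lin walk_dot0; lra.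
Qed.

End SuperSudakov.

(** * Majorizing measures and chaining *)

Section Partitions.
Context {R : realType} {n : nat} {I : finType} (y : I -> 'rV[R]_n).
Implicit Types (A S : {set I}) (i j k : I).

Definition dist i j : R := enorm (y i - y j).

Lemma dist_ge0 i j : 0 <= dist i j. Proof. exact: enorm_ge0. Qed.

Lemma distxx i : dist i i = 0. Proof. by rewrite /dist subrr enorm0. Qed.

Lemma distC i j : dist i j = dist j i. Proof. exact: enormBC. Qed.

Lemma dist_triangle i j k : dist i k <= dist i j + dist j k.
Proof. exact: enorm_triangle. Qed.

Definition diameter A : R := \big[Num.max/0]_(i in A) \big[Num.max/0]_(j in A) dist i j.

Lemma bigmax_ge (T : finType) (P : pred T) (f : T -> R) (b : R) t :
  P t -> f t <= \big[Num.max/b]_(i | P i) f i.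
Proof. by move=> Pt; rewrite (bigD1 t) //= le_max lexx. Qed.

Lemma diameter_ge0 A : 0 <= diameter A. Proof. exact: bigmax_ge_id. Qed.

Lemma dist_le_diameter A i j : i \in A -> j \in A -> dist i j <= diameter A.
Proof.
move=> iA jA; apply: le_trans (bigmax_ge _ _ (fun i => \big[Num.max/0]_(j in A) dist i j) _ _ iA).
exact: bigmax_ge.
Qed.

Lemma diameter_le A (b : R) : 0 <= b ->
  (forall i j, i \in A -> j \in A -> dist i j <= b) -> diameter A <= b.
Proof. by move=> b0 h; do 2!apply: bigmax_le => // ? ?; exact: h. Qed.

Lemma diameter_sub A S : A \subset S -> diameter A <= diameter S.
Proof.
move=> AS; apply: diameter_le => [|i j iA jA]; first exact: diameter_ge0.
by apply: dist_le_diameter; exact: (fintype.subsetP AS).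
Qed.

Definition separated (r : R) S : bool :=
  [forall i in S, forall j in S, (i != j) ==> (r < dist i j)].

Lemma separatedP (r : R) S :
  reflect (forall i j, i \in S -> j \in S -> i != j -> r < dist i j) (separated r S).
Proof.
apply: (iffP forall_inP) => h i.
  by move=> j iS jS; apply/implyP; exact: (forall_inP (h i iS)).
by move=> iS; apply/forall_inP => j jS; apply/implyP; exact: h.
Qed.

Definition net A (r : R) : {set I} :=
  [arg max_(S > finset.set0 | (S \subset A) && separated r S) #|S|].

Lemma netP A (r : R) : [/\ net A r \subset A, separated r (net A r) &
  0 <= r -> forall i, i \in A -> exists2 j, j \in net A r & dist i j <= r].
Proof.
rewrite /net; case: arg_maxnP => [|S /andP[SA Ssep] Smax].
  by rewrite finset.sub0set; apply/separatedP => i j; rewrite inE.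
split=> // r0 i iA; apply: contrapT => far.
have {}far j : j \in S -> r < dist i j.
  by move=> jS; rewrite ltNge; apply/negP => ij; apply: far; exists j.
have iS : i \notin S by apply/negP => /far; rewrite distxx ltNge r0.
have big : (i |: S \subset A)%SET && separated r (i |: S)%SET.
  rewrite finset.subUset finset.sub1set iA SA /=; apply/separatedP => j k.
  rewrite !in_setU1 => /predU1P[->|jS] /predU1P[->|kS].
  - by rewrite eqxx.
  - by move=> _; exact: far.
  - by move=> _; rewrite distC; exact: far.
  - by move/separatedP: Ssep; exact.
by have := Smax _ big; rewrite cardsU1 iS add1n /= ltnn.
Qed.

(* Splitting every cell of f along a maximal separated subset of it. *)
Lemma refine_partition (L : finType) (f : I -> L) (r : {set I} -> R) (N : nat) :
  (forall A, 0 <= r A) ->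
  (forall i S, S \subset [set j | f j == f i] -> separated (r [set j | f j == f i]) S ->
    (#|S| <= N)%N) ->
  exists2 f' : {ffun I -> I}, (#|f' @: I| <= #|f @: I| * N)%N &
    forall i, diameter [set j | f' j == f' i] <= 2 * r [set j | f j == f i].
Proof.
move=> r0 sepN; pose cell p := [set j | f j == p].
pose ctr i := odflt i [pick j | (j \in net (cell (f i)) (r (cell (f i)))) &&
                              (dist i j <= r (cell (f i)))].
have ctrP i : (ctr i \in net (cell (f i)) (r (cell (f i)))) && (dist i (ctr i) <= r (cell (f i))).
  rewrite /ctr; case: pickP => // no.
  have [_ _ net_near] := netP (cell (f i)) (r (cell (f i))).
  have iA : i \in cell (f i) by rewrite inE.
  have [j jn ij] := net_near (r0 _) i iA.
  by have := no j; rewrite jn ij.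
pose g i := (f i, ctr i).
have [i0 _|noI] := pickP (@predT I); last first.
  exists [ffun i => i] => [|i]; last by have := noI i.
  by rewrite leqNgt; apply/negP => /(leq_ltn_trans (leq0n _)); rewrite card_gt0 => /set0Pn[i];
     have := noI i.
(* A pair (old cell, centre) is renamed by an index belonging to it, so that partitions of all
   levels are maps from [I] to [I], among which an optimal sequence can be chosen. *)
pose lab t := odflt i0 [pick j | g j == t].
have glab i : g (lab (g i)) = g i.
  by rewrite /lab; case: pickP => [j /eqP //|/(_ i)]; rewrite eqxx.
exists [ffun i => lab (g i)] => [|i].
  have -> : [ffun i => lab (g i)] @: I = lab @: (g @: I).
    by rewrite -imset_comp; apply: eq_imset => i; rewrite ffunE.
  apply: leq_trans (leq_imset_card _ _) _.
  rewrite -sum1_card (partition_big fst (mem (f @: I))) /=; last first.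
    by move=> _ /imsetP[i _ ->] /=; rewrite imset_f ?inE.
  rewrite -sum_nat_const; apply: leq_sum => _ /imsetP[i _ ->].
  rewrite sum1_card; apply: leq_trans (sepN i (net (cell (f i)) (r (cell (f i)))) _ _);
    try by have [] := netP (cell (f i)) (r (cell (f i))).
  rewrite -(card_in_imset (f := snd)).
    apply: subset_leq_card; apply/fintype.subsetP => x /imsetP[t /andP[/imsetP[j _ ->]]] /=.
    by move=> /eqP fij ->; have /andP[] := ctrP j; rewrite fij.
  by move=> [a b] [a' b'] /andP[_ /eqP /= ->] /andP[_ /eqP /= ->] /= ->.
apply: diameter_le => [|j k]; first by rewrite mulr_ge0.
rewrite !inE !ffunE => /eqP ej /eqP ek.
have {ej} : g j = g i by rewrite -glab ej glab.
have {ek} : g k = g i by rewrite -glab ek glab.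
move=> [fk ck] [fj cj].
have /andP[_ dj] := ctrP j; have /andP[_ dk] := ctrP k.
rewrite fj cj in dj; rewrite fk ck in dk.
apply: le_trans (dist_triangle _ (ctr i) _) _.
by rewrite (distC _ k); rewrite /cell in dj dk; lra.
Qed.

End Partitions.

(** * Cardinalities 2^(4^m) against exponentials *)

Section NumericBounds.
Context {R : realType}.

Lemma expR1_le4 : expR 1 <= 4 :> R.
Proof.
have h : expR (1 / 2) <= 2 :> R.
  by apply: le_trans (expR_le_quadratic (1 / 2) _) _; [rewrite ger0_norm; lra|lra].
have -> : expR 1 = expR (1 / 2) * expR (1 / 2) :> R by rewrite -expRD; congr expR; field.
have -> : (4 : R) = 2 * 2 by ring.
by apply: ler_pM; rewrite ?expR_ge0.
Qed.

Lemma sqr_pow2 m : (2 ^+ m) ^+ 2 = (4 ^ m)%N%:R :> R.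
Proof. by rewrite -exprM mulnC exprM natrX; congr (_ ^+ _); ring. Qed.

Lemma pow2_le_expR m : (2 ^ (4 ^ m))%N%:R <= expR ((2 ^+ m) ^+ 2) :> R.
Proof.
rewrite sqr_pow2 -[X in expR X]mulr1 expRM_natl natrX.
by apply: lerXn2r; rewrite ?nnegrE ?expR_ge0 //; have := expR_ge1Dx (1 : R); lra.
Qed.

(** 2^(4^m) is 16 to the power 4^(m - 1), and e <= 4 leaves room for the factor 4 when m > 0. With
    the preceding bound, sets of this size fit [super_Sudakov] with p = 2^m and q = p / 2. *)
Lemma expR_le_pow2 m : (0 < m)%N ->
  4 * expR ((2 ^+ m / 2) ^+ 2) <= (2 ^ (4 ^ m))%N%:R :> R.
Proof.
case: m => // m _; have -> : 2 ^+ m.+1 / 2 = 2 ^+ m :> R by rewrite exprS; field.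
rewrite sqr_pow2.
rewrite -[X in expR X]mulr1 expRM_natl expnS; set N := (4 ^ m)%N.
have N0 : (0 < N)%N by rewrite expn_gt0.
rewrite expnM natrX.
have -> : ((2 ^ 4)%N%:R : R) = 4 * 4 by rewrite -natrM.
rewrite exprMn; apply: ler_pM; rewrite ?exprn_ge0 ?expR_ge0 //.
  by rewrite -[leLHS]expr1 ler_weXn2l //; lra.
by apply: lerXn2r; rewrite ?nnegrE ?expR_ge0 ?expR1_le4.
Qed.

End NumericBounds.

(** * Van Handel's contraction argument *)

Section MajorizingMeasure.
Context {R : realType} {n : nat} {I : finType}.
Context (h : R) (M K : nat) (hM : h ^+ 2 * M%:R = 1) (h0 : 0 <= h).
Context (hK : h * 2 ^+ K <= 1) (hKn : 2 * 2 ^+ K * h * n%:R <= 1).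
Context (y : I -> 'rV[R]_n) (W : R) (widthW : forall i (A : {set I}), width h M y i A <= W).
(* kap and eta are so large that super_Sudakov contradicts the minimality of the
   penalty on a large separated set. *)
Context (kap eta : R) (kap0 : 0 < kap) (eta0 : 0 < eta).
Context (kap_eta : (8 + kap^-1) / eta < 1 / 128 - 4 / kap).
Implicit Types (A S : {set I}) (i j k : I).

Local Notation dist := (dist y).
Local Notation diameter := (diameter y).
Local Notation separated := (separated y).

Definition ball i (rho : R) : {set I} := [set k | dist i k <= rho].

Definition ball_width i (rho : R) : R := width h M y i (ball i rho).

(* The functional of van Handel's interpolation: [cut_radius m i] is the radius
   realizing inf_rho (2^m rho / eta + w(I) - w(B(i, rho))). *)
Definition penalty m i j : R := 2 ^+ m / eta * dist i j - ball_width i (dist i j).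

(** Between consecutive distances from i the closed ball is constant while the linear term grows, so
    the infimum over all radii is a minimum over the points of [I]. *)
Definition cut_point m i : I := [arg min_(j < i) penalty m i j]%O.

Definition cut_radius m i : R := dist i (cut_point m i).

Lemma penalty_min m i j : penalty m i (cut_point m i) <= penalty m i j.
Proof. by rewrite /cut_point; case: arg_minP => // k _; apply. Qed.

Lemma ball_widthW i rho : 0 <= ball_width i rho <= W.
Proof. by rewrite widthW width_ge0. Qed.

Lemma W_ge0 i : 0 <= W.
Proof. by have /andP[] := ball_widthW i 0; exact: le_trans. Qed.

Lemma dist_le_W i j : dist i j <= 8 * W.
Proof.
have := enorm_le_width h M hM h0 y i [set i; j] i j.
by rewrite !inE !eqxx orbT => /(_ isT isT)/le_trans; apply; rewrite ler_pM2l.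
Qed.

(** Testing the minimum at level N with the minimizer of level N + 1 shows that the minimal penalty
    rises by at least 2^N / eta times the new radius. The sum telescopes, and the minimal penalties
    stay between - W and 0. *)
Lemma sum_cut_radius N i :
  \sum_(0 <= m < N) 2 ^+ m * cut_radius m.+1 i <= eta * W.
Proof.
suff tele : \sum_(0 <= m < N) 2 ^+ m * cut_radius m.+1 i
    <= eta * (penalty N i (cut_point N i) + W).
  apply: (le_trans tele); rewrite ler_pM2l // gerDr.
  apply: le_trans (penalty_min N i i) _; rewrite /penalty distxx mulr0 sub0r oppr_le0.
  by have /andP[] := ball_widthW i 0.
elim: N => [|N IH].
  rewrite big_nil mulr_ge0 ?(ltW eta0) // /penalty expr0 mul1r.
  have /andP[_] := ball_widthW i (dist i (cut_point 0 i)).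
  have : 0 <= eta^-1 * dist i (cut_point 0 i) by rewrite mulr_ge0 ?invr_ge0 ?(ltW eta0) ?dist_ge0.
  lra.
rewrite big_nat_recr //=; have := penalty_min N i (cut_point N.+1 i).
rewrite [penalty N i (cut_point N.+1 i)]/penalty.
rewrite [penalty N.+1 i (cut_point N.+1 i)]/penalty -/(cut_radius N.+1 i) exprS.
set b := ball_width _ _; set d := cut_radius _ _; set P := penalty _ _ _ => le1.
have -> : eta * (2 * 2 ^+ N / eta * d - b + W)
    = eta * (2 ^+ N / eta * d - b + W) + 2 ^+ N * d by field; rewrite gt_eqF.
rewrite lerD2r; apply: le_trans IH _.
by rewrite ler_pM2l // lerD2r.
Qed.

(** Otherwise consider the balls of the cut radii around 2^(4^m) of the points, and let l0 be the
    centre of one of least width. By [super_Sudakov], a ball around l0 containing all of them is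
    wider by r 2^m (1 / 128 - 4 / kap), while minimality of the penalty at l0 allows a gain of at
    most 2^m (8 r + r / kap) / eta. *)
Lemma small_separated m A S (r : R) : (0 < m <= K)%N -> 0 <= r ->
  (forall i j, i \in A -> j \in A -> dist i j <= 8 * r) ->
  (forall i, i \in A -> cut_radius m i <= r / kap) ->
  S \subset A -> separated r S -> (#|S| <= 2 ^ (4 ^ m))%N.
Proof.
move=> /andP[m0 mK] r0 Ar As SA /separatedP Ssep; rewrite leqNgt; apply/negP => cS.
have p0 : 0 < 2 ^+ m :> R by rewrite exprn_gt0.
have pK : 2 ^+ m <= 2 ^+ K :> R by rewrite ler_weXn2l //; lra.
(* Exactly 2^(4^m) points are kept, since [super_Sudakov] limits the cardinality from above as
   well. *)
pose J := [set x in take (2 ^ (4 ^ m)) (enum S)].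
have cJ : #|J| = (2 ^ (4 ^ m))%N.
  rewrite cardsE; have /card_uniqP -> : uniq (take (2 ^ (4 ^ m)) (enum S)).
    by rewrite take_uniq // enum_uniq.
  by rewrite size_take -cardE cS.
have JS i : i \in J -> i \in S by rewrite inE => /mem_take; rewrite mem_enum.
have JA i : i \in J -> i \in A by move=> /JS; exact: (fintype.subsetP SA).
have rp : 0 < r.
  rewrite lt_def r0 andbT; apply/eqP => r00.
  have : (1 < #|J|)%N.
    by rewrite cJ (leq_trans _ (leq_pexp2l _ (expn_gt0 4 m))) // expn1.
  move=> /card_gt1P[i [j [iJ jJ ij]]].
  have := Ssep i j (JS _ iJ) (JS _ jJ) ij; have := Ar i j (JA _ iJ) (JA _ jJ); lra.
have [i0 i0J] : exists i, i \in J.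
  by apply/set0Pn; rewrite -card_gt0 cJ expn_gt0.
pose cw i := ball_width i (cut_radius m i).
have [l0 l0J l0min] : exists2 l, l \in J & forall i, i \in J -> cw l <= cw i.
  by exists [arg min_(j < i0 in J) cw j]%O; case: arg_minP.
pose Ub := \bigcup_(l in J) ball l (cut_radius m l).
have ball_self l (rho : R) : 0 <= rho -> l \in ball l rho by rewrite inE distxx.
have l0U : l0 \in Ub by apply/bigcupP; exists l0 => //; apply: ball_self; exact: dist_ge0.
(* The ball around l0 through the farthest point of the union contains the union, and its radius
   competes in the definition of [cut_point]. *)
pose ks := [arg max_(j > l0 in Ub) dist l0 j]%O.
have [ksU ksmax] : ks \in Ub /\ forall j, j \in Ub -> dist l0 j <= dist l0 ks.
  by rewrite /ks; case: arg_maxP.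
have dks : dist l0 ks <= 8 * r + r / kap.
  have /bigcupP[l lJ] := ksU; rewrite inE => lk.
  apply: le_trans (dist_triangle _ _ l _) _; apply: lerD; first exact: Ar (JA _ _) (JA _ _).
  by apply: le_trans lk _; exact: As (JA _ _).
have := super_Sudakov h M hM h0 y J (fun l => ball l (cut_radius m l)) (ball l0 (dist l0 ks))
   i0 l0 (8 * r) r (2 ^+ m / 2) (r / kap) (2 ^+ m) (cw l0).
have -> : r ^+ 2 * (2 ^+ m / 2) / (8 * (8 * r)) - 4 * (r / kap) * 2 ^+ m = r * 2 ^+ m * (1 / 128 - 4 / kap).
  by field; rewrite !gt_eqF.
have r80 : 0 < 8 * r by rewrite mulr_gt0.
have rk0 : 0 < r / kap by rewrite divr_gt0.
have q0 : 0 < 2 ^+ m / 2 :> R by rewrite divr_gt0.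
move=> /(_ i0J r80 rp q0 rk0 p0).
have hq : h * (2 ^+ m / 2) <= 1.
  have := ler_wpM2l h0 pK; have := mulr_ge0 h0 (ltW p0).
  by move: hK; set a := 2 ^+ m; set b := 2 ^+ K; lra.
have hp : 2 * 2 ^+ m * h * n%:R <= 1.
  apply: le_trans hKn; have hn : 0 <= 2 * (h * n%:R) by rewrite !mulr_ge0.
  have := ler_wpM2l hn pK.
  by set a := 2 ^+ m; set b := 2 ^+ K; lra.
have cJR : #|J|%:R = (2 ^ (4 ^ m))%N%:R :> R by rewrite cJ.
move=> /(_ hq hp).
have c1 l l' : l \in J -> l' \in J -> enorm (y l - y l') <= 8 * r.
  by move=> lJ l'J; exact: Ar (JA _ _) (JA _ _).
have c2 l l' : l \in J -> l' \in J -> l != l' -> r <= enorm (y l - y l').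
  by move=> lJ l'J ll'; apply: ltW; exact: Ssep (JS _ _) (JS _ _) ll'.
have c3 : 4 * expR ((2 ^+ m / 2) ^+ 2) <= #|J|%:R :> R by rewrite cJR expR_le_pow2.
have c4 : #|J|%:R <= expR ((2 ^+ m) ^+ 2) :> R by rewrite cJR pow2_le_expR.
move=> /(_ c1 c2 c3 c4).
have c5 l i : l \in J -> i \in ball l (cut_radius m l) -> enorm (y i - y l) <= r / kap.
  move=> lJ; rewrite inE => li; apply: le_trans (As l (JA _ lJ)).
  by rewrite enormBC.
have c6 l : l \in J -> l \in ball l (cut_radius m l).
  by move=> _; apply: ball_self; exact: dist_ge0.
have c7 l : l \in J -> ball l (cut_radius m l) \subset ball l0 (dist l0 ks).
  move=> lJ; apply/fintype.subsetP => i il; rewrite inE; apply: ksmax.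
  by apply/bigcupP; exists l.
move=> /(_ c5 c6 c7 l0min); rewrite leNgt => /negP; apply.
have := penalty_min m l0 ks; rewrite /penalty -/(cut_radius m l0) -/(cw l0).
rewrite -/(ball_width l0 (dist l0 ks)).
set B := ball_width _ _; set C := cw l0 => opt.
have BC : B - C <= 2 ^+ m / eta * (8 * r + r / kap).
  have me0 : 0 <= 2 ^+ m / eta by rewrite divr_ge0 ?ltW.
  have := ler_wpM2l me0 dks; have := mulr_ge0 me0 (dist_ge0 y l0 (cut_point m l0)).
  rewrite /cut_radius in opt; lra.
have : 2 ^+ m / eta * (8 * r + r / kap) < r * 2 ^+ m * (1 / 128 - 4 / kap).
  have -> : 2 ^+ m / eta * (8 * r + r / kap) = r * 2 ^+ m * ((8 + kap^-1) / eta) by ring.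
  by rewrite ltr_pM2l ?mulr_gt0.
lra.
Qed.

(** The position of the cut radius on the scale 8 W / 4^j, encoded in m bits: 2^m labels are few
    compared with 2^(4^m), and stopping the scale leaves an error of order W / 4^m. *)
Definition label m i : {ffun 'I_m -> bool} := [ffun j : 'I_m => cut_radius m i <= 8 * W / 4 ^+ j].

Lemma label_cut_radius m i i' : label m i' = label m i ->
  cut_radius m i' <= 4 * cut_radius m i + 4 * (8 * W / 4 ^+ m).
Proof.
move=> lab.
have s0 j : 0 <= cut_radius m j by exact: dist_ge0.
have D0 (k : nat) : 0 <= 8 * W / 4 ^+ k by rewrite divr_ge0 ?exprn_ge0 // mulr_ge0 ?(W_ge0 i).
suff H (j : nat) : (j <= m)%N ->
    cut_radius m i' <= 4 * cut_radius m i \/ cut_radius m i' <= 4 * (8 * W / 4 ^+ j).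
  by have := s0 i; have := D0 m; case: (H m (leqnn m)); lra.
elim: j => [_|j IH jm].
  right; rewrite expr0 divr1; apply: le_trans (dist_le_W _ _) _.
  by have := W_ge0 i; lra.
case: (IH (ltnW jm)) => [|le4]; first by left.
have eqj : (cut_radius m i' <= 8 * W / 4 ^+ j) = (cut_radius m i <= 8 * W / 4 ^+ j).
  by have := congr1 (fun g : {ffun 'I_m -> bool} => g (Ordinal jm)) lab; rewrite !ffunE.
have e4 : 4 * (8 * W / 4 ^+ j.+1) = 8 * W / 4 ^+ j.
  by rewrite exprS; field; rewrite expf_neq0 ?pnatr_eq0.
have [lei|lti] := leP (cut_radius m i) (8 * W / 4 ^+ j).
  by right; rewrite e4 eqj.
by left; apply: le_trans le4 _; rewrite ler_pM2l // ltW.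
Qed.

Definition cell (c : I -> I) i : {set I} := [set j | c j == c i].

(** The old diameter returns with the factor 1 / 2, which makes refinement a contraction; summed
    over m, the other two terms are bounded by a multiple of [W]. *)
Definition level_bound (c : I -> I) m i : R :=
  2^-1 * (2 ^+ m * diameter (cell c i))
  + 16 * kap * (2 ^+ m * cut_radius m i) + 16 * kap * (8 * W * 2^-1 ^+ m).

Lemma kap_ge1 : 1 <= kap.
Proof.
have : 0 < (8 + kap^-1) / eta by rewrite divr_gt0 // addr_gt0 // invr_gt0.
move=> /lt_trans/(_ kap_eta) lt0; have k0 := kap0.
have : 4 / kap * kap = 4 by rewrite divfK ?gt_eqF.
have : 0 < (1 / 128 - 4 / kap) * kap by rewrite mulr_gt0.
lra.
Qed.

(* The contraction step: a partition with at most 2^(4^m) cells is refined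
   along the values of [cut_radius m] and along nets. *)
Lemma refine_level (c : I -> I) m : (m <= K)%N -> (#|c @: I| <= 2 ^ (4 ^ m))%N ->
  exists2 c' : {ffun I -> I}, (#|c' @: I| <= 2 ^ (4 ^ m.+1))%N &
    forall i, 2 ^+ m.+1 * diameter (cell c' i) <= level_bound c m i.
Proof.
move=> mK cc.
have [i0 _|noI] := pickP (@predT I); last first.
  exists [ffun i => i] => [|i]; last by have := noI i.
  by rewrite leqNgt; apply/negP => /(leq_ltn_trans (leq0n _)); rewrite card_gt0 => /set0Pn[i];
     have := noI i.
have W0 := W_ge0 i0; have k1 := kap_ge1.
have p0 : 0 < 2 ^+ m :> R by rewrite exprn_gt0.
have s0 i : 0 <= cut_radius m i by exact: dist_ge0.
(* [small_separated] starts at m = 1, so level 1 receives the trivial partition; its diameter is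
   absorbed by the last term of the bound. *)
have [m0|m0] := posnP m.
  exists [ffun _ => i0] => [|i].
    apply: leq_trans (_ : 1 <= _)%N; last by rewrite expn_gt0.
    have -> : [ffun=> i0] @: I = [set i0].
      by apply/setP => x; rewrite inE; apply/imsetP/eqP => [[j _ ->]|->]; rewrite ?ffunE //; exists i0; rewrite ?ffunE.
    by rewrite cards1.
  rewrite /level_bound m0 !expr0 !mul1r expr1 mulr1.
  have dW : diameter (cell [ffun=> i0] i) <= 8 * W.
    by apply: diameter_le => [|j k _ _]; [rewrite mulr_ge0|exact: dist_le_W].
  have d0 := diameter_ge0 y (cell c i).
  have c0 : 0 <= kap * cut_radius 0 i by rewrite mulr_ge0 ?(ltW kap0) // -m0.
  have := ler_wpM2r W0 k1; lra.
pose f i := (c i, label m i).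
(* The two summands secure the hypotheses of [small_separated]: distances at most 8 r and cut radii
   at most r / kap. Doubled by the net and again by the weight, 1 / 8 becomes the contraction factor
   1 / 2. *)
pose r (A : {set I}) := diameter A / 8 + kap * \big[Num.max/0]_(i in A) cut_radius m i.
have r0 A : 0 <= r A.
  rewrite addr_ge0 ?divr_ge0 ?diameter_ge0 // mulr_ge0 ?(ltW kap0) //; exact: bigmax_ge_id.
have sepN i S : S \subset [set j | f j == f i] -> separated (r [set j | f j == f i]) S ->
    (#|S| <= 2 ^ (4 ^ m))%N.
  set A := [set j | _]; move=> SA; apply: (small_separated m A S _ _ (r0 A) _ _ SA).
  - by rewrite m0.
  - move=> j k jA kA; apply: le_trans (dist_le_diameter y A j k jA kA) _.
    have : 0 <= kap * \big[Num.max/0]_(i in A) cut_radius m i.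
      by rewrite mulr_ge0 ?(ltW kap0) //; exact: bigmax_ge_id.
    rewrite /r; lra.
  - move=> j jA; rewrite ler_pdivlMr // mulrC.
    have : kap * cut_radius m j <= kap * \big[Num.max/0]_(i in A) cut_radius m i.
      by rewrite ler_pM2l //; exact: bigmax_ge.
    have := diameter_ge0 y A; rewrite /r; lra.
have [c' cc' dc'] := refine_partition y _ f r _ r0 sepN.
exists c' => [|i].
  apply: (leq_trans cc').
  have fc : (#|f @: I| <= #|c @: I| * 2 ^ m)%N.
    have -> : (2 ^ m)%N = #|[set: {ffun 'I_m -> bool}]%SET|.
      by rewrite cardsT card_ffun card_bool card_ord.
    rewrite -cardsX; apply: subset_leq_card; apply/fintype.subsetP => _ /imsetP[j _ ->].
    by rewrite finset.in_setX /= finset.in_setT andbT imset_f.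
  apply: leq_trans (leq_mul (leq_trans fc (leq_mul cc (leqnn _))) (leqnn _)) _.
  rewrite -!expnD leq_exp2l // expnS.
  have : (m < 4 ^ m)%N by rewrite ltn_expl.
  by move: (4 ^ m)%N => a; lia.
have le1 : diameter (cell c' i) <= 2 * r [set j | f j == f i] by exact: dc'.
have le2 : diameter [set j | f j == f i] <= diameter (cell c i).
  by apply: diameter_sub; apply/fintype.subsetP => j; rewrite !inE => /eqP[-> _].
have le3 : \big[Num.max/0]_(j in [set j | f j == f i]) cut_radius m j
    <= 4 * cut_radius m i + 4 * (8 * W / 4 ^+ m).
  apply: bigmax_le => [|j].
    by rewrite addr_ge0 ?mulr_ge0 ?invr_ge0 ?exprn_ge0.
  by rewrite inE => /eqP[_ lab]; exact: label_cut_radius.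
have le4 := ler_wpM2l (ltW kap0) le3.
have le5 : diameter (cell c' i) <= diameter (cell c i) / 4
    + 2 * (kap * (4 * cut_radius m i + 4 * (8 * W / 4 ^+ m))).
  by move: le1; rewrite /r; lra.
rewrite exprS /level_bound.
have p20 : 0 <= 2 * 2 ^+ m :> R by rewrite mulr_ge0 ?ltW.
apply: le_trans (ler_wpM2l p20 le5) _.
have e4 : 4 ^+ m = 2 ^+ m * 2 ^+ m :> R by rewrite -exprMn; congr (_ ^+ _); ring.
rewrite e4 exprVn le_eqVlt; apply/orP; left; apply/eqP; field.
by rewrite gt_eqF.
Qed.

(* Among the sequences of partitions with the prescribed cardinalities take an
   optimal one; refining it level by level cannot improve it. *)
Theorem majorizing_partitions i0 : exists c : nat -> I -> I,
  (forall m, (m <= K)%N -> (#|c m @: I| <= 2 ^ (4 ^ m))%N) /\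
  forall i, \sum_(0 <= m < K.+1) 2 ^+ m * diameter (cell (c m) i)
    <= (16 + 768 * kap + 64 * (kap * eta)) * W.
Proof.
pose C := {ffun 'I_K.+1 -> {ffun I -> I}}.
pose adm (c : C) := [forall m, #|c m @: I| <= 2 ^ (4 ^ m)]%N.
pose cn (c : C) m : I -> I := c (inord m).
pose tot (c : C) i := \sum_(0 <= m < K.+1) 2 ^+ m * diameter (cell (cn c m) i).
pose G (c : C) := \big[Num.max/0]_i tot c i.
have cst_card : #|[ffun=> i0] @: I| = 1%N.
  have -> : [ffun=> i0] @: I = [set i0].
    by apply/setP => x; rewrite inE; apply/imsetP/eqP => [[j _ ->]|->]; rewrite ?ffunE //; exists i0; rewrite ?ffunE.
  by rewrite cards1.
pose c0 : C := [ffun=> [ffun=> i0]].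
have adm0 : adm c0 by apply/forallP => m; rewrite ffunE cst_card expn_gt0.
have [c admc cmin] : exists2 c, adm c & forall c', adm c' -> G c <= G c'.
  by exists [arg min_(c < c0 | adm c) G c]%O; case: arg_minP.
have cc m : (m <= K)%N -> (#|cn c m @: I| <= 2 ^ (4 ^ m))%N.
  by move=> mK; have /forallP/(_ (inord m)) := admc; rewrite inordK.
have D0 : 0 <= 8 * W by rewrite mulr_ge0 // (W_ge0 i0).
pose T m i := if m is m'.+1 then level_bound (cn c m') m' i else 8 * W.
have [c' c'P] : exists c' : 'I_K.+1 -> {ffun I -> I}, forall m,
    (#|c' m @: I| <= 2 ^ (4 ^ m))%N /\ forall i, 2 ^+ m * diameter (cell (c' m) i) <= T m i.
  apply: (@fin_all_exists _ (fun=> {ffun I -> I}) (fun (m : 'I_K.+1) (c' : {ffun I -> I}) =>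
    (#|c' @: I| <= 2 ^ (4 ^ m))%N /\
    forall i, 2 ^+ m * diameter (cell c' i) <= T m i)) => -[[|m] mK] /=.
    exists [ffun=> i0]; split=> [|i]; first by rewrite cst_card.
    by rewrite expr0 mul1r; apply: diameter_le => // j k _ _; exact: dist_le_W.
  have [c' c'1 c'2] := refine_level (cn c m) m (ltnW mK) (cc m (ltnW mK)).
  by exists c'.
have admc' : adm (finfun c') by apply/forallP => m; rewrite ffunE; have [] := c'P m.
(* 8 W comes from level 0, 16 kap (8 + 2 eta) W from the cut radii, 256 kap W from the geometric
   errors. *)
pose B := (8 + 384 * kap + 32 * (kap * eta)) * W.
have k0 := kap0; have W0 := W_ge0 i0.
have B0 : 0 <= B.
  by apply: mulr_ge0 _ W0; have := mulr_gt0 kap0 eta0; lra.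
have bound i : tot (finfun c') i <= 2^-1 * G c + B.
  rewrite /tot.
  apply: le_trans (_ : \sum_(0 <= m < K.+1) T m i <= _).
    rewrite !big_mkord; apply: ler_sum => m _; rewrite /cn ffunE inord_val.
    by have [_] := c'P m; apply.
  rewrite big_nat_recl //= /level_bound !big_split /= -!mulr_sumr.
  have h1 : \sum_(0 <= m < K) 2 ^+ m * diameter (cell (cn c m) i) <= G c.
    apply: le_trans (bigmax_ge I predT (tot c) 0 i isT).
    by rewrite /tot big_nat_recr //= lerDl mulr_ge0 ?exprn_ge0 ?diameter_ge0.
  have h2 : \sum_(0 <= m < K) 2 ^+ m * cut_radius m i <= 8 * W + 2 * (eta * W).
    apply: le_trans (_ : \sum_(0 <= m < K.+1) 2 ^+ m * cut_radius m i <= _).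
      by rewrite big_nat_recr //= lerDl mulr_ge0 ?exprn_ge0 // /cut_radius dist_ge0.
    rewrite big_nat_recl // expr0 mul1r; apply: lerD; first exact: dist_le_W.
    have -> : \sum_(0 <= m < K) 2 ^+ m.+1 * cut_radius m.+1 i
        = 2 * \sum_(0 <= m < K) 2 ^+ m * cut_radius m.+1 i.
      by rewrite mulr_sumr; apply: eq_bigr => m _; rewrite exprS mulrA.
    by rewrite ler_pM2l // sum_cut_radius.
  have h3 : \sum_(0 <= m < K) 2^-1 ^+ m <= 2 :> R.
    have -> : \sum_(0 <= m < K) 2^-1 ^+ m = 2 - 2 * 2^-1 ^+ K :> R.
      elim: (K) => [|k IH]; first by rewrite big_nil expr0; ring.
      by rewrite big_nat_recr //= IH exprS; field.
    by rewrite gerBl mulr_ge0 // exprn_ge0 // invr_ge0.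
  have k16 : 0 <= 16 * kap by rewrite mulr_ge0 // ltW.
  have := ler_wpM2l k16 h2; have := ler_wpM2l (mulr_ge0 k16 D0) h3.
  rewrite /B; lra.
(* Optimality of [c] against its own refinement, whence G c <= 2 B. *)
have GB : G c <= 2^-1 * G c + B.
  apply: le_trans (cmin _ admc') _; apply: bigmax_le => [|i _]; last exact: bound.
  by rewrite addr_ge0 // mulr_ge0 ?invr_ge0 //; exact: bigmax_ge_id.
exists (cn c); split=> // i.
apply: le_trans (bigmax_ge I predT (tot c) 0 i isT) _; rewrite -/(G c).
by move: GB; rewrite /B; lra.
Qed.

End MajorizingMeasure.

(** * Chaining for a subgaussian vector *)

Section Chaining.
Context {R : realType} {n : nat} {O : finType}.
Context (pr : O -> R) (pr0 : forall o, 0 <= pr o) (xi : O -> 'rV[R]_n).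
Context (s : R) (s0 : 0 < s).
Context (mgf : forall v, \sum_o pr o * expR (dot v (xi o)) <= expR (s ^+ 2 * dot v v)).

Lemma mass_le1 : \sum_o pr o <= 1.
Proof.
have := mgf 0; rewrite dot0l mulr0 expR0; apply: le_trans.
by apply: ler_sum => o _; rewrite dot0l expR0 mulr1.
Qed.

Lemma sum_pr_le1 (P : pred O) : \sum_(o | P o) pr o <= 1.
Proof.
apply: le_trans mass_le1; rewrite [leRHS](bigID P) /= lerDl.
by apply: sumr_ge0.
Qed.

Lemma subgaussian_tail v (a : R) : 0 <= a ->
  \sum_(o | 2 * s * a * enorm v < dot v (xi o)) pr o <= expR (- a ^+ 2).
Proof.
move=> a0; have [v0|v0] := eqVneq v 0.
  rewrite big_pred0 ?expR_ge0 // => o; by rewrite v0 enorm0 mulr0 dot0l ltxx.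
have nv0 : 0 < enorm v.
  rewrite lt_def enorm_ge0 andbT; apply: contra_neq v0 => v0; apply: dot_eq0.
  by rewrite -enorm_sqr v0 expr0n.
pose th := a / (s * enorm v).
have th0 : 0 <= th by rewrite divr_ge0 // ltW // mulr_gt0.
pose t := 2 * s * a * enorm v.
have Markov : \sum_(o | t < dot v (xi o)) pr o * expR (th * t)
    <= \sum_o pr o * expR (dot (th *: v) (xi o)).
  rewrite [leRHS](bigID (fun o => t < dot v (xi o))) /= -[leLHS]addr0; apply: lerD.
    apply: ler_sum => o to; apply: ler_wpM2l => //; rewrite ler_expR dotZl.
    by apply: ler_wpM2l => //; exact: ltW.
  by apply: sumr_ge0 => o _; rewrite mulr_ge0 ?expR_ge0.
have := le_trans Markov (mgf (th *: v)).
rewrite -mulr_suml -/t dotZl dotZr -enorm_sqr.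
have -> : th * t = 2 * a ^+ 2 by rewrite /th /t; field; rewrite !gt_eqF.
have -> : s ^+ 2 * (th * (th * enorm v ^+ 2)) = a ^+ 2 by rewrite /th; field; rewrite !gt_eqF.
rewrite -ler_pdivlMr ?expR_gt0 // -expRN -expRD => /le_trans; apply.
by rewrite ler_expR; lra.
Qed.

Lemma union_bound (T : finType) (S : {set T}) (E : T -> pred O) :
  \sum_(o | [exists t in S, E t o]) pr o <= \sum_(t in S) \sum_(o | E t o) pr o.
Proof.
have -> : \sum_(t in S) \sum_(o | E t o) pr o = \sum_o \sum_(t in S | E t o) pr o.
  by rewrite (exchange_big_dep predT) //=.
rewrite [leRHS](bigID (fun o => [exists t in S, E t o])) /= -[leLHS]addr0; apply: lerD.
  apply: ler_sum => o /exists_inP[t tS Et].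
  rewrite (bigD1 t) /= ?tS ?Et // lerDl; exact: sumr_ge0.
by apply: sumr_ge0 => o _; exact: sumr_ge0.
Qed.

Lemma bool_union_bound (P Q : pred O) :
  \sum_(o | P o || Q o) pr o <= \sum_(o | P o) pr o + \sum_(o | Q o) pr o.
Proof.
rewrite (bigID P) /=; apply: lerD.
  by rewrite le_eqVlt; apply/orP; left; apply/eqP; apply: eq_bigl => o; case: (P o); rewrite ?andbF ?andbT.
rewrite [leRHS](bigID P) /= -[leLHS]add0r; apply: lerD; first exact: sumr_ge0.
by rewrite le_eqVlt; apply/orP; left; apply/eqP; apply: eq_bigl => o; case: (P o); rewrite ?andbF.
Qed.

Context {I : finType} (y : I -> 'rV[R]_n) (i0 : I) (y0 : y i0 = 0).
Context (N : nat) (c : nat -> I -> I) (c_inj : injective (c N)).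
Context (c_card : forall m, (m <= N)%N -> (#|c m @: I| <= 2 ^ (4 ^ m))%N).
Context (D G : R) (distD : forall i j, dist y i j <= D).
Context (sumG : forall i, \sum_(0 <= m < N.+1) 2 ^+ m * diameter y (cell (c m) i) <= G).

Definition cell_rep m i : I := odflt i0 [pick j | c m j == c m i].

Lemma cell_repP m i : cell_rep m i \in cell (c m) i.
Proof. by rewrite /cell_rep; case: pickP => [j|/(_ i)]; rewrite ?inE // eqxx. Qed.

Lemma card_cell_rep m : (m <= N)%N -> (#|cell_rep m @: I| <= 2 ^ (4 ^ m))%N.
Proof.
move=> mN; apply: leq_trans (c_card m mN).
have -> : cell_rep m @: I = (fun a => odflt i0 [pick j | c m j == a]) @: (c m @: I).
  by rewrite -imset_comp; apply: eq_imset.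
exact: leq_imset_card.
Qed.

Lemma dist_cell_rep m i : dist y (cell_rep m i) i <= diameter y (cell (c m) i).
Proof. by apply: dist_le_diameter; rewrite ?cell_repP // inE. Qed.

Lemma cell_rep_last i : cell_rep N i = i.
Proof. by apply: c_inj; have := cell_repP N i; rewrite inE => /eqP. Qed.

Definition link_bad (a : R) (t : I * I) (o : O) : bool :=
  2 * s * a * enorm (y t.2 - y t.1) < dot (y t.2 - y t.1) (xi o).

Definition links m : {set I * I} := finset.setX (cell_rep m @: I) (cell_rep m.+1 @: I).

(** At most 2^(5 * 4^m) links compete, each failing with probability at most exp(- u^2 4^m). As 4^m
    >= m + 1 and u^2 >= 8, a factor exp(- 3 m) is left over, which makes the levels summable. *)
Lemma links_tail (u : R) m : 8 <= u ^+ 2 -> 0 <= u -> (m < N)%N ->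
  \sum_(o | [exists t in links m, link_bad (u * 2 ^+ m) t o]) pr o
  <= expR (5 - u ^+ 2) * 2^-1 ^+ m.
Proof.
move=> u8 u0 mN; apply: le_trans (union_bound _ _ _) _.
have p0 : 0 <= u * 2 ^+ m by rewrite mulr_ge0 ?exprn_ge0.
apply: le_trans (_ : \sum_(t in links m) expR (- (u * 2 ^+ m) ^+ 2) <= _).
  by apply: ler_sum => t _; exact: subgaussian_tail.
rewrite sumr_const -[X in X <= _]mulr_natl exprMn sqr_pow2.
have cl : (#|links m| <= 2 ^ (5 * 4 ^ m))%N.
  rewrite cardsX; apply: leq_trans (leq_mul (card_cell_rep m (ltnW mN)) (card_cell_rep m.+1 mN)) _.
  by rewrite -expnD leq_exp2l // expnS -mulSn.
set q := (4 ^ m)%N in cl *.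
have clR : #|links m|%:R <= expR (5 * q%:R) :> R.
  apply: le_trans (_ : (2 ^ (5 * q))%N%:R <= _); first by rewrite ler_nat.
  rewrite natrX -natrM -[X in expR X]mulr1 expRM_natl.
  by apply: lerXn2r; rewrite ?nnegrE ?expR_ge0 //; have := expR_ge1Dx (1 : R); lra.
apply: le_trans (ler_wpM2r (expR_ge0 _) clR) _; rewrite -expRD.
have q1 : (m + 1)%:R <= q%:R :> R by rewrite ler_nat addn1 ltn_expl.
have q2 : 0 <= (u ^+ 2 - 5) * (q%:R - (m + 1)%:R) by rewrite mulr_ge0 //; lra.
apply: le_trans (_ : expR ((5 - u ^+ 2) + m%:R * (- 3)) <= _).
  rewrite ler_expR natrD in q2 *; have m0 : 0 <= m%:R :> R by [].
  have := mulr_ge0 m0 (_ : 0 <= u ^+ 2 - 8); rewrite subr_ge0 => /(_ u8); lra.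
rewrite expRD expRM_natl ler_pM2l ?expR_gt0 //.
apply: lerXn2r; rewrite ?nnegrE ?expR_ge0 ?invr_ge0 //.
rewrite expRN lef_pV2 ?posrE ?expR_gt0 //; have := expR_ge1Dx (3 : R); lra.
Qed.

(** A point is reached from y i0 = 0 through the representatives of its cells, the last being the
    point itself because [c N] is injective. The first link accounts for D; every other link is at
    most the sum of two consecutive cell diameters, whence 2 G. For u^2 < 8 the right-hand side
    exceeds 1. *)
Lemma chaining_tail (u : R) : 0 <= u ->
  \sum_(o | [exists i, 2 * s * u * (D + 2 * G) < dot (y i) (xi o)]) pr o
  <= 4 * expR 8 * expR (- u ^+ 2).
Proof.
move=> u0; have [u8|u8] := ltP (u ^+ 2) 8.
  apply: le_trans (sum_pr_le1 _) _; rewrite -mulrA -expRD.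
  by have := expR_ge1Dx (8 - u ^+ 2); lra.
pose bad0 o := [exists t in (cell_rep 0 @: I), link_bad u (i0, t) o].
pose bad o := [exists m : 'I_N, [exists t in links m, link_bad (u * 2 ^+ m) t o]].
have good o : ~~ (bad0 o || bad o) -> forall i, dot (y i) (xi o) <= 2 * s * u * (D + 2 * G).
  rewrite negb_or => /andP[/exists_inPn good0 /existsPn good] i.
  have su0 : 0 <= 2 * s * u by rewrite !mulr_ge0 // ltW.
  have step m : (m < N)%N -> dot (y (cell_rep m.+1 i) - y (cell_rep m i)) (xi o)
      <= 2 * s * u * (2 ^+ m * diameter y (cell (c m) i)
                      + 2 ^+ m.+1 * diameter y (cell (c m.+1) i)).
    move=> mN; have := good (Ordinal mN) => /exists_inPn/(_ (cell_rep m i, cell_rep m.+1 i)).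
    rewrite finset.in_setX /= !imset_f // => /(_ isT); rewrite /link_bad /= -leNgt => /le_trans; apply.
    have -> : 2 * s * (u * 2 ^+ m) * enorm (y (cell_rep m.+1 i) - y (cell_rep m i))
      = 2 * s * u * (2 ^+ m * enorm (y (cell_rep m.+1 i) - y (cell_rep m i))) by ring.
    apply: ler_wpM2l => //; rewrite exprS.
    have p0 : 0 <= 2 ^+ m :> R by rewrite exprn_ge0.
    have := dist_triangle y (cell_rep m.+1 i) i (cell_rep m i).
    rewrite (distC _ i) /dist => tri.
    have d1 := dist_cell_rep m i; have d2 := dist_cell_rep m.+1 i; rewrite /dist in d1 d2.
    have := ler_wpM2l p0 (le_trans tri (lerD d2 d1)).
    have := mulr_ge0 p0 (diameter_ge0 y (cell (c m.+1) i)); lra.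
  have tele k : (k <= N)%N -> dot (y (cell_rep k i)) (xi o)
      <= 2 * s * u * (D + \sum_(0 <= m < k) (2 ^+ m * diameter y (cell (c m) i)
                      + 2 ^+ m.+1 * diameter y (cell (c m.+1) i))).
    elim: k => [_|k IH kN].
      rewrite big_nil addr0; have := good0 (cell_rep 0 i) (imset_f _ isT).
      rewrite /link_bad /= y0 subr0 -leNgt => /le_trans; apply; apply: ler_wpM2l => //.
      by have := distD (cell_rep 0 i) i0; rewrite /dist y0 subr0.
    rewrite big_nat_recr //= addrA mulrDr.
    have -> : dot (y (cell_rep k.+1 i)) (xi o) = dot (y (cell_rep k i)) (xi o)
       + dot (y (cell_rep k.+1 i) - y (cell_rep k i)) (xi o) by rewrite dotBl; ring.
    by apply: lerD; [apply: IH (ltnW kN)|apply: step].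
  have := tele N (leqnn N); rewrite cell_rep_last => /le_trans; apply.
  apply: ler_wpM2l => //; rewrite lerD2l big_split /= mulrDl mul1r.
  have d0 m : 0 <= 2 ^+ m * diameter y (cell (c m) i) by rewrite mulr_ge0 ?exprn_ge0 ?diameter_ge0.
  apply: lerD; apply: le_trans (sumG i).
    by rewrite big_nat_recr //= lerDl.
  by rewrite big_nat_recl //= lerDr.
apply: le_trans (_ : \sum_(o | bad0 o || bad o) pr o <= _).
  rewrite [leRHS](bigID (fun o => [exists i, 2 * s * u * (D + 2 * G) < dot (y i) (xi o)])) /=.
  rewrite -[leLHS]addr0; apply: lerD; last exact: sumr_ge0.
  rewrite le_eqVlt; apply/orP; left; apply/eqP; apply: eq_bigl => o.
  case: (boolP [exists i, _]) => [/existsP[i lt_i]|]; rewrite ?andbF // andbT.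
  apply/esym; apply: contraTT lt_i => /good/(_ i); by rewrite -leNgt.
apply: le_trans (bool_union_bound _ _) _.
have b0 : \sum_(o | bad0 o) pr o <= 2 * expR (- u ^+ 2).
  apply: le_trans (union_bound _ _ _) _.
  apply: le_trans (_ : \sum_(t in cell_rep 0 @: I) expR (- u ^+ 2) <= _).
    by apply: ler_sum => t _; exact: subgaussian_tail.
  rewrite sumr_const -[X in X <= _]mulr_natl; apply: ler_wpM2r; first exact: expR_ge0.
  by rewrite (_ : 2 = (2 ^ (4 ^ 0))%N%:R) // ler_nat card_cell_rep.
have b1 : \sum_(o | bad o) pr o <= 2 * expR (5 - u ^+ 2).
  have -> : \sum_(o | bad o) pr o = \sum_(o | [exists m in [set: 'I_N]%SET,
      [exists t in links m, link_bad (u * 2 ^+ m) t o]]) pr o.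
    by apply: eq_bigl => o; apply: eq_existsb => m; rewrite finset.in_setT.
  apply: le_trans (union_bound _ _ _) _.
  apply: le_trans (_ : \sum_(m in [set: 'I_N]%SET) expR (5 - u ^+ 2) * 2^-1 ^+ m <= _).
    by apply: ler_sum => m _; exact: links_tail.
  rewrite -mulr_sumr mulrC; apply: ler_wpM2r; first exact: expR_ge0.
  rewrite (eq_bigl predT) => [|m]; last by rewrite finset.in_setT.
  rewrite -(big_mkord predT (fun m => 2^-1 ^+ m)).
  have -> : \sum_(0 <= m < N) 2^-1 ^+ m = 2 - 2 * 2^-1 ^+ N :> R.
    elim: (N) => [|k IH]; first by rewrite big_nil expr0; ring.
    by rewrite big_nat_recr //= IH exprS; field.
  by rewrite gerBl mulr_ge0 // exprn_ge0 // invr_ge0.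
apply: le_trans (lerD b0 b1) _; rewrite (expRD 5).
have e8 : expR 5 <= expR 8 :> R by rewrite ler_expR; lra.
have e1 : 1 <= expR 8 :> R by have := expR_ge1Dx (8 : R); lra.
have e0 := expR_ge0 (- u ^+ 2).
have := ler_wpM2r e0 e8; have := ler_wpM2r e0 e1; lra.
Qed.

End Chaining.

(** * Supporting functionals in finite dimension *)

Section HahnBanach.
Context {R : realType} {n : nat}.
Implicit Types (p : 'rV[R]_n -> R) (x z v : 'rV[R]_n) (a t : R).

Definition sublinear p :=
  (forall x z, p (x + z) <= p x + p z) /\ (forall a x, 0 <= a -> p (a *: x) <= a * p x).

Lemma sublinear0 p : sublinear p -> p 0 = 0.
Proof.
move=> [pD pZ]; apply/eqP; rewrite eq_le; apply/andP; split.
  by have := pZ 0 0 (lexx _); rewrite scaler0 mul0r.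
by have := pD 0 0; rewrite addr0; lra.
Qed.

Lemma sublinear_ge p a x : sublinear p -> 0 <= a -> a * p x <= p (a *: x).
Proof.
move=> sp a0; have [->|an0] := eqVneq a 0; first by rewrite scale0r sublinear0 // mul0r.
have ap : 0 < a by rewrite lt_def an0.
have := sp.2 a^-1 (a *: x); rewrite invr_ge0 a0 scalerA mulVf // scale1r => /(_ isT).
by rewrite ler_pdivlMl.
Qed.

(* The infimum over t >= 0 of p (x + t v) - t p v is the largest sublinear
   minorant of p that is linear along v and agrees with p at v. *)
Lemma linear_along p v : sublinear p ->
  exists p', [/\ sublinear p', (forall x, p' x <= p x) & p' (- v) <= - p v].
Proof.
move=> sp; have [pD pZ] := sp.
pose S x := [set p (x + t *: v) - t * p v | t in [set t | 0 <= t]]%classic.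
have S0 x : (S x !=set0)%classic.
  by exists (p (x + 0 *: v) - 0 * p v); exists 0 => /=.
have Slb x : lbound (S x) (- p (- x)).
  move=> _ [t /= t0 <-]; have := sublinear_ge p t v sp t0.
  by have := pD (x + t *: v) (- x); rewrite addrC addKr; lra.
have Sinf x : has_inf (S x) by split=> //; exists (- p (- x)).
have infle x t : 0 <= t -> inf (S x) <= p (x + t *: v) - t * p v.
  by move=> t0; apply: ge_inf; [exists (- p (- x))|exists t].
have leinf x b : (forall t, 0 <= t -> b <= p (x + t *: v) - t * p v) -> b <= inf (S x).
  by move=> h; apply: lb_le_inf => // _ [t /= t0 <-]; exact: h.
exists (fun x => inf (S x)); split.
- split=> [x z|a x a0].
    rewrite -lerBlDr; apply: (leinf) => t t0; rewrite lerBlDl -lerBlDr; apply: (leinf) => u u0.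
    rewrite lerBlDr; have tu : 0 <= t + u by rewrite addr_ge0.
    apply: le_trans (infle (x + z) _ tu) _; rewrite scalerDl addrACA.
    have := pD (x + t *: v) (z + u *: v); lra.
  have [->|an0] := eqVneq a 0.
    have := infle (0 *: x) 0 (lexx _); rewrite !scale0r addr0 sublinear0 // !mul0r; lra.
  have ap : 0 < a by rewrite lt_def an0.
  rewrite -ler_pdivrMl //; apply: (leinf) => t t0; rewrite ler_pdivrMl //.
  have at0 : 0 <= a * t by rewrite mulr_ge0.
  apply: le_trans (infle (a *: x) _ at0) _; rewrite -scalerA -scalerDr.
  have := pZ a (x + t *: v) a0; lra.
- by move=> x; have := infle x 0 (lexx _); rewrite scale0r addr0 mul0r subr0.
- by have := infle (- v) 1 ler01; rewrite scale1r addNr sublinear0 // mul1r sub0r.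
Qed.

Lemma linear_along_seq p (vs : seq 'rV[R]_n) : sublinear p ->
  exists p', [/\ sublinear p', (forall x, p' x <= p x)
    & forall v, v \in vs -> p' (- v) <= - p' v].
Proof.
elim: vs p => [|v vs IH] p sp; first by exists p.
have [p1 [sp1 p1p p1v]] := linear_along p v sp.
have [p2 [sp2 p2p1 p2v]] := IH p1 sp1.
exists p2; split=> // [x|w]; first exact: le_trans (p2p1 x) (p1p x).
rewrite inE => /predU1P[->|]; last exact: p2v.
apply: le_trans (p2p1 _) _; apply: le_trans p1v _; rewrite lerN2.
exact: le_trans (p2p1 v) (p1p v).
Qed.

(** Linearity along a vector passes to smaller sublinear functions, so directions can be treated in
    turn. Starting with [x0] fixes the value there; the coordinate vectors then leave a linear
    function, whose coordinates are its values on the basis. *)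
Lemma supporting_functional p x0 : sublinear p ->
  exists2 t : 'rV[R]_n, (forall x, dot t x <= p x) & p x0 <= dot t x0.
Proof.
move=> sp; have [p1 [sp1 p1p p1x0]] := linear_along p x0 sp.
have [q [sq qp1 qe]] := linear_along_seq p1 [seq delta_mx 0 k | k <- enum 'I_n] sp1.
pose t : 'rV[R]_n := \row_k q (delta_mx 0 k).
have {}qe k : q (- delta_mx 0 k) <= - q (delta_mx 0 k).
  by apply: qe; apply: map_f; rewrite mem_enum.
have q_le x : q x <= dot t x.
  rewrite {1}(row_sum_delta x) /dot.
  elim/big_ind2: _ => [|x1 a1 x2 a2 h1 h2|k _]; first by rewrite sublinear0.
    by apply: le_trans (sq.1 _ _) _; exact: lerD.
  rewrite mxE; have [x0k|/ltW x0k] := leP 0 (x 0 k).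
    by rewrite [leRHS]mulrC; exact: sq.2.
  rewrite -[x 0 k]opprK scaleNr -scalerN.
  have xk : 0 <= - x 0 k by rewrite oppr_ge0.
  apply: le_trans (sq.2 _ _ xk) _.
  by have := ler_wpM2l xk (qe k); lra.
exists t => [x|].
  have := q_le (- x); rewrite dotNr => h.
  have := sq.1 x (- x); rewrite subrr sublinear0 //.
  have := le_trans (qp1 x) (p1p x); lra.
have := q_le (- x0); rewrite dotNr.
have := sq.1 x0 (- x0); rewrite subrr sublinear0 // => h0 h1.
have h2 := le_trans (qp1 (- x0)) p1x0.
have := q_le x0; lra.
Qed.

End HahnBanach.

(** * The walk and the Gaussian vector in the convex order *)

Section LineWalk.
Context {R : realType}.
Implicit Types (f g phi : R -> R) (h t b : R).

Fixpoint line_walk h m f t : R :=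
  if m is m'.+1 then (line_walk h m' f (t + h) + line_walk h m' f (t - h)) / 2 else f t.

Lemma line_walk_le h m f g t : 0 <= h ->
  (forall r, `|r - t| <= h * m%:R -> f r <= g r) -> line_walk h m f t <= line_walk h m g t.
Proof.
move=> h0; elim: m t => [|m IH] t fg /=; first by apply: fg; rewrite subrr normr0 mulr0.
rewrite ler_pM2r ?invr_gt0 //; apply: lerD; apply: IH => r rt; apply: fg;
  rewrite -[m.+1%:R]natr1 mulrDr mulr1;
  move: rt; rewrite !ler_norml => /andP[r1 r2]; apply/andP; split; lra.
Qed.

Lemma eq_line_walk h m f g t : f =1 g -> line_walk h m f t = line_walk h m g t.
Proof. by move=> fg; elim: m t => [|m IH] t /=; rewrite ?fg // !IH. Qed.

Lemma line_walk_lin h m (a b : R) f g t : line_walk h m (fun r => a * f r + b * g r) t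
  = a * line_walk h m f t + b * line_walk h m g t.
Proof. by elim: m t => [|m IH] t //=; rewrite !IH; ring. Qed.

Lemma line_walk_affine h m (a b : R) t : line_walk h m (fun r => a + b * r) t = a + b * t.
Proof. by elim: m t => [|m IH] t //=; rewrite !IH; field. Qed.

Lemma cosh_le (u : R) : (expR u + expR (- u)) / 2 <= expR (2 * u ^+ 2).
Proof.
have [u1|u1] := leP `|u| (1 / 2).
  have := expR_le_quadratic u u1.
  have := expR_le_quadratic (- u); rewrite normrN sqrrN => /(_ u1).
  have := expR_ge1Dx (2 * u ^+ 2); lra.
have u2 : `|u| <= 2 * u ^+ 2.
  rewrite -(real_normK (num_real u)).
  have : 0 <= `|u| * (2 * `|u| - 1) by rewrite mulr_ge0 //; lra.
  lra.
have e1 : expR u <= expR (2 * u ^+ 2).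
  by rewrite ler_expR (le_trans (ler_norm u)).
have e2 : expR (- u) <= expR (2 * u ^+ 2).
  by rewrite ler_expR (le_trans (ler_norm (- u))) // normrN.
lra.
Qed.

(** One step multiplies exp(B t^2) by exp(B h^2) cosh(2 B h t), so the coefficient of t^2 grows by
    at most 8 B^2 h^2. While B <= 2 b this is at most 32 b^2 h^2, and the condition on [M] keeps B
    in that range. *)
Lemma line_walk_expR_sqr h M b m t : 0 <= b -> 32 * b * h ^+ 2 * M%:R <= 1 -> (m <= M)%N ->
  line_walk h m (fun r => expR (b * r ^+ 2)) t
  <= expR (b * (1 + 32 * b * h ^+ 2 * m%:R) * t ^+ 2 + 2 * b * h ^+ 2 * m%:R).
Proof.
move=> b0 bM; elim: m t => [|m IH] t mM /=; first by rewrite !mulr0 !addr0 mulr1.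
have := IH (t + h) (ltnW mM); have := IH (t - h) (ltnW mM).
rewrite -[m.+1%:R]natr1.
set B := b * (1 + _); set c := 2 * b * h ^+ 2 * m%:R.
have bh0 : 0 <= 32 * b * h ^+ 2 by apply: mulr_ge0 (sqr_ge0 _); apply: mulr_ge0 => //; rewrite ler0n.
have tm0 : 0 <= 32 * b * h ^+ 2 * m%:R by rewrite mulr_ge0.
have tm1 : 32 * b * h ^+ 2 * m%:R <= 1.
  by apply: le_trans bM; apply: ler_wpM2l; rewrite // ler_nat ltnW.
have B0 : 0 <= B by rewrite mulr_ge0 // addr_ge0.
have B2 : B <= 2 * b by rewrite /B mulrC; apply: ler_wpM2r => //; lra.
have h2 : 0 <= h ^+ 2 by exact: sqr_ge0.
move=> le1 le2.
have e1 : B * (t + h) ^+ 2 + c = (B * t ^+ 2 + B * h ^+ 2 + c) + 2 * B * h * t by ring.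
have e2 : B * (t - h) ^+ 2 + c = (B * t ^+ 2 + B * h ^+ 2 + c) + - (2 * B * h * t) by ring.
rewrite e1 expRD in le2; rewrite e2 expRD in le1.
set E := expR (_ + c) in le1 le2; have E0 : 0 <= E by exact: expR_ge0.
have cs := ler_wpM2l E0 (cosh_le (2 * B * h * t)).
apply: le_trans (_ : E * expR (2 * (2 * B * h * t) ^+ 2) <= _); first by lra.
rewrite /E -expRD ler_expR.
have q1 := ler_wpM2r h2 B2.
have BB : B ^+ 2 <= (2 * b) ^+ 2 by rewrite ler_pXn2r ?nnegrE // mulr_ge0.
have q2 : 0 <= 8 * h ^+ 2 * t ^+ 2 by apply: mulr_ge0 (sqr_ge0 _); apply: mulr_ge0.
have q3 := ler_wpM2l q2 BB.
have -> : b * (1 + 32 * b * h ^+ 2 * (m%:R + 1)) * t ^+ 2 + 2 * b * h ^+ 2 * (m%:R + 1)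
    = B * t ^+ 2 + c + (8 * h ^+ 2 * t ^+ 2 * (2 * b) ^+ 2 + 2 * b * h ^+ 2).
  by rewrite /B /c; ring.
by clearbody B c; lra.
Qed.

(* A symmetric random walk is dominated in the convex order by a centred
   discrete law (C, w, hv) with Gaussian tails: a convex psi >= 0 with psi(0) = 0
   satisfies psi(r) w(hv >= r / c') <= c' sum w psi(hv). *)
Lemma line_walk_domination (C : finType) (w hv : C -> R) h M (V c0 c' v0 : R) phi :
  0 <= h -> (forall c, 0 <= w c) -> \sum_c w c <= 1 -> \sum_c w c * hv c = 0 ->
  0 < c0 -> 0 < c' <= 1 -> c' * expR 1 <= c0 -> 32 * h ^+ 2 * M%:R <= c' ^+ 2 ->
  h * M%:R <= c' * V ->
  (forall v, 0 <= v <= V -> c0 * expR (- v ^+ 2) <= \sum_(c | v <= hv c) w c) ->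
  (forall v, 0 <= v <= V -> c0 * expR (- v ^+ 2) <= \sum_(c | hv c <= - v) w c) ->
  (forall r, phi 0 + v0 * r <= phi r) ->
  (forall a r, 0 <= a <= 1 -> phi (a * r) <= (1 - a) * phi 0 + a * phi r) ->
  (\sum_c w c) * line_walk h M phi 0 <= \sum_c w c * phi (hv c).
Proof.
move=> h0 w0 w1 wc c00 /andP[c'0 c'1] c'c0 hM hMV tailp tailm tang conv.
(* Both laws are centred, so subtracting the tangent at 0 removes the total mass of [w] times phi 0
   from both sides; the remainder is nonnegative and vanishes at 0. *)
pose psi r := phi r - (phi 0 + v0 * r).
have psi0 r : 0 <= psi r by rewrite subr_ge0.
have psiZ a r : 0 <= a <= 1 -> psi (a * r) <= a * psi r.
  by move=> a01; have := conv a r a01; rewrite /psi; lra.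
pose tot := \sum_c w c * psi (hv c).
have tot0 : 0 <= tot by apply: sumr_ge0 => c _; rewrite mulr_ge0.
have part (P : pred C) : \sum_(c | P c) w c * psi (hv c) <= tot.
  by rewrite /tot [leRHS](bigID P) /= lerDl; apply: sumr_ge0 => c _; rewrite mulr_ge0.
have scaled r s : c' * `|s| >= `|r| -> 0 <= r * s -> psi r <= c' * psi s.
  have [->|s0] := eqVneq s 0.
    rewrite normr0 mulr0 normr_le0 => /eqP -> _.
    by have := psiZ 0 0; rewrite mul0r lexx ler01 mul0r => /(_ isT)/le_trans; apply; rewrite mulr_ge0 // ltW.
  move=> rs rs0; have ns0 : 0 < `|s| by rewrite normr_gt0.
  have a0 : 0 <= r / s.
    have -> : r / s = r * s / s ^+ 2 by field.
    by rewrite divr_ge0 ?sqr_ge0.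
  have a1 : r / s <= c'.
    by rewrite -(ger0_norm a0) normf_div ler_pdivrMr.
  have {1}-> : r = r / s * s by rewrite divfK.
  apply: le_trans (psiZ _ _ _) _; first by rewrite a0 (le_trans a1).
  by apply: ler_wpM2r.
(* Each value of [hv] beyond r / c' contributes its mass times at least psi r / c' to [tot], and the
   tail hypothesis bounds that mass from below. The resulting growth exp(r^2 / c'^2) has mean at
   most e along the walk. *)
have bound r : `|r| <= h * M%:R -> psi r <= c' / c0 * tot * expR (c'^-1 ^+ 2 * r ^+ 2).
  move=> rM; pose v := `|r| / c'.
  have vV : 0 <= v <= V by rewrite divr_ge0 ?(ltW c'0) // ler_pdivrMr // mulrC (le_trans rM).
  have cv : c' * v = `|r| by rewrite /v mulrC divfK // gt_eqF.
  suff key : c0 * expR (- v ^+ 2) * psi r <= c' * tot.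
    have -> : c'^-1 ^+ 2 * r ^+ 2 = v ^+ 2.
      by rewrite /v exprMn real_normK ?num_real // mulrC.
    have E0 := expR_gt0 (v ^+ 2).
    have : psi r = (c0 * expR (- v ^+ 2) * psi r) * (expR (v ^+ 2) / c0).
      rewrite expRN; field; rewrite !gt_eqF //.
    move=> ->; apply: le_trans (ler_wpM2r _ key) _; first by rewrite divr_ge0 // ltW.
    rewrite le_eqVlt; apply/orP; left; apply/eqP; field; by rewrite gt_eqF.
  have [r0|/ltW r0] := leP 0 r.
    apply: le_trans (ler_wpM2r (psi0 r) (tailp v vV)) _.
    rewrite mulr_suml; apply: le_trans (ler_wpM2l (ltW c'0) (part (fun c => v <= hv c))).
    rewrite mulr_sumr; apply: ler_sum => c vc; rewrite mulrCA; apply: ler_wpM2l => //.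
    have hc0 : 0 <= hv c by apply: le_trans vc; case/andP: vV.
    apply: scaled; last by rewrite mulr_ge0.
    by rewrite -cv ler_pM2l // ger0_norm.
  apply: le_trans (ler_wpM2r (psi0 r) (tailm v vV)) _.
  rewrite mulr_suml; apply: le_trans (ler_wpM2l (ltW c'0) (part (fun c => hv c <= - v))).
  rewrite mulr_sumr; apply: ler_sum => c vc; rewrite mulrCA; apply: ler_wpM2l => //.
  have hc0 : hv c <= 0 by apply: le_trans vc _; rewrite oppr_le0; case/andP: vV.
  apply: scaled; last by rewrite mulr_le0.
  by rewrite -cv ler_pM2l // ler0_norm // lerNr.
have Epsi : line_walk h M psi 0 <= tot.
  apply: le_trans (_ : line_walk h M (fun r => c' / c0 * tot * expR (c'^-1 ^+ 2 * r ^+ 2) + 0 * 0) 0 <= _).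
    by apply: line_walk_le => // r; rewrite subr0 mul0r addr0 => /bound.
  rewrite line_walk_lin mul0r addr0.
  have b0 : 0 <= c'^-1 ^+ 2 by exact: sqr_ge0.
  have bM : 32 * c'^-1 ^+ 2 * h ^+ 2 * M%:R <= 1.
    have -> : 32 * c'^-1 ^+ 2 * h ^+ 2 * M%:R = 32 * h ^+ 2 * M%:R / c' ^+ 2 by rewrite exprVn; ring.
    by rewrite ler_pdivrMr ?exprn_gt0 // mul1r.
  have := line_walk_expR_sqr h M _ M 0 b0 bM (leqnn M).
  rewrite expr0n mulr0 add0r => /le_trans le1.
  have le2 : line_walk h M (fun r => expR (c'^-1 ^+ 2 * r ^+ 2)) 0 <= expR 1.
    by apply: le1; rewrite ler_expR; lra.
  have k0 : 0 <= c' / c0 * tot by rewrite mulr_ge0 // divr_ge0 // ltW.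
  apply: le_trans (ler_wpM2l k0 le2) _.
  have -> : c' / c0 * tot * expR 1 = (c' * expR 1) / c0 * tot by ring.
  by rewrite -[leRHS]mul1r; apply: ler_wpM2r => //; rewrite ler_pdivrMr // mul1r.
have e1 : line_walk h M phi 0 = phi 0 + line_walk h M psi 0.
  have -> : line_walk h M phi 0 = line_walk h M (fun r => 1 * psi r + 1 * (phi 0 + v0 * r)) 0.
    by apply: eq_line_walk => r; rewrite /psi; ring.
  by rewrite line_walk_lin line_walk_affine; ring.
have e2 : \sum_c w c * phi (hv c) = (\sum_c w c) * phi 0 + tot.
  have -> : tot = \sum_c (w c * phi (hv c) - (w c * phi 0 + v0 * (w c * hv c))).
    by apply: eq_bigr => c _; rewrite /psi; ring.
  by rewrite sumrB big_split /= -mulr_suml -mulr_sumr wc; ring.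
rewrite e1 e2 mulrDr lerD2l.
have W0 : 0 <= \sum_c w c by exact: sumr_ge0.
by have := ler_wpM2l W0 Epsi; have := ler_wpM2r tot0 w1; lra.
Qed.

End LineWalk.

(** * Coordinatewise comparison with a discrete product law *)

Section GridDomination.
Context {R : realType} {n : nat}.
Implicit Types (x : 'rV[R]_n) (F : 'rV[R]_n -> R) (G : 'rV[R]_n -> 'rV[R]_n) (ks : seq 'I_n) (h : R).

Lemma walk_line h k m F x (t : R) : walk h 0 (nseq m k) F (x + t *: delta_mx 0 k)
  = line_walk h m (fun r => F (x + r *: delta_mx 0 k)) t.
Proof.
elim: m t => [|m IH] t //=; rewrite -!IH /bstep !mxE mulr0 addr0 subr0 !mul1r.
by rewrite -addrA -scalerDl -addrA -scalerBl.
Qed.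

Lemma bstepC h k l F x : bstep h 0 k (bstep h 0 l F) x = bstep h 0 l (bstep h 0 k F) x.
Proof.
rewrite /bstep !mxE mulr0 addr0 subr0 !mul1r.
set a := h *: _; set b := h *: _.
by rewrite (addrAC x a b) (addrAC x a (- b)) (addrAC x (- a) b) (addrAC x (- a) (- b)); field.
Qed.

Lemma walk_rem h k ks F x : k \in ks -> walk h 0 ks F x = bstep h 0 k (walk h 0 (rem k ks) F) x.
Proof.
elim: ks x => // l ks IH x; rewrite inE /=; case: eqVneq => [->|kl] /=; first by [].
move=> kks; rewrite bstepC {1}/bstep !IH //.
Qed.

(** Steps without drift commute, so the rounds can be regrouped into [M] consecutive steps in each
    coordinate, as an exchange of one coordinate at a time requires. *)
Lemma walk_perm h ks ks' F x : perm_eq ks ks' -> walk h 0 ks F x = walk h 0 ks' F x.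
Proof.
elim: ks ks' x => [|k ks IH] ks' x pks.
  by move: pks; rewrite perm_sym => /perm_nilP ->.
have kks' : k \in ks' by rewrite -(perm_mem pks) mem_head.
rewrite (walk_rem _ _ _ _ _ kks') /=.
have {}pks : perm_eq ks (rem k ks').
  by rewrite -(perm_cons k) (perm_trans pks) // perm_to_rem.
by rewrite /bstep !(IH _ _ pks).
Qed.

Lemma perm_columns_rounds M :
  perm_eq (flatten [seq nseq M k | k <- enum 'I_n]) (rounds M).
Proof.
apply/permP => a; rewrite /rounds !count_flatten map_nseq sumn_nseq.
elim: (enum 'I_n) => //= k s ->; rewrite count_nseq mulnDl.
by congr addn; rewrite mulnC.
Qed.

Context {C : finType} (w hv : C -> R).

Definition grid_step (k : 'I_n) F x : R := \sum_c w c * F (x + hv c *: delta_mx 0 k).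

Definition grid_mean ks F : 'rV[R]_n -> R := foldr grid_step F ks.

Lemma grid_mean_lin (a b : R) F1 F2 ks x : grid_mean ks (fun z => a * F1 z + b * F2 z) x
  = a * grid_mean ks F1 x + b * grid_mean ks F2 x.
Proof.
elim: ks x => [|k ks IH] x //=; rewrite /grid_step !mulr_sumr -big_split /=.
by apply: eq_bigr => c _; rewrite IH; ring.
Qed.

Lemma grid_mean_cst (a : R) ks x : grid_mean ks (fun=> a) x = (\sum_c w c) ^+ size ks * a.
Proof.
elim: ks x => [|k ks IH] x /=; first by rewrite mul1r.
rewrite exprS -mulrA mulr_suml; apply: eq_bigr => c _; congr (_ * _); exact: IH.
Qed.

(** Averaging the later coordinates over the walk leaves a function convex in the current one, to
    which [line_walk_domination] applies. Each exchange costs one factor of the total mass of [w],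
    which truncating the Gaussian may push below 1. *)
Lemma grid_mean_ge h M (V c0 c' : R) F G ks x :
  0 <= h -> (forall c, 0 <= w c) -> \sum_c w c <= 1 -> \sum_c w c * hv c = 0 ->
  0 < c0 -> 0 < c' <= 1 -> c' * expR 1 <= c0 -> 32 * h ^+ 2 * M%:R <= c' ^+ 2 ->
  h * M%:R <= c' * V ->
  (forall v, 0 <= v <= V -> c0 * expR (- v ^+ 2) <= \sum_(c | v <= hv c) w c) ->
  (forall v, 0 <= v <= V -> c0 * expR (- v ^+ 2) <= \sum_(c | hv c <= - v) w c) ->
  subgradient F G ->
  (\sum_c w c) ^+ size ks * walk h 0 (flatten [seq nseq M k | k <- ks]) F x
  <= grid_mean ks F x.
Proof.
move=> h0 w0 w1 wc c00 c'01 c'c0 hM hMV tailp tailm sg.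
elim: ks x => [|k ks IH] x /=; first by rewrite mul1r.
have W0 : 0 <= \sum_c w c by exact: sumr_ge0.
rewrite walk_cat; set H := walk h 0 (flatten _) F in IH *.
have sgH : subgradient H (vwalk h 0 (flatten [seq nseq M k | k <- ks]) G).
  by apply: subgradient_walk => //; exact: small_drift0.
apply: le_trans (_ : (\sum_c w c) ^+ size ks * grid_step k H x <= _); last first.
  rewrite /grid_step mulr_sumr; apply: ler_sum => c _.
  by rewrite mulrCA; apply: ler_wpM2l.
rewrite exprSr -mulrA; apply: ler_wpM2l; first exact: exprn_ge0.
rewrite -[X in walk _ _ _ _ X](addr0 x) -[X in x + X](scale0r (delta_mx 0 k)) walk_line.
pose phi r := H (x + r *: delta_mx 0 k).
apply: (line_walk_domination C w hv h M V c0 c' (vwalk h 0 (flatten [seq nseq M k | k <- ks]) G x 0 k) phi) => //.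
  move=> r; have := sgH x (x + r *: delta_mx 0 k).
  by rewrite /phi scale0r addr0 (addrAC x) subrr add0r dotZr dot_delta mulrC.
move=> a r a01; have := subgradient_convex H _ x (x + r *: delta_mx 0 k) a sgH a01.
rewrite /phi scale0r addr0; congr (_ <= _); congr H.
by apply/rowP => j; rewrite !mxE; ring.
Qed.

End GridDomination.

(** * Rounding a Gaussian variable to a grid *)

Section GaussianCells.
Local Open Scope classical_set_scope.
Context {R : realType}.
Local Notation gauss := (normal_prob (0 : R) 1).

Lemma normal_pdf01E (x : R) :
  normal_pdf 0 1 x = normal_peak 1 * expR (- x ^+ 2 / 2).
Proof. by rewrite normal_pdfE ?oner_eq0 //= /normal_fun subr0 expr1n. Qed.

Lemma gauss_itv_oo (b0 b1 : bool) (a b : R) :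
  gauss [set` Interval (BSide b0 a) (BSide b1 b)] = gauss `]a, b[.
Proof.
rewrite /normal_prob integral_itv_bndoo //.
by apply/measurable_EFinP; apply: measurable_funTS; exact: measurable_normal_pdf.
Qed.

Lemma gauss_opp (a b : R) : a <= b -> gauss `[- b, - a[ = gauss `[a, b[.
Proof.
move=> ab; rewrite !gauss_itv_oo -(gauss_itv_oo true false) -[RHS](gauss_itv_oo true false).
rewrite /normal_prob integration_by_substitution_oppr //.
  by apply: eq_integral => x _; rewrite /= !normal_pdf01E sqrrN.
apply: continuous_subspaceT => x; apply: continuous_normal_pdf; exact: oner_neq0.
Qed.

Lemma gauss_fin (A : set R) : measurable A -> gauss A \is a fin_num.
Proof. by move=> mA; exact: fin_num_measure. Qed.

(** On [v, v + 1] the density is at least its value at v + 1, and (v + 1)^2 / 2 <= v^2 + 1. *)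
Lemma gauss_unit_ge (v : R) : 0 <= v ->
  normal_peak 1 * expR (- 1) * expR (- v ^+ 2) <= fine (gauss `[v, v + 1[).
Proof.
move=> v0; rewrite -lee_fin fineK ?gauss_fin //.
set c := _ * _ * _.
have c0 : 0 <= c by rewrite !mulr_ge0 ?expR_ge0 ?normal_peak_ge0.
have -> : c%:E = (\int[lebesgue_measure]_(x in `[v, (v + 1)%R[) c%:E)%E.
  rewrite integral_cst //= lebesgue_measure_itv /= lte_fin ltrDl ltr01.
  by rewrite -EFinB addrAC subrr add0r mule1.
apply: ge0_le_integral => //.
- by apply/measurable_EFinP; apply: measurable_funTS; exact: measurable_normal_pdf.
- move=> x; rewrite /= in_itv /= => /andP[vx xv]; rewrite lee_fin normal_pdf01E.
  rewrite /c -mulrA -expRD ler_pM2l ?normal_peak_gt0 ?oner_neq0 // ler_expR.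
  have : x ^+ 2 <= (v + 1) ^+ 2 by rewrite ler_pXn2r ?nnegrE //; lra.
  have := sqr_ge0 (v - 1); lra.
Qed.

Lemma gauss_large (d : R) : 0 < d ->
  exists B : nat, forall b : R, B%:R <= b -> 1 - d <= fine (gauss `[- b, b[).
Proof.
move=> d0; pose F (m : nat) : set R := `[- m%:R, m%:R[.
have mF m : measurable (F m) by exact: measurable_itv.
have UF : \bigcup_m F m = setT.
  rewrite -subTset => x _; exists (Num.truncn `|x|).+1 => //=.
  rewrite /F /= in_itv /=; have /andP[_ xt] := truncn_itv (normr_ge0 x).
  by have := ler_norm x; have := ler_norm (- x); rewrite normrN; lra.
have homF : {homo F : m k / (m <= k)%N >-> (m <= k)%O}.
  move=> m k mk; apply/subsetPset => x; rewrite /F /= !in_itv /= => /andP[x1 x2].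
  have mkR : m%:R <= k%:R :> R by rewrite ler_nat.
  by apply/andP; split; lra.
have mUF : measurable (\bigcup_m F m) by rewrite UF.
have gT : gauss setT = 1%E by exact: (probability_setT gauss).
have : gauss (F m) @[m --> \oo] --> 1%:E.
  by rewrite -gT -UF; exact: (@nondecreasing_cvg_mu _ _ _ gauss F mF mUF homF).
move=> /fine_cvgP[_] /cvgrPdist_le/(_ d d0)[B _ HB].
exists B => b Bb; have := HB B (leqnn B); rewrite /= ler_norml => /andP[_].
rewrite lerBlDr addrC -lerBlDr => /le_trans; apply.
rewrite fine_le ?gauss_fin //; apply: le_measure; rewrite ?inE //; first exact: mF.
by move=> x; rewrite /F /= !in_itv /= => /andP[x1 x2]; apply/andP; split; lra.
Qed.

Context (J : nat) (eta : R) (eta0 : 0 < eta).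
Notation C := 'I_(J + J).

Definition grid_point (c : nat) : R := (c%:R - J%:R) * eta.

Definition grid_cell (c : nat) : set R := `[grid_point c, grid_point c.+1[.

(* Rounding away from the origin preserves the lower bounds on the tails. *)
Definition grid_value (c : nat) : R := if (J <= c)%N then grid_point c.+1 else grid_point c.

Definition grid_weight (c : nat) : R := fine (gauss (grid_cell c)).

Lemma measurable_grid_cell c : measurable (grid_cell c).
Proof. exact: measurable_itv. Qed.

Lemma grid_weight_ge0 c : 0 <= grid_weight c.
Proof. by rewrite fine_ge0 // measure_ge0. Qed.

Lemma grid_pointS c : grid_point c.+1 = grid_point c + eta.
Proof. by rewrite /grid_point -natr1; ring. Qed.

Lemma grid_cell_value c x : grid_cell c x -> `|x - grid_value c| <= eta.
Proof.
rewrite /grid_cell /grid_value /= in_itv /= grid_pointS => /andP[x1 x2].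
by rewrite ler_norml; case: ifP => _; apply/andP; split; lra.
Qed.

Lemma grid_cell_inj c c' x : grid_cell c x -> grid_cell c' x -> c = c'.
Proof.
rewrite /grid_cell /= !in_itv /= /grid_point => /andP[a1 a2] /andP[b1 b2].
have lt1 : (c < c'.+1)%N.
  by rewrite -(ltr_nat R) -(ltrD2r (- J%:R)) -(ltr_pM2r eta0) (le_lt_trans a1).
have lt2 : (c' < c.+1)%N.
  by rewrite -(ltr_nat R) -(ltrD2r (- J%:R)) -(ltr_pM2r eta0) (le_lt_trans b1).
by lia.
Qed.

(** Reversing the index is reflection at the origin. This symmetry gives the mean zero required by
    the convex order, and the lower tails from the upper ones. *)
Lemma grid_rev (c : C) : grid_weight (rev_ord c) = grid_weight c /\
  grid_value (rev_ord c) = - grid_value c.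
Proof.
have e (k : nat) : (k <= J + J)%N -> grid_point (J + J - k) = - grid_point k.
  by move=> kJ; rewrite /grid_point natrB // natrD; ring.
have cJ := ltn_ord c.
have e1 : grid_point (rev_ord c) = - grid_point c.+1 by rewrite /= e.
have e2 : grid_point (rev_ord c).+1 = - grid_point c by rewrite /= -subSn // subSS e // ltnW.
split.
  rewrite /grid_weight /grid_cell e1 e2 gauss_opp //.
  by rewrite grid_pointS lerDl ltW.
rewrite /grid_value e1 e2.
have -> : (J <= rev_ord c)%N = (c < J)%N.
  rewrite /=; move: cJ; move: (nat_of_ord c) => m cJ; lia.
by case: (leqP J c).
Qed.

Lemma sum_grid_mean : \sum_(c : C) grid_weight c * grid_value c = 0.
Proof.
have : \sum_(c : C) grid_weight c * grid_value c = - \sum_(c : C) grid_weight c * grid_value c.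
  rewrite [LHS](reindex_inj rev_ord_inj) -sumrN; apply: eq_bigr => c _.
  by have [-> ->] := grid_rev c; rewrite mulrN.
lra.
Qed.

Lemma gauss_grid_union (P : pred C) :
  (gauss (\big[setU/set0]_(c < J + J | P c) grid_cell c)
   = (\sum_(c < J + J | P c) grid_weight c)%:E)%E.
Proof.
rewrite (measure_bigsetU_ord gauss P); last 2 first.
- by move=> c; exact: measurable_grid_cell.
- by move=> c c' _ _ [x [/grid_cell_inj h /h e]]; exact: val_inj.
rewrite -sumEFin; apply: eq_bigr => c _.
by rewrite /grid_weight fineK // gauss_fin //; exact: measurable_grid_cell.
Qed.

Lemma sum_grid_weight_le1 (P : pred C) : \sum_(c : C | P c) grid_weight c <= 1.
Proof.
rewrite -lee_fin -gauss_grid_union; apply: probability_le1.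
by apply: bigsetU_measurable => c _; exact: measurable_grid_cell.
Qed.

Lemma sum_grid_weight_ge (P : pred C) (A : set R) : measurable A ->
  (forall x, A x -> - (J%:R * eta) <= x < J%:R * eta) ->
  (forall (c : C) x, A x -> grid_cell c x -> P c) ->
  fine (gauss A) <= \sum_(c : C | P c) grid_weight c.
Proof.
move=> mA Arange AP; rewrite -lee_fin fineK ?gauss_fin // -gauss_grid_union.
apply: le_measure; rewrite ?inE //; first by apply: bigsetU_measurable => c _; exact: measurable_grid_cell.
move=> x Ax; have /andP[x1 x2] := Arange x Ax.
have y0 : 0 <= (x + J%:R * eta) / eta by rewrite divr_ge0 ?(ltW eta0) //; lra.
have /andP[t1 t2] := truncn_itv y0; set t := Num.truncn _ in t1 t2.
rewrite ler_pdivlMr // in t1; rewrite ltr_pdivrMr // in t2.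
have tJ : (t < J + J)%N.
  by rewrite -(ltr_nat R) -(ltr_pM2r eta0) natrD; lra.
have xt : grid_cell (Ordinal tJ) x.
  by rewrite /grid_cell /grid_point /= in_itv /=; apply/andP; split; lra.
rewrite (bigD1 (Ordinal tJ)) ?(AP _ x) //; by left.
Qed.

Lemma grid_tail (v : R) : 0 <= v -> v + 1 <= J%:R * eta ->
  normal_peak 1 * expR (- 1) * expR (- v ^+ 2) <= \sum_(c : C | v <= grid_value c) grid_weight c.
Proof.
move=> v0 vJ; apply: le_trans (gauss_unit_ge v v0) _.
apply: sum_grid_weight_ge => // [x|c x]; rewrite /= in_itv /= => /andP[x1 x2].
  by apply/andP; split; lra.
rewrite /grid_cell /= in_itv /= => /andP[c1 c2].
rewrite /grid_value; case: leqP => [_|cJ]; first by apply: ltW; apply: le_lt_trans c2.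
have : grid_point c.+1 <= 0.
  rewrite /grid_point; have : (c.+1%:R : R) <= J%:R by rewrite ler_nat.
  by move=> h; rewrite mulr_le0_ge0 ?(ltW eta0) // subr_le0.
lra.
Qed.

Lemma grid_tail_opp (v : R) : 0 <= v -> v + 1 <= J%:R * eta ->
  normal_peak 1 * expR (- 1) * expR (- v ^+ 2) <= \sum_(c : C | grid_value c <= - v) grid_weight c.
Proof.
move=> v0 vJ; apply: le_trans (grid_tail v v0 vJ) _.
rewrite [leLHS](reindex_inj rev_ord_inj) le_eqVlt; apply/orP; left; apply/eqP.
apply: eq_big => [c|c _]; last by have [-> _] := grid_rev c.
by have [_ ->] := grid_rev c; rewrite lerNr.
Qed.

End GaussianCells.

(** * Gaussian expectations bounded below by grid sums *)

Section SimpleMinorant.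
Import HBNNSimple.
Local Open Scope classical_set_scope.
Context {R : realType} {n : nat}.
Context {d : measure_display} {W : measurableType d} (Q : probability W R).

Lemma nnsfun_integral_le (s : {nnsfun W >-> R}) (f : W -> \bar R) :
  (forall t, (s t)%:E <= f t)%E -> (\int[Q]_t (s t)%:E <= \int[Q]_t f t)%E.
Proof.
move=> sf; rewrite integralT_nnsfun ge0_integralTE => [|t].
  by apply: ereal_sup_ubound; exists s.
by apply: le_trans (sf t); rewrite lee_fin.
Qed.

Lemma nnsfun_sum_exists (C : finType) (s : C -> {nnsfun W >-> R}) :
  exists s' : {nnsfun W >-> R}, (forall t, s' t = \sum_c s c t) /\
    (\int[Q]_t (s' t)%:E = \sum_c \int[Q]_t (s c t)%:E)%E.
Proof.
exists (\big[add_nnsfun/nnsfun0]_(c <- index_enum C) s c).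
have e t : (\big[@add_nnsfun _ W R/@nnsfun0 _ W R]_(c <- index_enum C) s c) t = \sum_c s c t.
  by elim: (index_enum C) => [|c r IH]; rewrite ?big_nil // !big_cons /= IH.
split=> //; under eq_integral do rewrite e -sumEFin.
rewrite (@ge0_integral_sum _ _ _ Q _ measurableT _ (fun c t => (s c t)%:E)) //.
  by move=> c; apply/measurable_EFinP; exact: measurable_funP.
by move=> c t _; rewrite lee_fin.
Qed.

Context (g : 'I_n -> {RV Q >-> R}) (g_gauss : forall i, standard_gaussian Q (g i))
  (g_indep : mutually_independent Q g).
Context (C : finType) (cell : C -> set R) (hv : C -> R) (eta e0 : R).
Context (cell_meas : forall c, measurable (cell c))
  (cell_inj : forall c c' x, cell c x -> cell c' x -> c = c')
  (cell_near : forall c x, cell c x -> `|x - hv c| <= eta).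
Context (p : 'rV[R]_n -> R) (p_ge0 : forall x, 0 <= p x)
  (p_near : forall x z : 'rV[R]_n, (forall k, `|x 0 k - z 0 k| <= eta) -> p z - e0 <= p x).

Let w c := fine (normal_prob (0 : R) 1 (cell c)).
Let G t : 'rV[R]_n := \row_i g i t.

Lemma box_measurable (J : {set 'I_n}) (b : 'I_n -> C) :
  measurable [set t | forall i, i \in J -> cell (b i) (g i t)].
Proof.
have -> : [set t | forall i, i \in J -> cell (b i) (g i t)]
    = \bigcap_(i in [set i | i \in J]) (g i @^-1` cell (b i)).
  by apply/seteqP; split=> t /=.
apply: fin_bigcap_measurable => // i _.
by rewrite -[_ @^-1` _]setTI; exact: (measurable_funP (g i)).
Qed.

Lemma box_probability (J : {set 'I_n}) (b : 'I_n -> C) :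
  Q [set t | forall i, i \in J -> cell (b i) (g i t)] = (\prod_(i in J) w (b i))%:E.
Proof.
rewrite (g_indep J (fun i => cell (b i))) // -prodEFin; apply: eq_bigr => i _.
rewrite /w -(g_gauss i _ (cell_meas (b i))) fineK //.
exact: (fin_num_measure (distribution Q (g i))).
Qed.

(** [J] holds the coordinates whose cells [b] are chosen, [ks] the others. With all cells chosen the
    minorant is a constant on a box, whose probability is a product by independence. Choosing one
    more cell splits the box; the minorants of the pieces have disjoint supports, so their sum stays
    below p(G). *)
Lemma simple_minorant ks (J : {set 'I_n}) (b : 'I_n -> C) : uniq ks ->
  (forall k, (k \in J) = (k \notin ks)) ->
  exists s : {nnsfun W >-> R}, [/\ forall t, s t <= p (G t),
    forall t, s t != 0 -> forall i, i \in J -> cell (b i) (g i t)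
    & ((\prod_(i in J) w (b i)
        * grid_mean w hv ks (fun x => p x - e0) (\sum_(i in J) hv (b i) *: delta_mx 0 i))%:E
       <= \int[Q]_t (s t)%:E)%E].
Proof.
elim: ks J b => [|k ks IH] J b.
  move=> _ JT; set x := \sum_(i in J) _.
  have [m0 m1] : 0 <= Num.max 0 (p x - e0) /\ p x - e0 <= Num.max 0 (p x - e0).
    by rewrite !le_max !lexx orbT.
  exists (scale_nnsfun (indic_nnsfun R (box_measurable J b)) m0); split => /=.
  - move=> t; rewrite mindicE; case: (boolP (t \in _)) => [|_]; last by rewrite mulr0.
    rewrite inE mulr1 => tb; rewrite ge_max p_ge0 /=; apply: p_near => j.
    rewrite mxE /x summxE (bigD1 j) ?JT //= big1 ?addr0 => [|i /andP[_ ij]].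
      by rewrite !mxE !eqxx mulr1; apply: cell_near; apply: tb; rewrite JT.
    by rewrite !mxE eqxx eq_sym (negbTE ij) mulr0.
  - move=> t; rewrite mindicE; case: (boolP (t \in _)) => [|_]; last by rewrite mulr0 eqxx.
    by rewrite inE.
  - under eq_integral do rewrite EFinM mindicE -indicE.
    rewrite ge0_integralZl //=; last by apply/measurable_EFinP; exact: measurable_indic (box_measurable J b).
    rewrite integral_indic //; last exact: box_measurable.
    rewrite setIT [X in (_ * X)%E](box_probability J b) -EFinM lee_fin mulrC; apply: ler_wpM2r m1.
    by apply: prodr_ge0 => i _; rewrite fine_ge0 // measure_ge0.
move=> /= /andP[kks uks] Jk.
pose bc c i := if i == k then c else b i.
have kJ : k \notin J by rewrite Jk negbK mem_head.
have Jk' j : (j \in k |: J)%SET = (j \notin ks).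
  rewrite in_setU1 Jk inE negb_or; case: eqVneq => [->|] //=.
pose minorant c (s : {nnsfun W >-> R}) := [/\ forall t, s t <= p (G t),
    forall t, s t != 0 -> forall i, (i \in k |: J)%SET -> cell (bc c i) (g i t)
    & ((\prod_(i in (k |: J)%SET) w (bc c i)
        * grid_mean w hv ks (fun x => p x - e0) (\sum_(i in (k |: J)%SET) hv (bc c i) *: delta_mx 0 i))%:E
       <= \int[Q]_t (s t)%:E)%E].
have [s sP] : exists s : C -> {nnsfun W >-> R}, forall c, minorant c (s c).
  by apply: fin_all_exists => c; exact: (IH (k |: J)%SET (bc c) uks Jk').
have [s' [s'E s'int]] := nnsfun_sum_exists C s.
have bcJ c i : i \in J -> bc c i = b i.
  by rewrite /bc; case: eqVneq => // ->; rewrite (negbTE kJ).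
exists s'; split.
- move=> t; rewrite s'E.
  have [c c0|all0] := pickP (fun c => s c t != 0); last first.
    by rewrite big1 // => c _; apply/eqP; rewrite -[_ == _]negbK all0.
  rewrite (bigD1 c) //= big1 ?addr0; first by have [] := sP c.
  move=> c' c'c; apply/eqP; apply: contraNT c'c => c'0; apply/eqP.
  have [_ /(_ t c0 k)] := sP c; have [_ /(_ t c'0 k)] := sP c'.
  rewrite !in_setU1 eqxx /bc eqxx => /(_ isT) h' _ /(_ isT) h _.
  exact: cell_inj h' h.
- move=> t; rewrite s'E => snz i iJ.
  have [c c0|all0] := pickP (fun c => s c t != 0); last first.
    by rewrite big1 ?eqxx // in snz => c _; apply/eqP; rewrite -[_ == _]negbK all0.
  have [_ /(_ t c0 i)] := sP c.
  by rewrite in_setU1 iJ orbT bcJ // => /(_ isT).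
- rewrite s'int.
  apply: (@le_trans _ _ (\sum_c (\prod_(i in (k |: J)%SET) w (bc c i)
        * grid_mean w hv ks (fun x => p x - e0)
          (\sum_(i in (k |: J)%SET) hv (bc c i) *: delta_mx 0 i))%:E)%E); last first.
    by apply: lee_sum => c _; have [] := sP c.
  rewrite sumEFin lee_fin.
  apply: (@le_trans _ _ (\prod_(i in J) w (b i) * \sum_c w c * grid_mean w hv ks
    (fun x => p x - e0) (\sum_(i in J) hv (b i) *: delta_mx 0 i + hv c *: delta_mx 0 k))) => //.
  rewrite mulr_sumr.
  rewrite le_eqVlt; apply/orP; left; apply/eqP; apply: eq_bigr => c _.
  have eW : \prod_(i in J) w (bc c i) = \prod_(i in J) w (b i).
    by apply: eq_bigr => i iJ; rewrite bcJ.
  have eS : \sum_(i in J) hv (bc c i) *: (delta_mx 0 i : 'rV[R]_n)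
      = \sum_(i in J) hv (b i) *: delta_mx 0 i.
    by apply: eq_bigr => i iJ; rewrite bcJ.
  have ek : bc c k = c by rewrite /bc eqxx.
  by rewrite !big_setU1 //= eW eS ek [hv c *: _ + _]addrC; ring.
Qed.

Lemma expectation_ge_grid_mean (c0 : C) :
  ((grid_mean w hv (enum 'I_n) (fun x => p x - e0) 0)%:E <= \int[Q]_t (p (G t))%:E)%E.
Proof.
have [|s [sp _ sint]] := simple_minorant (enum 'I_n) finset.set0 (fun=> c0) (enum_uniq _).
  by move=> k; rewrite mem_enum inE.
rewrite !big_set0 mul1r in sint; apply: (le_trans sint).
by apply: nnsfun_integral_le => t; rewrite lee_fin.
Qed.

End SimpleMinorant.

(** * The norm of a Gaussian combination against the walk *)

Section GaussianLowerBound.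
Context {R : realType}.

Lemma bernoulli_ge (d : R) m : 0 <= d <= 1 -> 1 - m%:R * d <= (1 - d) ^+ m.
Proof.
move=> /andP[d0 d1]; elim: m => [|m IH]; first by rewrite mul0r subr0.
rewrite exprS -[m.+1%:R]natr1.
have d1' : 0 <= 1 - d by lra.
have := ler_wpM2l d1' IH.
have : 0 <= m%:R * d ^+ 2 by rewrite mulr_ge0 ?sqr_ge0.
lra.
Qed.

Context {V : normedModType R} {n : nat} (X : 'I_n -> V).

Definition combination_norm (x : 'rV[R]_n) : R := `|\sum_k x 0 k *: X k|.

Lemma combination_normD x z :
  combination_norm (x + z) <= combination_norm x + combination_norm z.
Proof.
rewrite /combination_norm (eq_bigr (fun k => x 0 k *: X k + z 0 k *: X k)).
  by rewrite big_split /= ler_normD.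
by move=> k _; rewrite mxE scalerDl.
Qed.

Lemma combination_normZ a x : combination_norm (a *: x) = `|a| * combination_norm x.
Proof.
rewrite /combination_norm -normrZ scaler_sumr; congr `|_|.
by apply: eq_bigr => k _; rewrite mxE scalerA.
Qed.

Lemma sublinear_combination_norm : sublinear combination_norm.
Proof.
split=> [|a x a0]; first exact: combination_normD.
by rewrite combination_normZ ger0_norm.
Qed.

Lemma combination_norm_near (e : R) (x z : 'rV[R]_n) : (forall k, `|x 0 k - z 0 k| <= e) ->
  combination_norm z - e * \sum_k `|X k| <= combination_norm x.
Proof.
move=> xz; rewrite lerBlDr.
have -> : z = x + (z - x) by rewrite subrKC.
apply: le_trans (combination_normD _ _) _; rewrite lerD2l.
apply: le_trans (ler_norm_sum _ _ _) _; rewrite mulr_sumr; apply: ler_sum => k _.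
by rewrite normrZ !mxE distrC; apply: ler_wpM2r.
Qed.

Lemma subgradient_combination_norm : exists G, subgradient combination_norm G.
Proof.
pose supports (x t : 'rV[R]_n) :=
  (forall z, dot t z <= combination_norm z) /\ combination_norm x <= dot t x.
have [G GP] : {G & forall x, supports x (G x)}.
  apply: boolp.choice => x; have [t t1 t2] := supporting_functional _ x sublinear_combination_norm.
  by exists t.
exists G => x z; rewrite dotBr; have [h1 h2] := GP x; have := h1 z; lra.
Qed.

(** The minimum is the parameter c' of [line_walk_domination] for tails c0 exp(- v^2) with c0 =
    [normal_peak 1] / e. Of the divisor 24, a factor 6 scales the walk so that 32 / 36 <= 1, and 4
    pays for rounding and lost mass, a half each. *)
Definition gaussian_constant : R :=
  Num.min 1 (normal_peak 1 * expR (- 1) * expR (- 1)) / 24.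

Lemma gaussian_constant_gt0 : 0 < gaussian_constant.
Proof.
by rewrite divr_gt0 // lt_min ltr01 !mulr_gt0 ?expR_gt0 ?normal_peak_gt0 ?oner_neq0.
Qed.

Context {d : measure_display} {W : measurableType d} (Q : probability W R).
Context (g : 'I_n -> {RV Q >-> R}) (g_gauss : forall i, standard_gaussian Q (g i))
  (g_indep : mutually_independent Q g).

Theorem gaussian_mean_ge_walk (h : R) M : 0 <= h -> h ^+ 2 * M%:R = 1 ->
  ((gaussian_constant * walk h 0 (rounds M) combination_norm 0)%:E
   <= 'E_Q[fun t => `|\sum_i g i t *: X i|%R])%E.
Proof.
move=> h0 hM; set Wp := walk _ _ _ _ _.
have E0 : (0 <= 'E_Q[fun t => `|\sum_i g i t *: X i|%R])%E.
  by rewrite unlock; apply: integral_ge0 => t _; rewrite lee_fin.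
have Wp0 : 0 <= Wp.
  rewrite -[leLHS](walk_cst h (0 : 'rV[R]_n) (rounds M) 0 0).
  by apply: ler_walk => // [|z]; [exact: small_drift0|exact: normr_ge0].
have [->|Wpn0] := eqVneq Wp 0; first by rewrite mulr0.
have Wpos : 0 < Wp by rewrite lt_def Wpn0.
pose c0 : R := normal_peak 1 * expR (- 1).
have c00 : 0 < c0 by rewrite mulr_gt0 ?expR_gt0 ?normal_peak_gt0 ?oner_neq0.
pose c' : R := Num.min 1 (c0 * expR (- 1)).
have c'0 : 0 < c' by rewrite lt_min ltr01 mulr_gt0 ?expR_gt0.
have c'1 : c' <= 1 by rewrite ge_min lexx.
have c'c0 : c' * expR 1 <= c0.
  have : c' <= c0 * expR (- 1) by rewrite ge_min lexx orbT.
  move=> /(ler_wpM2r (expR_ge0 1)) /le_trans; apply.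
  by rewrite -mulrA -expRD addNr expR0 mulr1.
pose cg := c' / 6; have cg0 : 0 < cg by rewrite divr_gt0.
have -> : gaussian_constant * Wp = cg * Wp / 4.
  by rewrite /gaussian_constant /cg /c' /c0; field.
pose h' := cg * h; have h'0 : 0 <= h' by rewrite mulr_ge0 // ltW.
have h'M : 32 * h' ^+ 2 * M%:R <= c' ^+ 2.
  have -> : 32 * h' ^+ 2 * M%:R = 32 / 36 * c' ^+ 2 * (h ^+ 2 * M%:R) by rewrite /h' /cg; field.
  rewrite hM; have := sqr_ge0 c'; lra.
pose Vm := h' * M%:R / c'.
have Vm0 : 0 <= Vm by rewrite divr_ge0 ?mulr_ge0 // ltW.
pose L := \sum_k `|X k|; have L0 : 0 <= L by apply: sumr_ge0 => k _; exact: normr_ge0.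
(* With at most this mass lost per coordinate, the n-th power of the remaining mass is at least 1 /
   2. *)
pose dl : R := (2 * n.+1%:R)^-1.
have n0 : 0 < n.+1%:R :> R by rewrite ltr0n.
have dl0 : 0 < dl by rewrite invr_gt0 mulr_gt0.
have [B HB] := gauss_large dl dl0.
(* A mesh for which rounding changes the norm by at most half the mean of the scaled walk. *)
pose eta := cg * Wp / (2 * (L + 1)).
have L1 : 0 < L + 1 by rewrite ltr_wpDl.
have eta0 : 0 < eta by rewrite divr_gt0 ?mulr_gt0.
have etaL : eta * L <= cg * Wp / 2.
  have -> : cg * Wp / 2 = eta * (L + 1) by rewrite /eta; field; rewrite gt_eqF.
  by rewrite ler_pM2l // lerDl.
(* The grid must reach Vm + 1 for the tail bounds and B for the mass. *)
pose b := Vm + 1 + B%:R.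
have b0 : 0 <= b by rewrite !addr_ge0.
pose J := (Num.truncn (b / eta)).+1.
have Jb : b <= J%:R * eta.
  have y0 : 0 <= b / eta by rewrite divr_ge0 // ltW.
  by have /andP[_ /ltW] := truncn_itv y0; rewrite ler_pdivrMr.
have J0 : (0 < J + J)%N by rewrite addnS.
have B0 : 0 <= B%:R :> R by [].
pose w (c : 'I_(J + J)) : R := grid_weight J eta c.
pose hv (c : 'I_(J + J)) : R := grid_value J eta c.
have w0 c : 0 <= w c by exact: grid_weight_ge0.
have w1 : \sum_c w c <= 1 by exact: (sum_grid_weight_le1 J eta eta0 predT).
have wc : \sum_c w c * hv c = 0 by exact: sum_grid_mean.
have mass : 1 - dl <= \sum_c w c.
  apply: le_trans (HB (J%:R * eta) _) _; first by apply: le_trans Jb; rewrite /b; lra.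
  by apply: (sum_grid_weight_ge J eta eta0 predT).
have VJ v : 0 <= v <= Vm -> v + 1 <= J%:R * eta.
  by move=> /andP[v0 vV]; apply: le_trans Jb; rewrite /b; lra.
have tailp v : 0 <= v <= Vm -> c0 * expR (- v ^+ 2) <= \sum_(c | v <= hv c) w c.
  by move=> vV; apply: grid_tail => //; [case/andP: vV|exact: VJ].
have tailm v : 0 <= v <= Vm -> c0 * expR (- v ^+ 2) <= \sum_(c | hv c <= - v) w c.
  by move=> vV; apply: grid_tail_opp => //; [case/andP: vV|exact: VJ].
have [G sg] := subgradient_combination_norm.
have h'V : h' * M%:R <= c' * Vm by rewrite /Vm mulrCA divff ?gt_eqF // mulr1.
have c'01 : 0 < c' <= 1 by rewrite c'0.
have gm := grid_mean_ge w hv h' M Vm c0 c' combination_norm G (enum 'I_n) 0 h'0 w0 w1 wc c00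
  c'01 c'c0 h'M h'V tailp tailm sg.
have eg := expectation_ge_grid_mean Q g g_gauss g_indep _ (fun c : 'I_(J + J) => grid_cell J eta c)
   hv eta (eta * L) (fun c => measurable_grid_cell J eta c)
   (fun c c' x h1 h2 => val_inj (grid_cell_inj J eta eta0 c c' x h1 h2))
   (fun c x => grid_cell_value J eta c x)
   combination_norm (fun x => normr_ge0 _) (combination_norm_near eta) (Ordinal J0).
rewrite unlock.
have -> : (fun t => (`|\sum_i g i t *: X i|)%:E)
    = (fun t => (combination_norm (\row_i g i t))%:E).
  by apply/funext => t; congr (`|_|%:E); apply: eq_bigr => i _; rewrite mxE.
apply: le_trans eg; rewrite lee_fin.
have -> : grid_mean w hv (enum 'I_n) (fun x => combination_norm x - eta * L) 0
    = grid_mean w hv (enum 'I_n) combination_norm 0 - (\sum_c w c) ^+ n * (eta * L).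
  have e := grid_mean_lin w hv 1 (- 1) combination_norm (fun=> eta * L) (enum 'I_n) 0.
  rewrite grid_mean_cst size_enum_ord in e.
  transitivity (1 * grid_mean w hv (enum 'I_n) combination_norm 0
    + - 1 * ((\sum_c w c) ^+ n * (eta * L))); last by ring.
  by rewrite -e; congr (grid_mean _ _ _ _ _); apply/funext => x; ring.
rewrite size_enum_ord in gm.
have wE : walk h' 0 (flatten [seq nseq M k | k <- enum 'I_n]) combination_norm 0 = cg * Wp.
  rewrite (walk_perm _ _ _ _ _ (perm_columns_rounds M)) -[X in walk _ _ _ _ X](scaler0 _ cg).
  rewrite walk_scale /Wp -walkZ; apply: eq_walk => z.
  by rewrite combination_normZ ger0_norm // ltW.
rewrite wE in gm.
set a := \sum_c w c in mass gm w1 *.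
have an : 1 / 2 <= a ^+ n.
  have dl1 : 0 <= dl <= 1.
    by rewrite (ltW dl0) /= invf_le1 ?mulr_gt0 // -natrM ler1n.
  apply: le_trans (_ : (1 - dl) ^+ n <= _); last first.
    by apply: lerXn2r; rewrite ?nnegrE; case/andP: dl1; lra.
  apply: le_trans (bernoulli_ge dl n dl1).
  have : n%:R * dl <= 1 / 2.
    rewrite ler_pdivrMr ?mulr_gt0 //.
    have -> : 1 / 2 * (2 * n.+1%:R) = n.+1%:R :> R by field.
    by rewrite ler_nat.
  lra.
apply: le_trans (lerB gm (lexx _)).
rewrite -mulrBr; have : 0 <= cg * Wp - eta * L by have := mulr_gt0 cg0 Wpos; lra.
by move=> /ler_wpM2r /(_ _ _ an); lra.
Qed.

End GaussianLowerBound.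

(** * Exponential moments along a Markov chain *)

Section MarkovOperator.
Context {R : realType} {N : nat} (A : 'M[R]_N) (p : 'I_N -> R).
Context (A_stoch : row_stochastic A) (p_dist : positive_distribution p)
  (p_stat : stationary_distribution A p).
Implicit Types (u v h f : 'I_N -> R).

Definition mean u : R := \sum_i p i * u i.

Definition step_op h : 'I_N -> R := fun i => \sum_j A i j * h j.

Let p_gt0 i : 0 < p i := p_dist.1 i.
Let p_ge0 i : 0 <= p i := ltW (p_gt0 i).
Let sum_p : \sum_i p i = 1 := p_dist.2.

Lemma meanD u v : mean (fun i => u i + v i) = mean u + mean v.
Proof. by rewrite -big_split; apply: eq_bigr => i _; rewrite mulrDr. Qed.

Lemma meanZ (c : R) u : mean (fun i => c * u i) = c * mean u.
Proof. by rewrite mulr_sumr; apply: eq_bigr => i _; rewrite mulrCA. Qed.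

Lemma mean_cst (c : R) : mean (fun=> c) = c.
Proof. by rewrite /mean -mulr_suml sum_p mul1r. Qed.

Lemma ler_mean u v : (forall i, u i <= v i) -> mean u <= mean v.
Proof. by move=> uv; apply: ler_sum => i _; apply: ler_wpM2l. Qed.

Lemma eq_mean u v : u =1 v -> mean u = mean v.
Proof. by move=> uv; apply: eq_bigr => i _; rewrite uv. Qed.

Lemma mean_sqr_ge u : mean u ^+ 2 <= mean (fun i => u i ^+ 2).
Proof.
have : mean (fun i => 0) <= mean (fun i => (u i - mean u) ^+ 2).
  by apply: ler_mean => i; exact: sqr_ge0.
have -> : mean (fun i => (u i - mean u) ^+ 2) = mean (fun i => u i ^+ 2) - mean u ^+ 2.
  rewrite (eq_mean _ (fun i => u i ^+ 2 + ((- 2 * mean u) * u i + mean u ^+ 2))); last by move=> i; ring.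
  by rewrite meanD meanD meanZ mean_cst; ring.
rewrite mean_cst; lra.
Qed.

Lemma mean_step h : mean (step_op h) = mean h.
Proof.
rewrite /mean; under eq_bigr do rewrite mulr_sumr.
rewrite exchange_big /=; apply: eq_bigr => j _.
by rewrite -p_stat mulr_suml; apply: eq_bigr => i _; rewrite mulrA.
Qed.

Lemma step_sqr_le h : mean (fun i => step_op h i ^+ 2) <= mean (fun i => h i ^+ 2).
Proof.
rewrite -(mean_step (fun i => h i ^+ 2)); apply: ler_mean => i.
have [A0 A1] := A_stoch; set m := step_op h i.
have : 0 <= \sum_j A i j * (h j - m) ^+ 2.
  by apply: sumr_ge0 => j _; rewrite mulr_ge0 ?sqr_ge0.
have -> : \sum_j A i j * (h j - m) ^+ 2
    = \sum_j (A i j * h j ^+ 2 + ((- 2 * m) * (A i j * h j) + m ^+ 2 * A i j)).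
  by apply: eq_bigr => j _; ring.
rewrite big_split big_split /= -!mulr_sumr A1 -/(step_op h i) -/m /step_op; lra.
Qed.

Definition variance_of h : R := mean (fun i => (h i - mean h) ^+ 2).

Lemma mean_sqrE h : mean (fun i => h i ^+ 2) = mean h ^+ 2 + variance_of h.
Proof.
rewrite (eq_mean _ (fun i => (h i - mean h) ^+ 2 + ((2 * mean h) * h i + - mean h ^+ 2))); last by move=> i; ring.
rewrite meanD meanD meanZ mean_cst /variance_of; ring.
Qed.

Lemma variance_ge0 h : 0 <= variance_of h.
Proof. by rewrite -(mean_cst 0); apply: ler_mean => i; exact: sqr_ge0. Qed.

Lemma L2norm_sqr (v : 'cV[R]_N) : L2norm p v ^+ 2 = mean (fun i => v i ord0 ^+ 2).
Proof.
have e : \sum_i p i * `|v i ord0| ^+ 2 = mean (fun i => v i ord0 ^+ 2).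
  by apply: eq_bigr => i _; rewrite real_normK ?num_real.
rewrite /L2norm e sqr_sqrtr // -(mean_cst 0); apply: ler_mean => i; exact: sqr_ge0.
Qed.

Lemma centered_mulmxE (v : 'cV[R]_N) i :
  ((A - averaging_mx p) *m v) i ord0 = step_op (fun j => v j ord0) i - mean (fun j => v j ord0).
Proof.
rewrite mxE /step_op /mean -sumrB; apply: eq_bigr => j _.
by rewrite !mxE mulrBl.
Qed.

Local Notation lambda := (L2opnorm p (A - averaging_mx p)).

Lemma L2norm_centered_le (v : 'cV[R]_N) : L2norm p ((A - averaging_mx p) *m v) <= L2norm p v.
Proof.
rewrite -(@ler_pXn2r _ 2) ?nnegrE ?sqrtr_ge0 // !L2norm_sqr.
rewrite (eq_mean _ _ (fun i => congr1 (fun x => x ^+ 2) (centered_mulmxE v i))).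
set h := fun j => v j ord0.
rewrite -(mean_step h) -/(variance_of (step_op h)).
have := step_sqr_le h; rewrite mean_sqrE; have := sqr_ge0 (mean (step_op h)); lra.
Qed.

Let opset := [set L2norm p ((A - averaging_mx p) *m v) | v in [set v : 'cV[R]_N | L2norm p v = 1]]%classic.

Lemma L2opnorm_set_sup : has_sup opset.
Proof.
split; last first.
  by exists 1 => _ [v /= v1 <-]; rewrite -v1 L2norm_centered_le.
exists (L2norm p ((A - averaging_mx p) *m const_mx 1)); exists (const_mx 1) => //=.
apply/eqP; rewrite -(@eqrXn2 _ 2) ?sqrtr_ge0 //; apply/eqP.
by rewrite expr1n L2norm_sqr (eq_mean _ (fun=> 1)) ?mean_cst // => i; rewrite mxE expr1n.
Qed.

Lemma L2opnorm_ge0 : 0 <= lambda.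
Proof.
have [[x xS] ub] := L2opnorm_set_sup.
have := sup_upper_bound L2opnorm_set_sup xS; apply: le_trans.
by case: xS => v _ <-; exact: sqrtr_ge0.
Qed.

Lemma L2opnorm_bound (v : 'cV[R]_N) :
  L2norm p ((A - averaging_mx p) *m v) <= lambda * L2norm p v.
Proof.
have [v0|v0] := eqVneq (L2norm p v) 0.
  by rewrite v0 mulr0 -v0 L2norm_centered_le.
have vp : 0 < L2norm p v by rewrite lt_def v0 sqrtr_ge0.
have scale (c : R) (u : 'cV[R]_N) : 0 <= c -> L2norm p (c *: u) = c * L2norm p u.
  move=> c0; apply/eqP; rewrite -(@eqrXn2 _ 2) ?mulr_ge0 ?sqrtr_ge0 //; apply/eqP.
  rewrite exprMn !L2norm_sqr -meanZ; apply: eq_mean => i; by rewrite mxE exprMn.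
pose u := (L2norm p v)^-1 *: v.
have c0 : 0 <= (L2norm p v)^-1 by rewrite invr_ge0 ltW.
have u1 : L2norm p u = 1 by rewrite /u scale // mulVf.
have : L2norm p ((A - averaging_mx p) *m u) <= lambda.
  by apply: (sup_upper_bound L2opnorm_set_sup); exists u.
by rewrite /u -scalemxAr scale // ler_pdivrMl // mulrC.
Qed.

(** A fixes constants and preserves the mean, so on h minus its mean the operator A - E_pi acts as
    A. *)
Lemma variance_step_le h : variance_of (step_op h) <= lambda ^+ 2 * variance_of h.
Proof.
pose v : 'cV[R]_N := \col_i (h i - mean h).
have vE j : v j ord0 = h j - mean h by rewrite mxE.
have := L2opnorm_bound v.
have l0 := L2opnorm_ge0.
have rhs0 : 0 <= lambda * L2norm p v by apply: mulr_ge0; [exact: l0|exact: sqrtr_ge0].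
rewrite -(@ler_pXn2r _ 2) ?nnegrE ?sqrtr_ge0 // exprMn !L2norm_sqr.
rewrite (eq_mean _ _ (fun i => congr1 (fun x => x ^+ 2) (centered_mulmxE v i))).
have mv : mean (fun j => v j ord0) = 0.
  rewrite (eq_mean _ (fun j => h j + - mean h)) => [|j]; last by rewrite vE.
  by rewrite meanD mean_cst subrr.
rewrite mv (eq_mean (fun i => v i ord0 ^+ 2) (fun i => (h i - mean h) ^+ 2)) => [|j]; last by rewrite vE.
rewrite -/(variance_of h) => le1; apply: le_trans le1; rewrite le_eqVlt; apply/orP; left; apply/eqP.
apply: eq_mean => i; congr (_ ^+ 2); rewrite subr0 mean_step.
rewrite /step_op [RHS](eq_bigr (fun j => A i j * h j - A i j * mean h)) => [|j _]; last by rewrite vE mulrBr.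
by rewrite sumrB -mulr_suml A_stoch.2 mul1r.
Qed.

(* For small a, split step_op h into its mean and its variance part: the tilt
   e^(a f) moves only O(a) of mass between the two, while the variance part has
   lost a factor 1 - lambda, and AM-GM absorbs the cross term. *)
Lemma tilted_step_le (a : R) f h : lambda < 1 -> (forall i, `|f i| <= 1) -> mean f = 0 ->
  mean (fun i => (expR (a * f i) * step_op h i) ^+ 2)
  <= expR (72 * a ^+ 2 / (1 - lambda)) * mean (fun i => h i ^+ 2).
Proof.
move=> l1 f1 f0; have l0 := L2opnorm_ge0.
set D := 1 - lambda; have D0 : 0 < D by rewrite subr_gt0.
have D1 : D <= 1 by rewrite /D; lra.
have e2 i : expR (a * f i) ^+ 2 = expR (2 * a * f i) by rewrite expr2 -expRD; congr expR; ring.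
have nh0 : 0 <= mean (fun i => h i ^+ 2).
  by rewrite -(mean_cst 0); apply: ler_mean => i; exact: sqr_ge0.
(* For |a| > D / 8 the crude bound exp(2 |a|) on the squared tilt suffices, as 2 |a| D <= 16 a^2. *)
have [aD|aD] := leP `|a| (D / 8); last first.
  apply: le_trans (_ : expR (2 * `|a|) * mean (fun i => step_op h i ^+ 2) <= _).
    rewrite -meanZ; apply: ler_mean => i; rewrite exprMn e2.
    apply: ler_wpM2r; first exact: sqr_ge0.
    rewrite ler_expR -mulrA ler_pM2l //; apply: le_trans (ler_norm _) _.
    by rewrite normrM -[leRHS]mulr1; apply: ler_wpM2l.
  apply: ler_pM; rewrite ?expR_ge0 ?step_sqr_le //.
    by rewrite -(mean_cst 0); apply: ler_mean => i; exact: sqr_ge0.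
  rewrite ler_expR ler_pdivlMr // -(real_normK (num_real a)).
  have a0 : 0 <= `|a| by [].
  have : 0 <= `|a| * (8 * `|a| - D) by rewrite mulr_ge0 //; lra.
  have := sqr_ge0 `|a|; lra.
set m := mean h; pose k i := step_op h i - m.
have kE i : step_op h i = m + k i by rewrite /k; ring.
have mk : mean k = 0 by rewrite /k meanD mean_step mean_cst subrr.
have q_le : mean (fun i => k i ^+ 2) <= lambda ^+ 2 * variance_of h.
  by have := variance_step_le h; rewrite /variance_of mean_step.
(* Since [f] and [k] are centred, the terms linear in them average out, and only the product of 2 m
   k with E - 1 needs AM-GM. Its cost 64 a^2 / D and the quadratic 8 a^2 make up the constant 72. *)
have pt i : (expR (a * f i) * step_op h i) ^+ 2
    <= (m ^+ 2 * (1 + (8 * a ^+ 2 + 64 * a ^+ 2 / D)) + (2 * a * m ^+ 2) * f i)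
       + (2 * m * k i + (1 + 4 * `|a| + D / 4) * k i ^+ 2).
  rewrite exprMn e2 kE; set x := 2 * a * f i.
  have a0 : 0 <= `|a| by [].
  have x1 : `|x| <= 2 * `|a|.
    by rewrite /x !normrM ger0_norm // -mulrA ler_pM2l // -[leRHS]mulr1; apply: ler_wpM2l.
  have x2 : `|x| <= 1 / 2 by apply: le_trans x1 _; lra.
  have up := expR_le_quadratic x x2; have low := expR_ge1Dx x.
  have x3 : x ^+ 2 <= 4 * a ^+ 2.
    rewrite -(real_normK (num_real x)) -(real_normK (num_real a)).
    have -> : 4 * `|a| ^+ 2 = (2 * `|a|) ^+ 2 by ring.
    by rewrite ler_pXn2r ?nnegrE // mulr_ge0.
  move: up low; set E := expR x => up low.
  have aa : 8 * a ^+ 2 <= 2 * `|a|.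
    rewrite -(real_normK (num_real a)).
    have : 0 <= `|a| * (1 - 4 * `|a|) by rewrite mulr_ge0 //; lra.
    lra.
  have E1 : `|E - 1| <= 4 * `|a|.
    move: x1; rewrite !ler_norml => /andP[x1a x1b]; apply/andP; split; lra.
  have cross : 2 * m * k i * (E - 1) <= 64 * a ^+ 2 / D * m ^+ 2 + D / 4 * k i ^+ 2.
    have D4 : 0 < D / 4 by lra.
    apply: le_trans (ler_norm _) _; rewrite normrM.
    apply: le_trans (ler_wpM2l _ E1) _; first exact: normr_ge0.
    rewrite -(real_normK (num_real m)) -(real_normK (num_real (k i))) -(real_normK (num_real a)).
    rewrite !normrM ger0_norm //.
    have := sqr_ge0 (8 * `|a| * `|m| - D / 2 * `|k i|).
    have -> : 64 * `|a| ^+ 2 / D * `|m| ^+ 2 = (64 * `|a| ^+ 2 * `|m| ^+ 2) / D by ring.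
    rewrite -lerBlDr ler_pdivlMr //.
    set u := `|a|; set v := `|m|; set t := `|k i|; lra.
  have k2 := sqr_ge0 (k i); have m2 := sqr_ge0 m.
  have Ek : E * k i ^+ 2 <= (1 + 4 * `|a|) * k i ^+ 2.
    by apply: ler_wpM2r => //; move: E1; rewrite ler_norml => /andP[_]; lra.
  have Em : m ^+ 2 * E <= m ^+ 2 * (1 + x + 8 * a ^+ 2).
    by apply: ler_wpM2l => //; lra.
  have -> : E * (m + k i) ^+ 2 = m ^+ 2 * E + 2 * m * k i * (E - 1) + 2 * m * k i + E * k i ^+ 2 by ring.
  have -> : 2 * a * m ^+ 2 * f i = m ^+ 2 * x by rewrite /x; ring.
  lra.
apply: le_trans (ler_mean _ _ pt) _.
rewrite meanD meanD mean_cst meanZ f0 mulr0 addr0 meanD !meanZ mk mulr0 add0r (mean_sqrE h) -/m.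
set s := variance_of h in q_le *; have s0 : 0 <= s by exact: variance_ge0.
have a0 : 0 <= `|a| by [].
have c0 : 0 <= 1 + 4 * `|a| + D / 4 by lra.
(* The factor 1 + 4 |a| + D / 4 <= 1 + D is compensated by lambda^2 <= 1 - D. *)
have qs : (1 + 4 * `|a| + D / 4) * mean (fun i => k i ^+ 2) <= s.
  apply: le_trans (ler_wpM2l c0 q_le) _; rewrite mulrA -[leRHS]mul1r; apply: ler_wpM2r => //.
  have l2 : lambda ^+ 2 <= 1 - D.
    have : 0 <= lambda * (1 - lambda) by rewrite mulr_ge0 // ltW.
    by rewrite /D; lra.
  apply: le_trans (ler_wpM2l c0 l2) _.
  have c1 : 1 + 4 * `|a| + D / 4 <= 1 + D by lra.
  have D2 : 0 <= 1 - D by lra.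
  have := ler_wpM2r D2 c1; have := sqr_ge0 D; lra.
have aD2 : 8 * a ^+ 2 <= 8 * a ^+ 2 / D.
  by rewrite ler_pdivlMr // -[leRHS]mulr1; apply: ler_wpM2l; rewrite // mulr_ge0 ?sqr_ge0.
set z := 72 * a ^+ 2 / D.
have z0 : 0 <= z by rewrite divr_ge0 ?(ltW D0) // mulr_ge0 ?sqr_ge0.
have m2 := sqr_ge0 m.
apply: le_trans (_ : (1 + z) * (m ^+ 2 + s) <= _); last first.
  by apply: ler_wpM2r; [rewrite addr_ge0|exact: expR_ge1Dx].
have zE : 8 * a ^+ 2 / D + 64 * a ^+ 2 / D = z by rewrite /z; ring.
have : m ^+ 2 * (1 + (8 * a ^+ 2 + 64 * a ^+ 2 / D)) <= m ^+ 2 * (1 + z).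
  by apply: ler_wpM2l => //; lra.
have := mulr_ge0 z0 s0; lra.
Qed.

End MarkovOperator.

(** * Finite paths and their law *)

Section RconsFfun.
Context {T : Type} {k : nat}.

Definition rcons_ffun (o : {ffun 'I_k -> T}) (a : T) : {ffun 'I_k.+1 -> T} :=
  [ffun i => oapp o a (unlift ord_max i)].

Lemma rcons_ffun_max o a : rcons_ffun o a ord_max = a.
Proof. by rewrite ffunE unlift_none. Qed.

Lemma rcons_ffun_lift o a i : rcons_ffun o a (lift ord_max i) = o i.
Proof. by rewrite ffunE liftK. Qed.

End RconsFfun.

Lemma sum_rcons_ffun {R : realType} {T : finType} {k : nat} (F : {ffun 'I_k.+1 -> T} -> R) :
  \sum_o F o = \sum_(o : {ffun 'I_k -> T}) \sum_a F (rcons_ffun o a).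
Proof.
rewrite pair_big /= (reindex (fun oa => rcons_ffun oa.1 oa.2)) //=.
exists (fun o => ([ffun i => o (lift ord_max i)], o ord_max)) => /= [oa _|o _].
  case: oa => o a; by congr (_, _); [apply/ffunP => i; rewrite ffunE rcons_ffun_lift|rewrite rcons_ffun_max].
apply/ffunP => i; case: (unliftP ord_max i) => [j|] ->.
  by rewrite rcons_ffun_lift ffunE.
by rewrite rcons_ffun_max.
Qed.

Section PathLaw.
Local Open Scope classical_set_scope.
Context {R : realType} {N : nat} (A : 'M[R]_N) (p : 'I_N -> R).
Context (A_stoch : row_stochastic A) (p_dist : positive_distribution p)
  (p_stat : stationary_distribution A p).
Context {d : measure_display} {W : measurableType d} (P : probability W R)
  (Y : nat -> W -> 'I_N) (Y_chain : markov_chain A p P Y).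

Definition path_of k w : {ffun 'I_k -> 'I_N} := [ffun i : 'I_k => Y i w].

Definition path_event k (o : {ffun 'I_k -> 'I_N}) : set W := [set w | path_of k w = o].

Definition path_prob k (o : {ffun 'I_k -> 'I_N}) : R := fine (P (path_event k o)).

Lemma measurable_path_event k o : measurable (path_event k o).
Proof.
have -> : path_event k o = \bigcap_(i in [set: 'I_k]) (Y i @^-1` [set o i]).
  apply/seteqP; split => w /=.
    by move=> <- i _ /=; rewrite ffunE.
  by move=> wo; apply/ffunP => i; rewrite ffunE; exact: wo.
by apply: fin_bigcap_measurable => // i _; case: Y_chain.
Qed.

Lemma path_prob_ge0 k o : 0 <= path_prob k o.
Proof. by rewrite fine_ge0 // measure_ge0. Qed.

Lemma path_probE k o : P (path_event k o) = (path_prob k o)%:E.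
Proof. by rewrite fineK // fin_num_measure //; exact: measurable_path_event. Qed.

Lemma path_event_prob k (E : pred {ffun 'I_k -> 'I_N}) :
  P [set w | E (path_of k w)] = (\sum_(o | E o) path_prob k o)%:E.
Proof.
pose F (i : 'I_#|{ffun 'I_k -> 'I_N}|) := path_event k (enum_val i).
have -> : [set w | E (path_of k w)] = \big[setU/set0]_(i < _ | E (enum_val i)) F i.
  apply/seteqP; split => w /=.
    move=> Ew; rewrite (bigD1 (enum_rank (path_of k w))) ?enum_rankK //=; left.
    by rewrite /F /path_event /= enum_rankK.
  elim/big_ind: _ => [//|B C hB hC [/hB|/hC] //|i Ei].
  by rewrite /F /path_event /= => ->.
rewrite (measure_bigsetU_ord P); last 2 first.
- by move=> i; exact: measurable_path_event.
- by move=> i j _ _ [w [/= wi wj]]; apply: enum_val_inj; rewrite -wi wj.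
rewrite (eq_bigr (fun i => (path_prob k (enum_val i))%:E)) => [|i _]; last exact: path_probE.
rewrite sumEFin; congr EFin.
rewrite [RHS](reindex (@enum_val _ predT)) //=.
by exists enum_rank => x _; rewrite ?enum_valK ?enum_rankK.
Qed.

Lemma path_prob_rcons k (o : {ffun 'I_k.+1 -> 'I_N}) a :
  path_prob k.+2 (rcons_ffun o a) = path_prob k.+1 o * A (o ord_max) a.
Proof.
case: Y_chain => _ _ markov.
pose x i := rcons_ffun o a (inord i).
have xlt (i : 'I_k.+1) : x i = o i.
  rewrite /x -(rcons_ffun_lift o a i); congr (rcons_ffun o a _); apply: val_inj.
  by rewrite [RHS]lift_max [LHS]inordK // (leq_trans (ltn_ord i)).
have xlast : x k.+1 = a.
  by rewrite /x -[RHS](rcons_ffun_max o a); congr (rcons_ffun o a _); apply: val_inj; rewrite /= inordK.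
have := markov k x.
have -> : [set w | forall i : nat, (i <= k.+1)%N -> Y i w = x i] = path_event k.+2 (rcons_ffun o a).
  apply/seteqP; split => w /= wx.
    apply/ffunP => i; rewrite ffunE wx; last by rewrite -ltnS.
    by rewrite /x inord_val.
  move=> i ik; rewrite /x -wx ffunE inordK //.
have -> : [set w | forall i : nat, (i <= k)%N -> Y i w = x i] = path_event k.+1 o.
  apply/seteqP; split => w /= wx.
    by apply/ffunP => i; rewrite ffunE wx -1?ltnS // xlt.
  by move=> i ik; have := xlt (Ordinal (ik : (i < k.+1)%N)); rewrite /= => ->; rewrite -wx ffunE.
rewrite !path_probE -EFinM => -[->].
by rewrite -(xlt ord_max) -xlast.
Qed.

Lemma path_prob1 (o : {ffun 'I_1 -> 'I_N}) : path_prob 1 o = p (o ord0).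
Proof.
case: Y_chain => _ init _; rewrite /path_prob.
have -> : path_event 1 o = Y 0%N @^-1` [set o ord0].
  apply/seteqP; split => w /=; first by move=> <-; rewrite ffunE.
  by move=> wo; apply/ffunP => i; rewrite ffunE ord1.
by rewrite init.
Qed.

(** The expectation of the product of the F_i(Y_i), i < k, with h(Y_k). Keeping [h] apart lets the
    last state be integrated out, which turns [h] into F_(k-1) times [step_op A h]. *)
Definition chain_mean k (F : nat -> 'I_N -> R) (h : 'I_N -> R) : R :=
  \sum_(o : {ffun 'I_k.+1 -> 'I_N})
    path_prob k.+1 o * (\prod_(i < k) F i (o (lift ord_max i)) * h (o ord_max)).

Lemma chain_mean0 F h : chain_mean 0 F h = mean p h.
Proof.
rewrite /chain_mean sum_rcons_ffun.
rewrite (bigD1 (ffun0 (card_ord 0))) //= [X in _ + X]big1 ?addr0.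
  apply: eq_bigr => a _; rewrite path_prob1 big_ord0 mul1r.
  by rewrite (_ : ord0 = ord_max :> 'I_1) ?rcons_ffun_max //; exact: val_inj.
by move=> o /eqP[]; apply/ffunP => i; have := ltn_ord i; rewrite ltn0.
Qed.

Lemma chain_meanS k F h :
  chain_mean k.+1 F h = chain_mean k F (fun s => F k s * step_op A h s).
Proof.
rewrite /chain_mean sum_rcons_ffun; apply: eq_bigr => o _.
rewrite /step_op !mulr_sumr; apply: eq_bigr => a _.
rewrite path_prob_rcons rcons_ffun_max big_ord_recr /=.
have -> : rcons_ffun o a (lift ord_max ord_max) = o ord_max by rewrite rcons_ffun_lift.
have -> : \prod_(i < k) F i (rcons_ffun o a (lift ord_max (widen_ord (leqnSn k) i)))
    = \prod_(i < k) F i (o (lift ord_max i)).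
  apply: eq_bigr => i _; rewrite rcons_ffun_lift; congr (F _ (o _)).
  by apply: val_inj; rewrite [RHS]lift_max.
ring.
Qed.

Lemma marginal k s : P (Y k @^-1` [set s]) = (p s)%:E.
Proof.
have -> : Y k @^-1` [set s] = [set w | path_of k.+1 w ord_max == s].
  by apply/seteqP; split => w /=; rewrite ffunE => /eqP.
rewrite (path_event_prob k.+1 (fun o => o ord_max == s)); congr EFin.
transitivity (chain_mean k (fun _ _ => 1) (fun s' => (s' == s)%:R)).
  rewrite /chain_mean big_mkcond /=; apply: eq_bigr => o _.
  by rewrite big1_eq mul1r; case: eqP => _; rewrite ?mulr1 ?mulr0.
have H h : chain_mean k (fun _ _ => 1) h = mean p h.
  elim: (k) h => [|j IH] h; first exact: chain_mean0.
  rewrite chain_meanS IH -(mean_step A p p_stat h); apply: eq_bigr => i _.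
  by rewrite mul1r.
rewrite H /mean (bigD1 s) //= eqxx mulr1 big1 ?addr0 // => j js.
by rewrite (negbTE js) mulr0.
Qed.

Lemma expectation_marginal k (f : 'I_N -> R) :
  ('E_P[fun w => f (Y k w)] = (mean p f)%:E)%E.
Proof.
have mY s : measurable (Y k @^-1` [set s]) by case: Y_chain.
rewrite unlock.
have -> : (fun w => (f (Y k w))%:E)
    = (fun w => \sum_s (f s)%:E * (\1_(Y k @^-1` [set s]) w)%:E)%E.
  apply/funext => w; rewrite (bigD1 (Y k w)) //= [X in (_ + X)%E]big1 ?adde0.
    by rewrite indicE mem_set // mule1.
  by move=> s sY; rewrite indicE memNset ?mule0 //= => /eqP; rewrite eq_sym (negbTE sY).
have intI s : P.-integrable setT (fun w => (f s)%:E * (\1_(Y k @^-1` [set s]) w)%:E)%E.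
  by apply: integrableZl => //; exact: integrable_indic.
rewrite (integral_sum measurableT intI) /mean -sumEFin; apply: eq_bigr => s _.
rewrite integralZl //; last exact: integrable_indic.
by rewrite integral_indic // setIT [X in (_ * X)%E](marginal k s) -EFinM mulrC.
Qed.

Local Notation lambda := (L2opnorm p (A - averaging_mx p)).

Lemma chain_mean_sqr_le k (F : nat -> 'I_N -> R) (c : nat -> R) h :
  (forall i, 0 <= c i) ->
  (forall i u, mean p (fun s => (F i s * step_op A u s) ^+ 2) <= c i * mean p (fun s => u s ^+ 2)) ->
  chain_mean k F h ^+ 2 <= (\prod_(i < k) c i) * mean p (fun s => h s ^+ 2).
Proof.
move=> c0 Fc; elim: k h => [|k IH] h.
  by rewrite chain_mean0 big_ord0 mul1r; exact: (mean_sqr_ge p p_dist).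
rewrite chain_meanS big_ord_recr /= -mulrA; apply: le_trans (IH _) _.
by apply: ler_wpM2l (Fc k h); apply: prodr_ge0.
Qed.

(** The last factor is the tilt of the constant 1, which [step_op] fixes, so it costs as much as the
    others. The squared norms give 72 / (1 - lambda), and the square root halves this to 36 =
    6^2. *)
Lemma path_mgf k (f : 'I_k.+1 -> 'I_N -> R) (v : 'rV[R]_k.+1) : lambda < 1 ->
  (forall i s, `|f i s| <= 1) -> (forall i, mean p (f i) = 0) ->
  \sum_o path_prob k.+1 o * expR (dot v (\row_i f i (o i)))
  <= expR ((6 / Num.sqrt (1 - lambda)) ^+ 2 * dot v v).
Proof.
move=> l1 f1 f0.
have D0 : 0 < 1 - lambda by rewrite subr_gt0.
pose F (i : nat) s := expR (v 0 (inord i) * f (inord i) s).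
pose c (i : nat) := expR (72 * v 0 (inord i) ^+ 2 / (1 - lambda)).
have Fc i u : mean p (fun s => (F i s * step_op A u s) ^+ 2) <= c i * mean p (fun s => u s ^+ 2).
  exact: (tilted_step_le A p A_stoch p_dist p_stat).
have step1 s : step_op A (fun=> 1) s = 1.
  by rewrite /step_op; under eq_bigr do rewrite mulr1; rewrite A_stoch.2.
have Fk : mean p (fun s => F k s ^+ 2) <= c k.
  have := Fc k (fun=> 1); rewrite expr1n (mean_cst p p_dist) mulr1; apply: le_trans.
  by rewrite le_eqVlt; apply/orP; left; apply/eqP; apply: eq_bigr => s _; rewrite step1 mulr1.
have -> : \sum_o path_prob k.+1 o * expR (dot v (\row_i f i (o i))) = chain_mean k F (F k).
  apply: eq_bigr => o _; congr (_ * _); rewrite /dot expR_sum big_ord_recr /=.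
  congr (_ * _); last first.
    rewrite mxE /F; have -> : inord k = ord_max :> 'I_k.+1 by apply: val_inj; rewrite /= inordK.
    by [].
  apply: eq_bigr => i _; rewrite mxE /F.
  have e1 : inord i = widen_ord (leqnSn k) i by apply: val_inj; rewrite /= inordK // ltnW // ltnS.
  have e2 : lift ord_max i = widen_ord (leqnSn k) i by apply: val_inj; exact: lift_max.
  by rewrite e1 e2.
have c0 i : 0 <= c i by exact: expR_ge0.
have pc0 : 0 <= \prod_(i < k) c i by apply: prodr_ge0.
have sq := le_trans (chain_mean_sqr_le k F c (F k) c0 Fc) (ler_wpM2l pc0 Fk).
apply: le_trans (ler_norm _) _.
rewrite -(@ler_pXn2r _ 2) ?nnegrE ?expR_ge0 // real_normK ?num_real //; apply: (le_trans sq).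
have -> : (\prod_(i < k) c i) * c k = \prod_(i < k.+1) c i by rewrite big_ord_recr.
rewrite /c -expR_sum expr2 -expRD ler_expR.
rewrite exprMn exprVn sqr_sqrtr ?(ltW D0) // /dot mulr_sumr -big_split /=.
apply: ler_sum => i _; rewrite inord_val le_eqVlt; apply/orP; left; apply/eqP.
by field; rewrite gt_eqF.
Qed.

End PathLaw.

(* A subgaussian vector with finitely many values is compared with the walk in
   an arbitrary norm: the norm of each value is attained by one functional, and
   chaining along the partitions of the majorizing measure theorem bounds the
   supremum of these functionals. *)
Lemma subgaussian_norm_tail {R : realType} {V : normedModType R} {n : nat} (X : 'I_n -> V)
    (kap eta : R) (O : finType) (pr : O -> R) (xi : O -> 'rV[R]_n) (s : R) :
  0 < kap -> 0 < eta -> (8 + kap^-1) / eta < 1 / 128 - 4 / kap ->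
  0 < s -> (forall o, 0 <= pr o) ->
  (forall v, \sum_o pr o * expR (dot v (xi o)) <= expR (s ^+ 2 * dot v v)) ->
  exists h M, [/\ 0 <= h, h ^+ 2 * M%:R = 1 &
    let w := walk h 0 (rounds M) (combination_norm X) 0 in
    forall u, 0 <= u ->
    \sum_(o | 2 * s * u * ((8 + 2 * (16 + 768 * kap + 64 * (kap * eta))) * w)
              < combination_norm X (xi o)) pr o
    <= 4 * expR 8 * expR (- u ^+ 2)].
Proof.
move=> kap0 eta0 kap_eta s0 pr0 mgf.
set Cm := 16 + 768 * kap + 64 * (kap * eta).
have Cm0 : 0 <= Cm by have := mulr_gt0 kap0 eta0; rewrite /Cm; lra.
pose supports (x t : 'rV[R]_n) :=
  (forall z, dot t z <= combination_norm X z) /\ combination_norm X x <= dot t x.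
have [t tP] : {t & forall x, supports x (t x)}.
  apply: boolp.choice => x.
  by have [t' t1 t2] := supporting_functional _ x (sublinear_combination_norm X); exists t'.
(* [None] carries the zero functional, from which the chain starts. *)
pose I : finType := option O.
pose y (i : I) : 'rV[R]_n := if i is Some o then t (xi o) else 0.
(* With this many levels 2^(4^(K + 1)) exceeds the number of functionals, so the partition into
   points is admissible at level K + 1, where it adds no diameter. *)
pose K := #|{: I}|.
pose q : R := 2 * 2 ^+ K * n.+1%:R.
have n10 : 0 < n.+1%:R :> R by rewrite ltr0n.
have pK0 : 0 < 2 ^+ K :> R by rewrite exprn_gt0.
have q0 : 0 < q by rewrite !mulr_gt0.
pose h := q^-1; pose M := ((2 * 2 ^ K * n.+1) ^ 2)%N.
have h0 : 0 <= h by rewrite invr_ge0 ltW.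
have hM : h ^+ 2 * M%:R = 1.
  by rewrite /M natrX !natrM natrX -/q -exprMn mulVf ?gt_eqF // expr1n.
exists h, M; split=> // w u u0.
have hq : h * q = 1 by rewrite /h mulVf // gt_eqF.
have n1 : 1 <= n.+1%:R :> R by rewrite ler1n.
have hpK0 : 0 <= h * 2 ^+ K by rewrite mulr_ge0 // ltW.
have hK : h * 2 ^+ K <= 1.
  have := ler_wpM2l hpK0 n1; move: hq hpK0; rewrite /q.
  by set a := 2 ^+ K; set b := n.+1%:R; lra.
have hKn : 2 * 2 ^+ K * h * n%:R <= 1.
  move: hq hpK0; rewrite /q -[n.+1%:R]natr1.
  by set a := 2 ^+ K; set b := n%:R; lra.
have y_le i z : dot (y i) z <= combination_norm X z.
  by case: i => [ o | ] /=; [exact: (tP _).1|rewrite dot0l; exact: normr_ge0].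
have widthW i (A : {set I}) : width h M y i A <= w.
  apply: ler_walk => // [|z]; first exact: small_drift0.
  by have [j _ ->] := supf_attained y i A z.
have [c [c_card c_sum]] := majorizing_partitions h M K hM h0 hK hKn y w widthW
  kap eta kap0 eta0 kap_eta (None : I).
rewrite -/Cm in c_sum.
pose c' m : I -> I := if (m <= K)%N then c m else id.
have c'K m : (m <= K)%N -> c' m = c m by rewrite /c' => ->.
have c'_last : c' K.+1 = id by rewrite /c' ltnn.
have c'_inj : injective (c' K.+1) by rewrite c'_last => i j.
have c'_card m : (m <= K.+1)%N -> (#|c' m @: I| <= 2 ^ (4 ^ m))%N.
  rewrite leq_eqVlt ltnS => /predU1P[->|mK]; last by rewrite c'K // c_card.
  apply: leq_trans (leq_imset_card _ _) _.
  have a1 : (K < 4 ^ K.+1)%N by apply: leq_trans (ltn_expl K.+1 _).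
  by apply: leq_trans (ltnW (ltn_expl (4 ^ K.+1) (ltnSn 1))); exact: ltnW.
have distw i j : dist y i j <= 8 * w.
  exact: (dist_le_W h M hM h0 y w widthW).
have c'_sum i : \sum_(0 <= m < K.+2) 2 ^+ m * diameter y (cell (c' m) i) <= Cm * w.
  rewrite big_nat_recr //= c'_last.
  have -> : diameter y (cell id i) = 0.
    apply/eqP; rewrite eq_le diameter_ge0 andbT; apply: diameter_le => // j k.
    by rewrite !inE => /eqP -> /eqP ->; rewrite distxx.
  rewrite mulr0 addr0; apply: le_trans (c_sum i).
  rewrite le_eqVlt; apply/orP; left; apply/eqP; rewrite !big_nat; apply: eq_bigr => m.
  by rewrite ltnS => /andP[_ mK]; rewrite c'K.
have := chaining_tail pr pr0 xi s s0 mgf y (None : I) erefl K.+1 c' c'_inj c'_card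
  (8 * w) (Cm * w) distw c'_sum u u0.
apply: le_trans; rewrite [leRHS](bigID (fun o => 2 * s * u * ((8 + 2 * Cm) * w) < combination_norm X (xi o))) /=.
rewrite -[leLHS]addr0; apply: lerD; last exact: sumr_ge0.
rewrite le_eqVlt; apply/orP; left; apply/eqP; apply: eq_bigl => o.
case: (boolP (_ < _)) => [lt_o|]; rewrite ?andbF // andbT; apply/esym/existsP.
exists (Some o); apply: lt_le_trans ((tP (xi o)).2).
by apply: le_lt_trans lt_o; apply: ler_wpM2l; [rewrite !mulr_ge0 // ltW|lra].
Qed.

(** A nonzero X_i has a nonzero supporting functional, to which [Khinchine] applies. Positivity
    keeps two thresholds apart: the tail estimate concerns a strict inequality, the event of the
    theorem a weak one. *)
Lemma walk_combination_norm_gt0 {R : realType} {V : normedModType R} {n : nat} (X : 'I_n -> V) h M :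
  (exists i, X i != 0) -> 0 <= h -> h ^+ 2 * M%:R = 1 ->
  0 < walk h 0 (rounds M) (combination_norm X) 0.
Proof.
move=> [i Xi] h0 hM.
have [t t1 t2] := supporting_functional _ (delta_mx 0 i) (sublinear_combination_norm X).
have Xe : combination_norm X (delta_mx 0 i) = `|X i|.
  rewrite /combination_norm (bigD1 i) //= mxE !eqxx scale1r big1 ?addr0 // => j ji.
  by rewrite mxE eqxx (negbTE ji) scale0r.
have tn : 0 < enorm t.
  have := dot_le t (delta_mx 0 i); rewrite enorm_delta mulr1; apply: lt_le_trans.
  by apply: lt_le_trans t2; rewrite Xe normr_gt0.
have := Khinchine h M hM h0 t => /(lt_le_trans _) lt0.
apply: lt_le_trans (lt0 _ _) _; first by rewrite divr_gt0.
apply: ler_walk => // [|z]; first exact: small_drift0.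
rewrite ler_norml t1 andbT lerNl -dotNr; apply: le_trans (t1 _) _.
by rewrite -scaleN1r combination_normZ normrN1 mul1r.
Qed.

(** * The tail bound for the Markov chain *)

Local Open Scope classical_set_scope.

(** Some X_i must be nonzero: if all vanish, the event reads 0 <= 0 and has probability 1, and the
    bound fails for large u when lambda < 1. *)
Theorem theorem1p3 (R : realType) :
  exists C L : R, 0 < C /\ 0 < L /\
    forall (V : completeNormedModType R) (n : nat) (X : 'I_n -> V)
      (X_neq0 : exists i, X i != 0)
      (N : nat) (A : 'M[R]_N) (p : 'I_N -> R)
      (A_stochastic : row_stochastic A)
      (p_distribution : positive_distribution p)
      (p_stationary : stationary_distribution A p)
      (d : measure_display) (W : measurableType d) (P : probability W R)
      (Y : nat -> W -> 'I_N) (Y_chain : markov_chain A p P Y)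
      (f : 'I_n -> 'I_N -> R)
      (f_bounded : forall i s, -1 <= f i s <= 1)
      (f_centered : forall i : 'I_n, ('E_P[fun w => f i (Y i w)] = 0)%E)
      (d' : measure_display) (W' : measurableType d') (Q : probability W' R)
      (g : 'I_n -> {RV Q >-> R})
      (g_gaussian : forall i, standard_gaussian Q (g i))
      (g_independent : mutually_independent Q g)
      (u : R) (u_ge0 : 0 <= u),
      let lambda := L2opnorm p (A - averaging_mx p) in
      (P [set w | ((u * C)%:E * 'E_Q[fun t => `|\sum_i g i t *: X i|%R]
                   <= `|\sum_i f i (Y i w) *: X i|%R%:E)%E]
       <= (L * expR (- (C * u ^+ 2 * (1 - lambda))))%:E)%E.
Proof.
have [kap [eta [kap0 eta0 kap_eta]]] : exists kap eta : R,
    [/\ 0 < kap, 0 < eta & (8 + kap^-1) / eta < 1 / 128 - 4 / kap].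
  (* 4 / kap is half of 1 / 128, and this eta makes the left side about a quarter of 1 / 128. *)
  by exists 1024, 4096; split; lra.
pose Cm : R := 16 + 768 * kap + 64 * (kap * eta).
have Cm0 : 0 <= Cm by have := mulr_gt0 kap0 eta0; rewrite /Cm; lra.
have cg0 := gaussian_constant_gt0 (R := R); set cg := gaussian_constant in cg0.
(* 24 is 2 * 6 from the tail bound with s = 6 / D, times 2 to separate the thresholds. *)
pose K0 := 24 * (8 + 2 * Cm) / cg.
have K00 : 0 < K0 by rewrite divr_gt0 // mulr_gt0 // ltr_wpDr // mulr_ge0.
have K0E : K0 * cg = 24 * (8 + 2 * Cm) by rewrite /K0 divfK // gt_eqF.
exists (K0 ^+ 2), (4 * expR 8); split; first by rewrite exprn_gt0.
split; first by rewrite mulr_gt0 ?expR_gt0.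
move=> V [|k] X X_neq0; first by case: X_neq0 => -[].
move=> N A p A_stochastic p_distribution p_stationary d W P Y Y_chain
  f f_bounded f_centered d' W' Q g g_gaussian g_independent u u_ge0.
lazy zeta; set lambda := L2opnorm _ _; set E := 'E_Q[_]%E.
pose xi (o : {ffun 'I_k.+1 -> 'I_N}) : 'rV[R]_k.+1 := \row_i f i (o i).
pose pr := path_prob P Y k.+1.
pose large o := ((u * K0 ^+ 2)%:E * E <= (combination_norm X (xi o))%:E)%E.
have xiE w : combination_norm X (xi (path_of Y k.+1 w)) = `|\sum_i f i (Y i w) *: X i|.
  by congr `|_|; apply: eq_bigr => i _; rewrite mxE ffunE.
have -> : [set w | ((u * K0 ^+ 2)%:E * E <= `|\sum_i f i (Y i w) *: X i|%R%:E)%E]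
    = [set w | large (path_of Y k.+1 w)].
  by apply/funext => w; rewrite /large /= xiE.
rewrite (path_event_prob A p P Y Y_chain k.+1 large) lee_fin -/pr.
have pr0 o : 0 <= pr o by exact: path_prob_ge0.
have e8 : 1 <= 4 * expR 8 :> R by have := expR_ge1Dx (8 : R); lra.
have sum_le1 : \sum_(o | large o) pr o <= 1.
  have : (\sum_(o | predT o) pr o)%:E = 1%E.
    rewrite -(path_event_prob A p P Y Y_chain k.+1 predT) -[RHS](probability_setT P).
    by congr (P _); apply/seteqP; split.
  move=> [<-]; rewrite [leRHS](bigID large) /= lerDl; exact: sumr_ge0.
have trivial_case : 1 - lambda <= 0 \/ u = 0 ->
    \sum_(o | large o) pr o <= 4 * expR 8 * expR (- (K0 ^+ 2 * u ^+ 2 * (1 - lambda))).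
  move=> triv; apply: (le_trans sum_le1).
  have : 1 <= expR (- (K0 ^+ 2 * u ^+ 2 * (1 - lambda))).
    rewrite -[leLHS]expR0 ler_expR oppr_ge0.
    case: triv => [l0|->]; last by rewrite expr0n mulr0 mul0r.
    by apply: mulr_ge0_le0 => //; apply: mulr_ge0; exact: sqr_ge0.
  by move=> e1; rewrite -[leLHS]mulr1; apply: ler_pM.
have [l1|l1] := leP 1 lambda; first by apply: trivial_case; left; lra.
have [u0|un0] := eqVneq u 0; first by apply: trivial_case; right.
have up : 0 < u by rewrite lt_def un0.
have D0 : 0 < 1 - lambda by rewrite subr_gt0.
set D := Num.sqrt (1 - lambda); have Dp : 0 < D by rewrite sqrtr_gt0.
have f1 i s : `|f i s| <= 1 by rewrite ler_norml.
have f0 i : mean p (f i) = 0.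
  have := f_centered i.
  by rewrite (expectation_marginal A p p_stationary P Y Y_chain i (f i)) => -[].
have mgf v := path_mgf A p A_stochastic p_distribution p_stationary P Y Y_chain k f v l1 f1 f0.
have s0 : 0 < 6 / D by rewrite divr_gt0.
have [h [M [h0 hM tail]]] :=
  subgaussian_norm_tail X kap eta _ pr xi (6 / D) kap0 eta0 kap_eta s0 pr0 mgf.
have w0 := walk_combination_norm_gt0 X h M X_neq0 h0 hM.
have wE := gaussian_mean_ge_walk X Q g g_gaussian g_independent h M h0 hM.
move: tail w0 wE; rewrite -/cg -/E -/Cm /=; set w := walk _ _ _ _ _ => tail w0 wE.
(* The tail bound is applied at level u K0 D: D cancels in the threshold and becomes 1 - lambda in
   the exponent. *)
have u'0 : 0 <= u * K0 * D by do 2![apply: mulr_ge0; last exact: ltW].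
have := tail _ u'0.
have -> : (u * K0 * D) ^+ 2 = K0 ^+ 2 * u ^+ 2 * (1 - lambda).
  by rewrite !exprMn sqr_sqrtr ?(ltW D0) //; ring.
apply: le_trans; set thr := 2 * _ * _ * _.
have thrE : thr < u * K0 ^+ 2 * (cg * w).
  have -> : thr = 12 * u * K0 * ((8 + 2 * Cm) * w) by rewrite /thr; field; rewrite gt_eqF.
  have -> : u * K0 ^+ 2 * (cg * w) = u * K0 * (K0 * cg) * w by ring.
  rewrite K0E; have c0 : 0 < u * K0 * ((8 + 2 * Cm) * w).
    do 2![apply: mulr_gt0 => //]; lra.
  lra.
have implied o : large o -> thr < combination_norm X (xi o).
  move=> lo; rewrite -lte_fin; apply: lt_le_trans lo.
  apply: (@lt_le_trans _ _ (u * K0 ^+ 2 * (cg * w))%:E); first by rewrite lte_fin.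
  rewrite EFinM; apply: lee_wpmul2l => //.
  by rewrite lee_fin mulr_ge0 ?sqr_ge0.
rewrite [leRHS](bigID large) /= -[leLHS]addr0; apply: lerD; last exact: sumr_ge0.
rewrite le_eqVlt; apply/orP; left; apply/eqP; apply: eq_bigl => o.
by case: (boolP (large o)) => [/implied ->|]; rewrite ?andbF.
Qed.
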